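(* Let $d\ge 2$ be an integer. For every positive integer $q$ there exist positive constants $b_q$ and $B_q$ depending on $d$ and $q$ only such that for every positive integer $n$, $$b_qn^{\frac{q(d-1)}{d+1}}\le\sup_{K\in\mathcal K_d}\mathbb E_K\left[R_n^q\right]\le B_qn^{\frac{q(d-1)}{d+1}}.$$
   Context: $\mathcal K_d$ is the class of all convex bodies in $\mathbb R^d$ (compact convex sets with nonempty interior). $\mathbb E_K$ is expectation when $X_1,\dots,X_n$ are i.i.d. uniformly distributed in $K$. $R_n$ is the number of vertices of the convex hull $\hat K_n$ of $X_1,\dots,X_n$. *)

(* Defs.v *)
From HB Require Import structures.
From mathcomp Require Import all_boot all_order all_algebra finmap.
From mathcomp Require Import all_classical all_reals all_analysis.
From mathcomp Require Import lra.

Set Implicit Arguments.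
Unset Strict Implicit.
Unset Printing Implicit Defensive.

Import Order.TTheory GRing.Theory Num.Theory.
Import numFieldNormedType.Exports.

Local Open Scope classical_set_scope.
Local Open Scope ring_scope.

Section tuple_measure.
Local Open Scope ereal_scope.
Context d (T : measurableType d) (R : realType).

(* The n-fold product measure mu \x ... \x mu, carried from iterated pairs to
   n.-tuple T.  [\x] is defined on arbitrary set functions, so this is stated
   for all mu; it is meaningful when mu is a sigma-finite measure, see
   tuple_measure_box. *)
Fixpoint tuple_measure (mu : set T -> \bar R) n : set (n.-tuple T) -> \bar R :=
  if n is m.+1 then
    pushforward (mu \x @tuple_measure mu m)
      (fun p : T * m.-tuple T => [tuple of p.1 :: p.2])
  else dirac [tuple].
Arguments tuple_measure : clear implicits.

Lemma measurable_tuple_cons n :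
  measurable_fun setT (fun p : T * n.-tuple T => [tuple of p.1 :: p.2]).
Proof. exact: measurable_cons. Qed.

Lemma measurable_tuple_uncons n :
  measurable_fun setT (fun t : n.+1.-tuple T => (thead t, [tuple of behead t])).
Proof.
by apply: measurable_fun_pair; [exact: measurable_tnth|exact: measurable_behead].
Qed.

Let mk_measure d' (U : measurableType d') (m : set U -> \bar R) : m set0 = 0 ->
  (forall A, 0 <= m A) -> semi_sigma_additive m -> sigma_finite setT m ->
  {nu : {sigma_finite_measure set U -> \bar R} | nu = m :> (_ -> _)}.
Proof.
move=> m0 mge0 madd msf.
pose M1 := isMeasure.Build _ _ _ m m0 mge0 madd.
pose Mm : {measure set U -> \bar R} := HB.pack m M1.
pose M2 := Measure_isSigmaFinite.Build _ _ _ Mm msf.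
pose Ms : {sigma_finite_measure set U -> \bar R} := HB.pack m M1 M2.
by exists Ms.
Qed.

Lemma tuple_measure_subproof (mu : {sigma_finite_measure set T -> \bar R}) n :
  {nu : {sigma_finite_measure set (n.-tuple T) -> \bar R} |
    nu = tuple_measure mu n :> (_ -> _)}.
Proof.
elim: n => [|n [nu nuE]].
  by exists (@dirac _ (0.-tuple T) [tuple] R).
pose f := fun p : T * n.-tuple T => [tuple of p.1 :: p.2].
pose h := fun t : n.+1.-tuple T => (thead t, [tuple of behead t]).
pose m := pushforward (mu \x nu) f.
have m0 : m set0 = 0 by rewrite /m /pushforward preimage_set0 measure0.
have mge0 A : 0 <= m A by apply: integral_ge0.
have madd : semi_sigma_additive m.
  move=> F mF tF mUF; rewrite /m /pushforward preimage_bigcup.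
  apply: measure_semi_sigma_additive.
  - by move=> k; rewrite -[X in measurable X]setTI; exact: measurable_tuple_cons.
  - apply/trivIsetP => /= i j _ _ ij; rewrite -preimage_setI.
    by move/trivIsetP : tF => /(_ _ _ _ _ ij) ->//; rewrite preimage_set0.
  - rewrite -preimage_bigcup -[X in measurable X]setTI.
    exact: measurable_tuple_cons.
have msf : sigma_finite setT m.
  have /sigma_finiteP[F [FT ndF Foo]] := sigma_finiteT mu.
  have /sigma_finiteP[G [GT ndG Goo]] := sigma_finiteT nu.
  exists (fun k => h @^-1` (F k `*` G k)).
    rewrite -preimage_bigcup; apply/esym/seteqP; split=> // t _.
    have : [set: T] (h t).1 by []. have : [set: n.-tuple T] (h t).2 by [].
    rewrite FT GT => -[k _ Gk] [l _ Fl]; exists (maxn k l) => //; split.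
      by move: Fl; exact/subsetPset/ndF/leq_maxr.
    by move: Gk; exact/subsetPset/ndG/leq_maxl.
  move=> k; have [mF Fk] := Foo k; have [mG Gk] := Goo k; split.
    rewrite -[X in measurable X]setTI; apply: measurable_tuple_uncons => //.
    exact: measurableX.
  rewrite /m /pushforward -comp_preimage (_ : h \o f = id).
    by rewrite product_measure1E// lte_mul_pinfty// ge0_fin_numE.
  by apply/funext => -[x t]; rewrite /h /f/= theadE; congr pair; exact: val_inj.
by have [nu' nu'E] := mk_measure m0 mge0 madd msf; exists nu'; rewrite nu'E /= -nuE.
Qed.

Section sigma_finite.
Variables (mu : {sigma_finite_measure set T -> \bar R}) (n : nat).

Let nu := proj1_sig (tuple_measure_subproof mu n).

Let nuE : nu = tuple_measure mu n :> (_ -> _).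
Proof. exact: (proj2_sig (tuple_measure_subproof mu n)). Qed.

Let tuple_measure0 : tuple_measure mu n set0 = 0.
Proof. by rewrite -nuE measure0. Qed.

Let tuple_measure_ge0 A : 0 <= tuple_measure mu n A.
Proof. by rewrite -nuE measure_ge0. Qed.

Let tuple_measure_additive : semi_sigma_additive (tuple_measure mu n).
Proof. by rewrite -nuE; exact: measure_semi_sigma_additive. Qed.

HB.instance Definition _ := isMeasure.Build _ _ _ (tuple_measure mu n)
  tuple_measure0 tuple_measure_ge0 tuple_measure_additive.

Let tuple_measure_sigma_finite : sigma_finite setT (tuple_measure mu n).
Proof. by rewrite -nuE; exact: sigma_finiteT. Qed.

HB.instance Definition _ := Measure_isSigmaFinite.Build _ _ _
  (tuple_measure mu n) tuple_measure_sigma_finite.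

End sigma_finite.

Lemma tuple_measure_box (mu : {sigma_finite_measure set T -> \bar R}) n
    (A : 'I_n -> set T) : (forall i, measurable (A i)) ->
  tuple_measure mu n [set t | forall i, A i (tnth t i)] = \prod_(i < n) mu (A i).
Proof.
elim: n A => [|n IH] A mA.
  by rewrite big_ord0 /= diracE mem_set// => -[].
rewrite big_ord_recl -IH//= /pushforward.
rewrite -(@product_measure1E _ _ _ _ _ mu (tuple_measure mu n))//; last first.
  rewrite (_ : mkset _ = \bigcap_(i in [set: 'I_n])
     ((@tnth n T)^~ i @^-1` A (lift ord0 i))).
    apply: fin_bigcap_measurable => // i _.
    by rewrite -[X in measurable X]setTI; exact: measurable_tnth.
  by apply/seteqP; split=> t /= h i; [move=> _|]; exact: h.
congr (_ \x _); apply/seteqP; split=> -[x t] /= h.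
  split; first by have := h ord0; rewrite tnth0.
  by move=> i; have := h (lift ord0 i); rewrite tnthS.
by move=> i; case: (unliftP ord0 i) => [j|] ->; rewrite ?tnthS ?tnth0; case: h.
Qed.

End tuple_measure.
Arguments tuple_measure {d T R} mu n A.

(* Joint law of n independent random points with common law P.  Not declared
   as a probability on tuple_measure itself, since that would shadow its
   sigma-finite instance. *)
Definition iid_law d (T : measurableType d) (R : realType) (P : probability T R)
  n : set (n.-tuple T) -> \bar R := tuple_measure P n.

Arguments iid_law {d T R} P n A.

Section iid_law.
Context d (T : measurableType d) (R : realType) (P : probability T R) (n : nat).

HB.instance Definition _ := Measure.copy (iid_law P n)
  (tuple_measure P n).

Let iid_lawT : iid_law P n [set: n.-tuple T] = 1%E.
Proof.
rewrite /iid_law (_ : setT = [set t | forall i, [set: T] (tnth t i)]).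
  rewrite (@tuple_measure_box _ _ _ P n (fun=> setT))// big1// => i _.
  exact: probability_setT.
by apply/seteqP; split.
Qed.

HB.instance Definition _ := Measure_isProbability.Build _ _ _ (iid_law P n)
  iid_lawT.

End iid_law.

Section borel_rV.
Context (R : realType) (d : nat).

HB.instance Definition _ := @isMeasurable.Build (sigma_display (@open 'rV[R]_d))
  'rV[R]_d <<s @open 'rV[R]_d >>
  (@sigma_algebra0 _ setT _) (@sigma_algebraC _ _) (@sigma_algebra_bigcup _ setT _).

Lemma open_measurable_rV (U : set 'rV[R]_d) : open U -> measurable U.
Proof. exact: sub_sigma_algebra. Qed.

Lemma closed_measurable_rV (U : set 'rV[R]_d) : closed U -> measurable U.
Proof.
by move=> cU; rewrite -(setCK U); apply: measurableC; apply: open_measurable_rV;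
   rewrite openC.
Qed.

Definition row_of_tuple (t : d.-tuple (measurableTypeR R)) : 'rV[R]_d :=
  \row_i tnth t i.

Lemma measurable_row_of_tuple : measurable_fun setT row_of_tuple.
Proof.
apply: (@measurability _ _ _ _ _ _ (@open 'rV[R]_d)) => //.
move=> _ [U oU <-]; rewrite setTI.
pose box (q : d.-tuple (rat * rat)) : set 'rV[R]_d :=
  [set v | forall i, v ord0 i \in `]ratr (tnth q i).1, ratr (tnth q i).2[].
pose F q := [set t | box q `<=` U /\ box q (row_of_tuple t)].
rewrite (_ : _ @^-1` U = \bigcup_q F q); last first.
  apply/seteqP; split => [t /= Ut|t [q _ []]]; last by move=> /[apply].
  have /nbhs_ballP[e /= e0 xeU] : nbhs (row_of_tuple t) U.
    exact: open_nbhs_nbhs.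
  have ratb i : {q : rat * rat | (tnth t i \in `]ratr q.1, ratr q.2[) /\
      forall z : R, z \in `]ratr q.1, ratr q.2[ -> ball (tnth t i : R) e z}.
    apply: cid; set x : R := tnth t i.
    have [|q1 q1P] := @rat_in_itvoo R (x - e) x; first by rewrite ltrBlDr ltrDl.
    have [|q2 q2P] := @rat_in_itvoo R x (x + e); first by rewrite ltrDl.
    exists (q1, q2) => /=; move: q1P q2P; rewrite !in_itv/=.
    move=> /andP[q1a q1b] /andP[q2a q2b]; split; first by rewrite q1b q2a.
    move=> z; rewrite in_itv/= => /andP[z1 z2].
    by rewrite -ball_normE/= ltr_norml; apply/andP; split; lra.
  exists [tuple (sval (ratb i)) | i < d] => //; split.
    move=> v vq; apply: xeU; split => // j i; rewrite ord1 mxE.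
    by have [_] := svalP (ratb i); apply; have := vq i; rewrite tnth_mktuple.
  by move=> i; rewrite mxE tnth_mktuple; have [] := svalP (ratb i).
apply: countable_bigcupT_measurable; first exact: countableP.
move=> q; have [qU|nqU] := pselect (box q `<=` U); last first.
  by rewrite (_ : F q = set0)//; apply/seteqP; split => // t [].
rewrite (_ : F q = \bigcap_(i in [set: 'I_d]) ((@tnth d _)^~ i @^-1`
     `]ratr (tnth q i).1, ratr (tnth q i).2[%classic)).
  apply: fin_bigcap_measurable => // i _.
  rewrite -[X in measurable X]setTI; apply: measurable_tnth => //.
apply/seteqP; split=> t.
  by move=> [_ tq] i _ /=; have := tq i; rewrite mxE.
by move=> tq; split=> // i; rewrite mxE; exact: tq.
Qed.

Definition lebesgue_measure_rV : set 'rV[R]_d -> \bar R :=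
  pushforward (tuple_measure (@lebesgue_measure R) d) row_of_tuple.

Let lebesgue_measure_rV0 : lebesgue_measure_rV set0 = 0%E.
Proof. by rewrite /lebesgue_measure_rV /pushforward preimage_set0 measure0. Qed.

Let lebesgue_measure_rV_ge0 A : (0 <= lebesgue_measure_rV A)%E.
Proof. by rewrite /lebesgue_measure_rV /pushforward measure_ge0. Qed.

Let lebesgue_measure_rV_additive : semi_sigma_additive lebesgue_measure_rV.
Proof.
move=> F mF tF mUF; rewrite /lebesgue_measure_rV /pushforward preimage_bigcup.
apply: measure_semi_sigma_additive.
- move=> k; rewrite -[X in measurable X]setTI; exact: measurable_row_of_tuple.
- apply/trivIsetP => /= i j _ _ ij; rewrite -preimage_setI.
  by move/trivIsetP : tF => /(_ _ _ _ _ ij) ->//; rewrite preimage_set0.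
- rewrite -preimage_bigcup -[X in measurable X]setTI.
  exact: measurable_row_of_tuple.
Qed.

HB.instance Definition _ := isMeasure.Build _ _ _ lebesgue_measure_rV
  lebesgue_measure_rV0 lebesgue_measure_rV_ge0 lebesgue_measure_rV_additive.

Lemma measurable_box_rV (a b : 'I_d -> R) :
  measurable [set v : 'rV[R]_d | forall i, v ord0 i \in `[a i, b i]].
Proof.
rewrite (_ : mkset _ = \bigcap_(i in [set: 'I_d])
   ((fun v : 'rV[R]_d => v ord0 i) @^-1` `[a i, b i]%classic)).
  apply: closed_measurable_rV; apply: closed_bigI => i _.
  apply: closed_comp; last exact: interval_closed.
  by move=> v _; exact: coord_continuous.
by apply/seteqP; split=> v h i; [move=> _|]; exact: h.
Qed.

Lemma lebesgue_measure_rV_box (a b : 'I_d -> R) : (forall i, a i <= b i) ->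
  lebesgue_measure_rV [set v | forall i, v ord0 i \in `[a i, b i]] =
  (\prod_i (b i - a i))%:E.
Proof.
move=> ab; rewrite /lebesgue_measure_rV /pushforward.
rewrite (_ : _ @^-1` _ = [set t | forall i, `[a i, b i]%classic (tnth t i)]).
  rewrite (@tuple_measure_box _ _ _ (@lebesgue_measure R) d
    (fun i => `[a i, b i]%classic)); last by move=> i; exact: measurable_itv.
  rewrite -prodEFin; apply: eq_bigr => i _.
  rewrite [LHS]lebesgue_measure_itv/= lte_fin.
  by have := ab i; rewrite le_eqVlt => /predU1P[->|->]//; rewrite ltxx subrr.
by apply/seteqP; split => t /= h i; have := h i; rewrite mxE.
Qed.

End borel_rV.

Section convex_body.
Context (R : realType) (d : nat).

Record convex_body := ConvexBody {
  body :> set 'rV[R]_d ;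
  body_compact : compact body ;
  body_convex : convex_set body ;
  body_interior : body° !=set0 }.

Lemma measurable_body (K : convex_body) : measurable (K : set _).
Proof.
apply: closed_measurable_rV; apply: compact_closed; last exact: body_compact.
exact: norm_hausdorff.
Qed.

Lemma lebesgue_body_lty (K : convex_body) : (lebesgue_measure_rV K < +oo)%E.
Proof.
have [M [Mr KM]] := compact_bounded (body_compact (c := K)).
pose c := `|M| + 1.
have Mc : M < c by rewrite /c (le_lt_trans (ler_norm _))// ltrDl.
pose b := [set v : 'rV[R]_d | forall i, v ord0 i \in `[- c, c]].
have mb : measurable b by exact: measurable_box_rV.
apply: (@le_lt_trans _ _ (lebesgue_measure_rV b)).
  apply: le_measure; rewrite ?inE//; first exact: measurable_body.
  move=> v Kv i; rewrite in_itv/= -ler_norml; apply: le_trans (KM c Mc v Kv).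
  rewrite [leRHS]/Num.norm/= mx_normrE.
  by apply: (le_bigmax _ (fun ij => `|v ij.1 ij.2|) (ord0, i)).
rewrite lebesgue_measure_rV_box ?ltry// => _.
by rewrite lerNl (@le_trans _ _ 0)// ?oppr_le0 addr_ge0.
Qed.

Lemma lebesgue_body_gt0 (K : convex_body) : (0 < lebesgue_measure_rV K)%E.
Proof.
have [x /nbhs_ballP[e /= e0 xeK]] := body_interior K.
pose b := [set v : 'rV[R]_d |
  forall i, v ord0 i \in `[x ord0 i - e / 2, x ord0 i + e / 2]].
have bK : b `<=` K.
  move=> v vb; apply: xeK; split=> // j i; rewrite ord1.
  have := vb i; rewrite in_itv/= => /andP[h1 h2].
  by rewrite -ball_normE/= ltr_norml; apply/andP; split; lra.
have mb : measurable b by exact: measurable_box_rV.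
apply: (@lt_le_trans _ _ (lebesgue_measure_rV b)); last first.
  by apply: le_measure; rewrite ?inE//; exact: measurable_body.
rewrite lebesgue_measure_rV_box => [|i]; last by lra.
by rewrite lte_fin; apply: prodr_gt0 => i _; lra.
Qed.

Definition uniform_law (K : convex_body) : set 'rV[R]_d -> \bar R :=
  fun A => (lebesgue_measure_rV (A `&` K) *
            (fine (lebesgue_measure_rV K))^-1%:E)%E.

Section uniform_law.
Variable K : convex_body.

Let uniform_law0 : uniform_law K set0 = 0%E.
Proof. by rewrite /uniform_law set0I measure0 mul0e. Qed.

Let uniform_law_ge0 A : (0 <= uniform_law K A)%E.
Proof.
by rewrite /uniform_law mule_ge0// lee_fin invr_ge0 fine_ge0.
Qed.

Let uniform_law_additive : semi_sigma_additive (uniform_law K).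
Proof.
move=> F mF tF mUF; rewrite /uniform_law.
under eq_fun do rewrite -ge0_sume_distrl//.
apply: cvgeZr => //.
exact: (@measure_semi_sigma_additive _ _ _
  (mrestr (@lebesgue_measure_rV R d) (measurable_body K)) F).
Qed.

HB.instance Definition _ := isMeasure.Build _ _ _ (uniform_law K)
  uniform_law0 uniform_law_ge0 uniform_law_additive.

Let uniform_lawT : uniform_law K setT = 1%E.
Proof.
rewrite /uniform_law setTI.
have K0 := lebesgue_body_gt0 K; have Koo := lebesgue_body_lty K.
have Kfin : lebesgue_measure_rV K \is a fin_num by rewrite ge0_fin_numE.
rewrite -[X in (X * _)%E]fineK// -EFinM divff// gt_eqF//.
by rewrite fine_gt0// K0.
Qed.

HB.instance Definition _ := Measure_isProbability.Build _ _ _ (uniform_law K)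
  uniform_lawT.

End uniform_law.

End convex_body.

Section convex_hull.
Context (R : realType) (M : lmodType R).
Implicit Type A P : set M.

Definition convex_hull A : set M :=
  \bigcap_(C in [set C : set M | convex_set C /\ A `<=` C]) C.

(* The vertices of a polytope are its extreme points. *)
Definition extreme_points P : set M :=
  [set v | P v /\ forall (x y : M) (t : R), P x -> P y -> 0 < t < 1 ->
    v = t *: x + (1 - t) *: y -> x = v /\ y = v].

Lemma extreme_points_hull A : extreme_points (convex_hull A) `<=` A.
Proof.
move=> v [hv ev]; apply: contrapT => nAv.
have : (convex_hull A `\ v) v; last by case=> _; apply.
apply: hv; split; last first.
  move=> a Aa; split; first by move=> C [_]; exact.
  by move=> av; apply: nAv; rewrite -av.
apply/convex_setW => x y /set_mem[hx xv] /set_mem[hy yv] k k0 k1.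
apply/mem_set; split.
  move=> C AC; have [cC _] := AC; apply/set_mem.
  by apply: cC; apply/mem_set; [exact: hx|exact: hy].
by move=> /esym kv; apply: xv; have [] := ev x y k%:num hx hy _ kv;
  rewrite ?k0.
Qed.

End convex_hull.

Definition n_vertices (R : realType) (d n : nat) (x : n.-tuple 'rV[R]_d) : nat :=
  #|` fset_set (extreme_points (convex_hull [set` x])) |.

(* fset_set is set0 on infinite sets; this does not occur in n_vertices. *)
Lemma finite_vertices (R : realType) (d n : nat) (x : n.-tuple 'rV[R]_d) :
  finite_set (extreme_points (convex_hull [set` x])).
Proof. exact: sub_finite_set (@extreme_points_hull _ _ _) (finite_seq x). Qed.

(* Main.v *)
Require Import Defs.
From HB Require Import structures.
From mathcomp Require Import all_boot all_order all_algebra finmap perm.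
From mathcomp Require Import all_classical all_reals all_analysis measurable_realfun.
From mathcomp Require Import ring lra zify.

(** Why the order is [n ^ (q (d - 1) / (d + 1))].  Let [k] be the integer part of
    the [(d + 1)]-st root of [n] ([nat_root]); in every moment the number of
    vertices is of order [k ^ (d - 1)], that is, [n / k ^ 2].

    Upper bound.  If each of the [2 ^ d] orthants of a parallelotope centred at
    [x] contains a sample point, then [x] is a convex combination of these points
    ([orthant_trap]) and cannot be a vertex.  This happens with good probability
    when the parallelotope lies in [K] and has measure at least of order [1 / n].
    After an affine change of coordinates [K] lies between two cubes
    ([affine_position]) and is the unit ball of a gauge [g].  At a point [x] of
    depth [delta = 1 - g x] between [D ^ j / k ^ 2] and [D ^ (j + 1) / k ^ 2],
    where [D = 4 ^ (d - 1)], take one edge along [x] of length of order [delta],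
    and [d - 1] edges of length of order [1 / (k 2 ^ j)] along the coordinate
    axes, tilted along [x]: the volume is at least of order
    [2 ^ j / k ^ (d + 1)].  The parallelotope stays in [K] as soon as the second
    differences of [g] at the scale of the edges are below [delta]
    ([tilted_segment], [cross_polytope]).  Second differences telescope along a
    line, so they are large on a small set only ([second_diff_volume]); by
    homogeneity a thin layer gets its share of that set ([layer_volume]).
    Altogether the points of [K] without a parallelotope have measure of order
    [k ^ -2] ([cell_cover_uniform]).

    The points of the layer [j] have measure of order [D ^ j / k ^ 2], and the
    probability that a sample misses one of the orthants at such a point decays
    exponentially in [2 ^ j]; so the set of points left exposed by a sample has
    measure of order [k ^ -2], in all moments ([exposed_moment]).  Now split the
    sample in two halves.  A vertex in one half is exposed by the other half
    ([n_vertices_cat]); given the other half, the number of such points is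
    binomial, and its moments are controlled by its factorial moments
    ([hits_moment]).  Hence the moment of order [q] is at most of order
    [1 + (n / k ^ 2) ^ q] ([vertices_upper]).

    Lower bound.  Let [K] be the part below height 1 of the paraboloid whose
    height is the squared norm of the base point.  The tangent planes over the
    points of a grid with [k ^ (d - 1)] points, raised by an amount of order
    [k ^ -2], cut off disjoint caps ([cap_disjoint]) of measure at least of order
    [k ^ -(d + 1)], hence of [1 / n] ([cap_probability]).  Each cap is hit by the
    sample with probability bounded below ([hit_event_probability]), and then it
    contains a vertex ([vertex_in_halfspace]), different caps containing different
    vertices.  So the expected number of vertices is at least of order
    [k ^ (d - 1)], and higher moments follow by convexity ([hit_moment]). *)

Set Implicit Arguments.
Unset Strict Implicit.
Unset Printing Implicit Defensive.

Import Order.TTheory GRing.Theory Num.Theory.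
Import numFieldNormedType.Exports.

Local Open Scope classical_set_scope.
Local Open Scope ring_scope.

(** * Lebesgue measure under affine maps *)

Lemma lebesgue_measure_shift (R : realType) (c : R) (A : set (measurableTypeR R)) :
  measurable A ->
  lebesgue_measure ((fun x : measurableTypeR R => x + c : measurableTypeR R) @^-1` A)
  = lebesgue_measure A.
Proof.
set mR := measurableTypeR R; move=> mA.
have mf : measurable_fun setT (fun x : measurableTypeR R => x + c : measurableTypeR R).
  by apply: measurable_funD => //.
pose Mm : {measure set mR -> \bar R} :=
  measure_function_pushforward__canonical__measure_function_Measure
    (@lebesgue_measure R) mf.
suff : lebesgue_measure A = Mm A by move=> ->.
apply: lebesgue_measure_unique => // _ [[a b] _ <-] /=.
rewrite /pushforward /=.
rewrite (_ : _ @^-1` _ = `]a - c, b - c]%classic); last first.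
  by apply/seteqP; split=> x /=; rewrite !in_itv/= ltrBlDr lerBrDr.
rewrite !lebesgue_measure_itv/= !lte_fin ltrD2r.
by case: ifP => // _; rewrite -EFinB; congr EFin; ring.
Qed.

Section tuple_shift.
Context (R : realType).
Local Notation mR := (measurableTypeR R).

Definition tuple_shift d (w t : d.-tuple mR) : d.-tuple mR :=
  [tuple (tnth t i + tnth w i : mR) | i < d].

Lemma tuple_shift_cons d (w : d.+1.-tuple mR) x (t : d.-tuple mR) :
  tuple_shift w [tuple of x :: t] =
  [tuple of (x + thead w : mR) :: tuple_shift [tuple of behead w] t].
Proof.
apply: eq_from_tnth => i; rewrite tnth_mktuple.
case: (unliftP ord0 i) => [j|] ->; last by rewrite !tnth0.
rewrite !tnthS tnth_mktuple; congr (_ + _).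
by rewrite tnth_behead; congr tnth; apply/val_inj; rewrite /= inordK ?ltnS.
Qed.

Lemma tuple_measure_shift d (w : d.-tuple mR) (A : set (d.-tuple mR)) :
  measurable A ->
  tuple_measure (@lebesgue_measure R) d (tuple_shift w @^-1` A) =
  tuple_measure (@lebesgue_measure R) d A.
Proof.
elim: d w A => [|d IH] w A mA.
  congr (tuple_measure _ _ _); apply/seteqP; split=> t /=;
    by rewrite (tuple0 (tuple_shift _ _)) (tuple0 t).
rewrite /= /pushforward /product_measure1.
set mu := @lebesgue_measure R; set nu := tuple_measure mu d.
pose A' := (fun p : mR * d.-tuple mR => [tuple of p.1 :: p.2]) @^-1` A.
have mA' : measurable A'.
  by rewrite -[A']setTI; exact: measurable_tuple_cons.
pose h := fun x => nu (xsection A' x).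
have mh : measurable_fun setT h by exact: measurable_fun_xsection.
pose sh (x : mR) : mR := x + thead w.
transitivity (\int[mu]_x (h \o sh) x)%E.
  apply: eq_integral => x _ /=.
  rewrite /h /nu -[RHS](IH [tuple of behead w]); last exact: measurable_xsection.
  congr (tuple_measure _ _ _); apply/seteqP; split => t; rewrite /xsection /= !inE /=;
    by rewrite /A' /= tuple_shift_cons.
have msh : measurable_fun setT sh by apply: measurable_funD.
rewrite -(@ge0_integral_pushforward _ _ _ _ R _ msh mu setT h)//.
by apply: eq_measure_integral => // B mB _; exact: lebesgue_measure_shift.
Qed.

End tuple_shift.

Section rV_measurability.
Context (R : realType) (d : nat).
Local Notation mR := (measurableTypeR R).

Lemma continuous_measurable_rV (f : 'rV[R]_d -> R) :
  continuous f -> measurable_fun setT (f : 'rV[R]_d -> mR).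
Proof.
move=> cf; apply: (@measurability _ _ _ _ _ _ (@RGenOpens.G R)).
  exact: RGenOpens.measurableE.
move=> _ [_ [a [b ->]] <-]; rewrite setTI; apply: open_measurable_rV.
by apply: open_comp => // v _; exact: cf.
Qed.

Lemma measurable_coord_rV (i : 'I_d) :
  measurable_fun setT (fun v : 'rV[R]_d => v ord0 i : mR).
Proof. by apply: continuous_measurable_rV => v; exact: coord_continuous. Qed.

Lemma measurable_rVP d' (T : measurableType d') (f : T -> 'rV[R]_d) :
  (forall i, measurable_fun setT (fun x => f x ord0 i : mR)) ->
  measurable_fun setT f.
Proof.
move=> mf; rewrite (_ : f = (@row_of_tuple R d) \o
    (fun x => [tuple (f x ord0 i : mR) | i < d])); last first.
  by apply/funext => x /=; apply/rowP => i; rewrite mxE tnth_mktuple.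
apply: measurableT_comp; first exact: measurable_row_of_tuple.
apply/measurable_fun_tnthP => i.
by rewrite (_ : _ \o _ = fun x => f x ord0 i)//; apply/funext => x /=;
  rewrite tnth_mktuple.
Qed.

Lemma measurable_funD_rV d' (T : measurableType d') (f g : T -> 'rV[R]_d) :
  measurable_fun setT f -> measurable_fun setT g ->
  measurable_fun setT (fun x => f x + g x).
Proof.
move=> mf mg; apply: measurable_rVP => i.
rewrite (_ : (fun _ => _) = (fun x => f x ord0 i + g x ord0 i)); last first.
  by apply/funext => x; rewrite mxE.
by apply: measurable_funD;
  apply: (@measurableT_comp _ _ _ _ _ _ (fun v : 'rV[R]_d => v ord0 i : mR)) => //;
  exact: measurable_coord_rV.
Qed.

Lemma measurable_funZ_rV d' (T : measurableType d') (a : T -> mR)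
    (f : T -> 'rV[R]_d) :
  measurable_fun setT a -> measurable_fun setT f ->
  measurable_fun setT (fun x => a x *: f x).
Proof.
move=> ma mf; apply: measurable_rVP => i.
rewrite (_ : (fun _ => _) = (fun x => (a x : R) * f x ord0 i)); last first.
  by apply/funext => x; rewrite mxE.
apply: measurable_funM => //.
by apply: (@measurableT_comp _ _ _ _ _ _ (fun v : 'rV[R]_d => v ord0 i : mR)) => //;
  exact: measurable_coord_rV.
Qed.

Lemma measurable_funM_rV d' (T : measurableType d') (f : T -> 'rV[R]_d)
    (M : 'M[R]_d) :
  measurable_fun setT f -> measurable_fun setT (fun x => f x *m M).
Proof.
move=> mf; apply: measurable_rVP => i.
rewrite (_ : (fun _ => _) = (fun x => \sum_j f x ord0 j * M j i)); last first.
  by apply/funext => x; rewrite mxE.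
apply: measurable_sum => j; apply: measurable_funM => //.
by apply: (@measurableT_comp _ _ _ _ _ _ (fun v : 'rV[R]_d => v ord0 j : mR)) => //;
  exact: measurable_coord_rV.
Qed.

End rV_measurability.

Section lebesgue_rV.
Context (R : realType) (d : nat).
Local Notation mR := (measurableTypeR R).
Local Notation lam := (@lebesgue_measure_rV R d).

Lemma lebesgue_rV_prod (A : 'I_d -> set mR) : (forall i, measurable (A i)) ->
  lam [set v | forall i, A i (v ord0 i)] =
  (\prod_i @lebesgue_measure R (A i))%E.
Proof.
move=> mA; rewrite -(@tuple_measure_box _ _ _ (@lebesgue_measure R) d A)//.
rewrite /lebesgue_measure_rV /pushforward; congr tuple_measure.
by apply/seteqP; split => t /= h i; have := h i; rewrite mxE.
Qed.

Lemma measurable_prod_rV (A : 'I_d -> set mR) : (forall i, measurable (A i)) ->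
  measurable [set v : 'rV[R]_d | forall i, A i (v ord0 i)].
Proof.
move=> mA; rewrite (_ : mkset _ = \bigcap_(i in [set: 'I_d])
   ((fun v : 'rV[R]_d => v ord0 i : mR) @^-1` A i)).
  apply: fin_bigcap_measurable => // i _.
  by rewrite -[X in measurable X]setTI; exact: measurable_coord_rV.
by apply/seteqP; split=> v h i; [move=> _|]; exact: h.
Qed.

Lemma lebesgue_rV_sigma_finite : sigma_finite setT lam.
Proof.
exists (fun n => [set v : 'rV[R]_d | forall i, v ord0 i \in `[- n%:R, n%:R]]).
  apply/esym/seteqP; split=> // v _.
  have [n vn] : exists n : nat, forall i, `|v ord0 i| <= n%:R.
    exists (Num.truncn (\sum_i `|v ord0 i|)).+1 => i.
    apply: (@le_trans _ _ (\sum_i `|v ord0 i|)); last exact/ltW/truncnS_gt.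
    by rewrite (bigD1 i)//= lerDl sumr_ge0.
  by exists n => // i; rewrite in_itv/= -ler_norml.
move=> n; split; first exact: measurable_box_rV.
rewrite lebesgue_measure_rV_box ?ltry// => i.
by rewrite lerNl (@le_trans _ _ 0)// oppr_le0.
Qed.

HB.instance Definition _ := Measure_isSigmaFinite.Build _ _ _ lam
  lebesgue_rV_sigma_finite.

Lemma lebesgue_rV_shift (w : 'rV[R]_d) (A : set 'rV[R]_d) : measurable A ->
  lam ((fun v => v + w) @^-1` A) = lam A.
Proof.
move=> mA; rewrite /lebesgue_measure_rV /pushforward.
set A' := @row_of_tuple R d @^-1` A.
have mA' : measurable A'.
  by rewrite -[A']setTI; exact: measurable_row_of_tuple.
rewrite -[RHS](tuple_measure_shift [tuple (w ord0 i : mR) | i < d])//.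
congr tuple_measure; suff H t : row_of_tuple t + w = row_of_tuple
   (tuple_shift [tuple (w ord0 i : mR) | i < d] t).
  by apply/seteqP; split=> t; rewrite /A' /= H.
by apply/rowP => i; rewrite !mxE !tnth_mktuple.
Qed.

Lemma product_measure_swap d1 d2 (T1 : measurableType d1)
    (T2 : measurableType d2) (m1 : {sigma_finite_measure set T1 -> \bar R})
    (m2 : {sigma_finite_measure set T2 -> \bar R}) (X : set (T1 * T2)) :
  measurable X ->
  (\int[m1]_x m2 (xsection X x) = \int[m2]_y m1 (ysection X y))%E.
Proof.
move=> mX; rewrite -[LHS]/((m1 \x m2)%E X) -[RHS]/((m1 \x^ m2)%E X).
by apply: product_measure_unique => //= A B mA mB; rewrite product_measure2E.
Qed.

(** A classical argument of Weil: compute in two ways the measure of the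
    pairs [(x, y)] with [x] in [A] and [x + y] in [B]. *)
Lemma shift_invariant_exchange (nu : {sigma_finite_measure set 'rV[R]_d -> \bar R})
    (A B : set 'rV[R]_d) :
  (forall (w : 'rV[R]_d) (C : set 'rV[R]_d), measurable C ->
      nu ((fun v => v + w) @^-1` C) = nu C) ->
  measurable A -> measurable B ->
  (nu A * lam B = nu B * lam (-%R @^-1` A))%E.
Proof.
move=> nush mA mB.
have mN : measurable_fun setT (fun v : 'rV[R]_d => - v).
  rewrite (_ : (fun _ => _) = fun v : 'rV[R]_d => (-1) *: v); last first.
    by apply/funext => v; rewrite scaleN1r.
  by apply: measurable_funZ_rV => //; exact: measurable_cst.
pose X := [set p : 'rV[R]_d * 'rV[R]_d | A p.1 /\ B (p.1 + p.2)].
have mX : measurable X.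
  apply: measurableI.
    by rewrite -[X in measurable X]setTI; exact: measurable_fst.
  rewrite -[X in measurable X]setTI.
  by apply: (measurable_funD_rV measurable_fst measurable_snd).
pose Y := [set p : 'rV[R]_d * 'rV[R]_d | B p.1 /\ A (p.1 - p.2)].
have mY : measurable Y.
  apply: measurableI.
    by rewrite -[X in measurable X]setTI; exact: measurable_fst.
  rewrite -[X in measurable X]setTI.
  apply: (measurable_funD_rV measurable_fst) => //.
  by apply: measurableT_comp => //; exact: measurable_snd.
have mNA : measurable (-%R @^-1` A : set 'rV[R]_d).
  by rewrite -[X in measurable X]setTI; exact: mN.
transitivity (\int[nu]_x lam (xsection X x))%E.
  rewrite -[in LHS](setIT A) -integral_indic// -ge0_integralZr//; last first.
    by apply/measurable_EFinP.
  apply: eq_integral => x _; rewrite indicE.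
  have [Ax|nAx] := pselect (A x).
    rewrite mem_set// mul1e -(lebesgue_rV_shift x mB); congr (lam _).
    by apply/seteqP; split => y; rewrite /xsection /= !inE /X /= addrC => // -[].
  rewrite memNset// mul0e (_ : xsection X x = set0) ?measure0//.
  by apply/seteqP; split=> // y; rewrite /xsection /= !inE /X /= => -[].
rewrite product_measure_swap//.
transitivity (\int[lam]_y nu (ysection Y y))%E.
  apply: eq_integral => y _; rewrite -(nush y (ysection Y y)); last first.
    exact: measurable_ysection.
  congr (nu _); apply/seteqP; split => x;
    by rewrite /ysection /= !inE /X /Y /= addrK => -[].
rewrite -product_measure_swap//.
rewrite -[in RHS](setIT B) -integral_indic// -ge0_integralZr//; last first.
  by apply/measurable_EFinP.
apply: eq_integral => x _; rewrite indicE.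
have [Bx|nBx] := pselect (B x).
  rewrite mem_set// mul1e -(lebesgue_rV_shift (- x) mNA); congr (lam _).
  by apply/seteqP; split => y; rewrite /xsection /= !inE /Y /= opprB addrC => // -[].
rewrite memNset// mul0e (_ : xsection Y x = set0) ?measure0//.
by apply/seteqP; split=> // y; rewrite /xsection /= !inE /Y /= => -[].
Qed.

Definition unit_cube : set 'rV[R]_d := [set v | forall i, v ord0 i \in `[0, 1]].

Lemma measurable_unit_cube : measurable unit_cube.
Proof. exact: measurable_box_rV. Qed.

Lemma lebesgue_unit_cube : lam unit_cube = 1%E.
Proof.
rewrite lebesgue_measure_rV_box//; congr EFin.
by apply: big1 => i _; rewrite subr0.
Qed.

(** Exchange [nu] with Lebesgue measure, then Lebesgue measure with itself: this
    also shows that reflection preserves Lebesgue measure. *)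
Lemma shift_invariant_unique (nu : {sigma_finite_measure set 'rV[R]_d -> \bar R})
    (A : set 'rV[R]_d) :
  (forall (w : 'rV[R]_d) (C : set 'rV[R]_d), measurable C ->
      nu ((fun v => v + w) @^-1` C) = nu C) ->
  measurable A -> (nu A = nu unit_cube * lam A)%E.
Proof.
move=> nush mA.
have := shift_invariant_exchange nush mA measurable_unit_cube.
rewrite lebesgue_unit_cube mule1 => ->; congr (_ * _)%E.
have := @shift_invariant_exchange lam A _ lebesgue_rV_shift mA measurable_unit_cube.
by rewrite lebesgue_unit_cube mule1 => ->; rewrite [X in (X * _)%E]lebesgue_unit_cube mul1e.
Qed.

End lebesgue_rV.

Lemma sigma_finite_pack d (T : measurableType d) (R : realType)
    (m : set T -> \bar R) (m0 : m set0 = 0%E) (mge0 : forall A, (0 <= m A)%E)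
    (madd : semi_sigma_additive m) (msf : sigma_finite setT m) :
  {nu : {sigma_finite_measure set T -> \bar R} | nu = m :> (_ -> _)}.
Proof.
pose M1 := isMeasure.Build _ _ _ m m0 mge0 madd.
pose Mm : {measure set T -> \bar R} := HB.pack m M1.
pose M2 := Measure_isSigmaFinite.Build _ _ _ Mm msf.
pose Ms : {sigma_finite_measure set T -> \bar R} := HB.pack m M1 M2.
by exists Ms.
Qed.

Section jacobian.
Context (R : realType) (d : nat).
Local Notation lam := (@lebesgue_measure_rV R d).
Implicit Types S T N H : 'M[R]_d.

(** The factor by which an invertible [T] scales volumes, that is, the absolute
    value of its determinant.  It is computed below on diagonal matrices and on
    shears, which generate the matrices of the parallelotopes. *)
Definition jac T : R := fine (lam ((fun v => v *m invmx T) @^-1` @unit_cube R d)).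

Lemma measurable_mulmx_preimage M (A : set 'rV[R]_d) : measurable A ->
  measurable ((fun v : 'rV[R]_d => v *m M) @^-1` A).
Proof.
by move=> mA; rewrite -[X in measurable X]setTI; apply: measurable_funM_rV.
Qed.

(** The image measure is again invariant under translations. *)
Lemma jacP T : T \in unitmx -> 0 < jac T /\ forall A, measurable A ->
  lam ((fun v => v *m invmx T) @^-1` A) = ((jac T)%:E * lam A)%E.
Proof.
move=> uT; set f := fun v : 'rV[R]_d => v *m invmx T.
have mf : measurable_fun setT f by apply: measurable_funM_rV.
pose nu0 : {measure set 'rV[R]_d -> \bar R} :=
  measure_function_pushforward__canonical__measure_function_Measure lam mf.
have nu_sf : sigma_finite setT nu0.
  have /sigma_finiteP[F [FT ndF Foo]] := sigma_finiteT lam.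
  exists (fun n => (fun v : 'rV[R]_d => v *m T) @^-1` F n).
    by rewrite -preimage_bigcup -FT preimage_setT.
  move=> n; have [mF Fn] := Foo n; split; first exact: measurable_mulmx_preimage.
  rewrite [ltLHS](_ : _ = lam (F n))// /nu0 /= /pushforward; congr (lam _).
  by apply/seteqP; split=> v; rewrite /f /= mulmxKV.
have [nu nuE0] := sigma_finite_pack (measure0 nu0) (measure_ge0 nu0)
  (@measure_semi_sigma_additive _ _ _ nu0) nu_sf.
have nuE A : measurable A -> lam (f @^-1` A) = (lam (f @^-1` @unit_cube R d) * lam A)%E.
  move=> mA; have := @shift_invariant_unique _ _ nu A; rewrite nuE0; apply => // w C mC.
  rewrite -[LHS]/(lam (f @^-1` _)) -[RHS]/(lam (f @^-1` C)).
  rewrite -[RHS](lebesgue_rV_shift (w *m T)); last exact: measurable_mulmx_preimage.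
  by congr (lam _); apply/seteqP; split=> v; rewrite /f /= mulmxDl mulmxK.
set D := lam (f @^-1` @unit_cube R d) in nuE *.
have D1 : (D * lam ((fun v => v *m T) @^-1` @unit_cube R d) = 1)%E.
  rewrite -(nuE _ (measurable_mulmx_preimage T (@measurable_unit_cube R d))).
  rewrite -[RHS](@lebesgue_unit_cube R d); congr (lam _).
  by apply/seteqP; split=> v; rewrite /f /= mulmxKV.
have D0 : (0 <= D)%E by exact: measure_ge0.
have Dfin : D \is a fin_num.
  rewrite ge0_fin_numE// ltey; apply/eqP => Doo; move: D1; rewrite Doo.
  set e := lam _; have : (0 <= e)%E by exact: measure_ge0.
  rewrite le_eqVlt => /predU1P[<-|e0]; first by rewrite mule0 => -[/esym/eqP]; rewrite oner_eq0.
  by rewrite gt0_mulye.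
split; last by move=> A mA; rewrite nuE// /jac fineK.
have Dgt0 : (0 < D)%E.
  rewrite lt0e D0 andbT; apply/eqP => DE; move: D1; rewrite DE.
  by rewrite mul0e => -[/esym/eqP]; rewrite oner_eq0.
by rewrite /jac fine_gt0// Dgt0 -ge0_fin_numE.
Qed.

Lemma jac_gt0 T : T \in unitmx -> 0 < jac T.
Proof. by case/jacP. Qed.

Lemma lebesgue_rV_linear T A : T \in unitmx -> measurable A ->
  lam ((fun v => v *m invmx T) @^-1` A) = ((jac T)%:E * lam A)%E.
Proof. by move=> /jacP[_]; apply. Qed.

Lemma jacE T (c : R) : lam ((fun v => v *m invmx T) @^-1` @unit_cube R d) = c%:E ->
  jac T = c.
Proof. by rewrite /jac => ->. Qed.

Lemma invmxM S T : S \in unitmx -> T \in unitmx ->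
  invmx (S *m T) = invmx T *m invmx S.
Proof.
move=> uS uT; have uST : S *m T \in unitmx by rewrite unitmx_mul uS.
rewrite -[RHS]mulmx1 -(mulmxV uST) mulmxA.
by rewrite -[invmx T *m _ *m _]mulmxA mulKmx// mulVmx// mul1mx.
Qed.

Lemma jacM S T : S \in unitmx -> T \in unitmx -> jac (S *m T) = jac S * jac T.
Proof.
move=> uS uT; apply: jacE; rewrite invmxM// mulrC EFinM.
transitivity ((jac T)%:E * lam ((fun v => v *m invmx S) @^-1` @unit_cube R d))%E.
  rewrite -(lebesgue_rV_linear uT
    (measurable_mulmx_preimage _ (@measurable_unit_cube R d))).
  by congr (lam _); apply/seteqP; split=> v /=; rewrite mulmxA.
rewrite lebesgue_rV_linear//; last exact: measurable_unit_cube.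
by rewrite lebesgue_unit_cube mule1.
Qed.

Lemma diag_mx_inv (r : 'rV[R]_d) : (forall i, r ord0 i != 0) ->
  diag_mx r *m diag_mx (\row_i (r ord0 i)^-1) = 1%:M.
Proof.
move=> r0; apply/matrixP => i j; rewrite mul_diag_mx !mxE.
by case: eqP => [->|_]; rewrite ?mulr0n ?mulr0// mulr1n divff.
Qed.

Lemma unitmx_diag (r : 'rV[R]_d) : (forall i, r ord0 i != 0) ->
  diag_mx r \in unitmx.
Proof. by move=> /diag_mx_inv/mulmx1_unit[]. Qed.

Lemma jac_diag (r : 'rV[R]_d) : (forall i, 0 < r ord0 i) ->
  jac (diag_mx r) = \prod_i r ord0 i.
Proof.
move=> r0; have rn0 i : r ord0 i != 0 by rewrite gt_eqF.
have uD := unitmx_diag rn0.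
apply: jacE; rewrite (_ : invmx _ = diag_mx (\row_i (r ord0 i)^-1)); last first.
  by rewrite -[RHS](mulKmx uD) diag_mx_inv// mulmx1.
transitivity (lam [set v | forall i, v ord0 i \in `[0, r ord0 i]]).
  congr (lam _); apply/seteqP; split=> v /= h i; have := h i;
    by rewrite mul_mx_diag !mxE !in_itv/= ler_pdivlMr// ler_pdivrMr// mul0r mul1r.
rewrite (@lebesgue_measure_rV_box R d (fun=> 0))//; last by move=> i; exact/ltW.
by congr EFin; apply: eq_bigr => i _; rewrite subr0.
Qed.

(** A transvection [1 + N] preserves volumes: its square [1 + 2 N] is also a
    conjugate of it, so that the factor equals its own square. *)
Lemma jac_transvection N H : N *m N = 0 -> H \in unitmx -> H *m N = N *m H *+ 2 ->
  1%:M + N \in unitmx /\ jac (1%:M + N) = 1.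
Proof.
move=> NN uH HN.
have uN (c : R) : 1%:M + c *: N \in unitmx.
  apply: (mulmx1_unit (B := 1%:M - c *: N) _).1.
  rewrite mulmxDl !mulmxBr !mul1mx !mulmx1 -scalemxAl -scalemxAr NN !scaler0 subr0.
  by rewrite subrK.
have uN1 : 1%:M + N \in unitmx by have := uN 1; rewrite scale1r.
split => //.
have conj : H *m (1%:M + N) = ((1%:M + N) *m (1%:M + N)) *m H.
  rewrite mulmxDr mulmx1 HN mulmxDl mul1mx mulmxDr mulmx1 NN addr0.
  by rewrite mulr2n !mulmxDl mul1mx addrA.
have : jac H * jac (1%:M + N) = jac (1%:M + N) * jac (1%:M + N) * jac H.
  rewrite -(jacM uN1 uN1) -(jacM uH uN1) -(jacM _ uH) ?conj//.
  by rewrite unitmx_mul uN1.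
have := jac_gt0 uN1; have := jac_gt0 uH.
move: (jac H) (jac (1%:M + N)) => x y x0 y0 E.
apply: (mulfI (x := y)); rewrite ?gt_eqF// mulr1.
by apply: (mulIf (x := x)); rewrite ?gt_eqF// -E mulrC.
Qed.

Lemma square0_unit N : N *m N = 0 -> (1%:M + N) *m (1%:M - N) = 1%:M.
Proof.
by move=> NN; rewrite mulmxDl !mulmxBr !mul1mx !mulmx1 NN subr0 subrK.
Qed.

Lemma shear_into_sqr0 i (t : 'rV[R]_d) : t ord0 i = 0 ->
  (t^T *m delta_mx ord0 i) *m (t^T *m delta_mx ord0 i) = 0.
Proof.
move=> ti0; rewrite mulmxA -[_ *m t^T]mulmxA (_ : delta_mx _ _ *m t^T = 0) ?mulmx0 ?mul0mx//.
by rewrite -rowE; apply/matrixP => k l; rewrite !mxE ord1.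
Qed.

Lemma shear_from_sqr0 i (t : 'rV[R]_d) : t ord0 i = 0 ->
  (delta_mx i ord0 *m t) *m (delta_mx i ord0 *m t) = 0.
Proof.
move=> ti0; rewrite mulmxA -[_ *m delta_mx _ _]mulmxA (_ : t *m delta_mx _ _ = 0) ?mulmx0 ?mul0mx//.
by rewrite -colE; apply/matrixP => k l; rewrite !mxE !ord1.
Qed.

(** Halving the coordinate [i] conjugates the shear to its square. *)
Lemma jac_shear_into i (t : 'rV[R]_d) : t ord0 i = 0 ->
  1%:M + t^T *m delta_mx ord0 i \in unitmx /\
  jac (1%:M + t^T *m delta_mx ord0 i) = 1.
Proof.
move=> ti0; pose h : 'rV[R]_d := \row_j (if j == i then 2^-1 else 1).
have h0 j : h ord0 j != 0 by rewrite mxE; case: ifP => // _; rewrite ?invr_eq0 ?oner_eq0 ?pnatr_eq0.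
apply: (@jac_transvection _ (diag_mx h)).
- exact: shear_into_sqr0.
- exact: unitmx_diag.
- apply/matrixP => k l; rewrite mul_diag_mx mxE -mulmxA mul_mx_diag !mxE !big_ord1 !mxE.
  rewrite eqxx/=; have [->|ki] := eqVneq k i; first by rewrite ti0; ring.
  have [_|li] := eqVneq l i; first by rewrite /=; field.
  by rewrite /=; ring.
Qed.

Lemma jac_shear_from i (t : 'rV[R]_d) : t ord0 i = 0 ->
  1%:M + delta_mx i ord0 *m t \in unitmx /\
  jac (1%:M + delta_mx i ord0 *m t) = 1.
Proof.
move=> ti0; pose h : 'rV[R]_d := \row_j (if j == i then 2 else 1).
have h0 j : h ord0 j != 0 by rewrite mxE; case: ifP => // _; rewrite ?oner_eq0 ?pnatr_eq0.
apply: (@jac_transvection _ (diag_mx h)).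
- exact: shear_from_sqr0.
- exact: unitmx_diag.
- apply/matrixP => k l; rewrite mul_diag_mx mxE -mulmxA mul_mx_diag !mxE !big_ord1 !mxE.
  rewrite eqxx/= ?andbT; have [->|li] := eqVneq l i; first by rewrite ti0; ring.
  have [_|ki] := eqVneq k i; first by rewrite /=; ring.
  by rewrite /=; ring.
Qed.

End jacobian.

(** * Sublinear functions and cross-polytopes below a level *)

Section sup_norm.
Context (R : realType) (d : nat).
Implicit Types v : 'rV[R]_d.

Lemma rV_coord_le_norm v i : `|v ord0 i| <= `|v|.
Proof.
rewrite [leRHS]/Num.norm/= mx_normrE.
by apply: (le_bigmax _ (fun ij => `|v ij.1 ij.2|) (ord0, i)).
Qed.

Lemma rV_norm_le v (r : R) : 0 <= r -> (forall i, `|v ord0 i| <= r) -> `|v| <= r.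
Proof.
move=> r0 vr; rewrite [leLHS]/Num.norm/= mx_normrE.
by apply: bigmax_le => // -[i j] _ /=; rewrite (ord1 i).
Qed.

Lemma rV_norm_delta (i : 'I_d) : `|delta_mx ord0 i : 'rV[R]_d| <= 1.
Proof.
apply: rV_norm_le => // j; rewrite mxE eqxx/=.
by case: eqP => _; rewrite ?normr1 ?normr0.
Qed.

Lemma rV_norm_attained v : (0 < d)%N -> exists i, `|v| = `|v ord0 i|.
Proof.
move=> d0; pose i0 := Ordinal d0.
exists [arg max_(i > i0) `|v ord0 i|]%O; case: arg_maxP => // i _ vi.
apply/eqP; rewrite eq_le rV_coord_le_norm andbT.
by apply: rV_norm_le => // j; exact: vi.
Qed.

End sup_norm.

Definition convex_in (R : realType) (V : lmodType R) (C : set V) :=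
  forall x y (t : R), C x -> C y -> 0 <= t <= 1 -> C (t *: x + (1 - t) *: y).

Definition second_diff (R : realType) d (g : 'rV[R]_d -> R) (b : R) (i : 'I_d) x :=
  g (x + b *: delta_mx ord0 i) + g (x - b *: delta_mx ord0 i) - g x *+ 2.

Section sublinear.
Context (R : realType) (d : nat) (g : 'rV[R]_d -> R) (rho : R).
Hypothesis rho0 : 0 < rho.
Hypothesis gD : forall x y, g (x + y) <= g x + g y.
Hypothesis gZ : forall r x, 0 <= r -> g (r *: x) = r * g x.
Hypothesis g_le : forall x, g x <= rho^-1 * `|x|.
Implicit Types x y : 'rV[R]_d.
Local Notation e i := (delta_mx ord0 i : 'rV[R]_d).
Local Notation D2 := (second_diff g).

Lemma sublinear_lip x y : g (x + y) <= g x + rho^-1 * `|y|.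
Proof. by apply: le_trans (gD _ _) _; rewrite lerD2l. Qed.

Lemma sublinear_conv x y t : 0 <= t <= 1 ->
  g (t *: x + (1 - t) *: y) <= t * g x + (1 - t) * g y.
Proof.
by move=> /andP[t0 t1]; apply: le_trans (gD _ _) _; rewrite !gZ// subr_ge0.
Qed.

Lemma sublinear_sum n (F : 'I_n -> 'rV[R]_d) :
  g (\sum_i F i) <= \sum_i g (F i).
Proof.
elim/big_ind2: _ => [|x u y v xu yv|//]; first by rewrite -(scale0r (0 : 'rV[R]_d)) gZ// mul0r.
by apply: le_trans (gD _ _) _; exact: lerD.
Qed.

Lemma continuous_sublinear : continuous g.
Proof.
move=> x A /= /nbhs_ballP[e /= e0 xeA]; apply/nbhs_ballP.
exists (rho * e) => [|y]; first by rewrite /= mulr_gt0.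
rewrite -ball_normE/= => xy; apply: xeA; rewrite -ball_normE/=.
have h : rho^-1 * `|x - y| < e by rewrite ltr_pdivrMl.
rewrite ltr_norml; apply/andP; split.
  have := sublinear_lip x (y - x); rewrite addrC subrK -normrN opprB; lra.
by have := sublinear_lip y (x - y); rewrite addrC subrK; lra.
Qed.

Lemma second_diff_ge0 b i x : 0 <= D2 b i x.
Proof.
have := @sublinear_conv (x + b *: e i) (x - b *: e i) (1/2) ltac:(lra).
rewrite (_ : _ *: _ + _ *: _ = x); last first.
  by apply/rowP => j; rewrite !mxE; field.
by rewrite /second_diff; lra.
Qed.

(** On a shorter segment with the same midpoint the values lie below the chord. *)
Lemma sublinear_chord b t i x : 0 <= t <= b -> 0 < b ->
  g (x + t *: e i) <= g x + t * ((g (x + b *: e i) - g (x - b *: e i)) / (b *+ 2))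
    + D2 b i x / 2 /\
  g (x - t *: e i) <= g x - t * ((g (x + b *: e i) - g (x - b *: e i)) / (b *+ 2))
    + D2 b i x / 2.
Proof.
move=> /andP[t0 tb] b0.
have u01 : 0 <= t / b <= 1 by rewrite divr_ge0 ?(ltW b0)//= ler_pdivrMr// mul1r.
have h (s : R) : g (x + t *: (s *: e i)) <=
    (t / b) * g (x + b *: (s *: e i)) + (1 - t / b) * g x.
  apply: le_trans (sublinear_conv _ _ u01); rewrite le_eqVlt; apply/orP; left.
  apply/eqP; congr g.
  by apply/rowP => j; rewrite !mxE; field; rewrite gt_eqF.
have D0 := second_diff_ge0 b i x.
have hp := h 1; have hm := h (-1); rewrite !scale1r !scaleN1r !scalerN in hp hm.
have E : t * ((g (x + b *: e i) - g (x - b *: e i)) / (b *+ 2)) =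
  (t / b) * ((g (x + b *: e i) - g (x - b *: e i)) / 2).
  by field; rewrite gt_eqF.
rewrite {}E; move: D0 hp hm u01; rewrite /second_diff.
move: (g _) (g _) (g _) (t / b) => p m z u; nra.
Qed.

Lemma second_diff_mono b b' i x : 0 < b <= b' -> D2 b i x <= D2 b' i x.
Proof.
move=> /andP[b0 bb']; have b'0 : 0 < b' := lt_le_trans b0 bb'.
have [] := @sublinear_chord b' b i x _ b'0; first by rewrite (ltW b0).
move=> h1 h2; rewrite [leLHS]/second_diff.
by move: h1 h2; move: (b * _) (D2 _ _ _) => p q; lra.
Qed.

Lemma second_diff_scale r b i x : 0 < r -> D2 b i (r *: x) = r * D2 (b / r) i x.
Proof.
move=> r0; rewrite /second_diff.
have E s : r *: x + s *: e i = r *: (x + (s / r) *: e i).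
  by rewrite scalerDr scalerA mulrC divfK// gt_eqF.
have E' : r *: x - b *: e i = r *: (x - (b / r) *: e i).
  by rewrite -scaleNr E mulNr scaleNr.
by rewrite E E' !gZ ?(ltW r0)//; ring.
Qed.

Definition slope b i x : R := (g (x + b *: e i) - g (x - b *: e i)) / (b *+ 2).

Lemma slope_bound b i x : 0 < b -> `|slope b i x| <= rho^-1.
Proof.
move=> b0; have h (s : R) : `|s| = 1 -> g (x + b *: (s *: e i)) <=
    g (x - b *: (s *: e i)) + rho^-1 * (b *+ 2).
  move=> s1; have := sublinear_lip (x - b *: (s *: e i)) ((b * s *+ 2) *: e i).
  rewrite (_ : _ + _ + _ = x + b *: (s *: e i)); last first.
    by apply/rowP => j; rewrite !mxE; ring.
  move/le_trans; apply; rewrite lerD2l ler_pM2l ?invr_gt0// normrZ normrMn normrM s1 mulr1.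
  by rewrite gtr0_norm// -[leRHS]mulr1 ler_pM2l ?rV_norm_delta// pmulrn_lgt0.
have hp := h 1 (normr1 _); have hm := h (-1) (normrN1 _).
rewrite !scale1r in hp; rewrite !scaleN1r !scalerN opprK in hm.
have b20 : 0 < b *+ 2 by rewrite pmulrn_lgt0.
rewrite /slope ler_norml ler_pdivlMr// ler_pdivrMr//; apply/andP; split; lra.
Qed.

(** The tilted segment [x +- (a e_i - s x)]: the slope of [g] along [e_i] is
    compensated by a move along the ray through [x], on which [g] is linear. *)
Lemma tilted_segment (delta a : R) i x : 0 < delta -> 0 < a -> a <= rho / 4 ->
  1 / 2 <= g x -> g x <= 1 - delta -> D2 (a *+ 2) i x <= delta ->
  forall w, w = a *: e i - (a * slope (a *+ 2) i x / g x) *: x ->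
  g (x + w) < 1 /\ g (x - w) < 1.
Proof.
move=> delta0 a0 ar g2 gd D w wE.
have gx0 : 0 < g x by lra.
set p := slope (a *+ 2) i x in wE; set s := a * p / g x in wE.
have a20 : 0 < a *+ 2 by rewrite pmulrn_lgt0.
have sE : s * g x = a * p by rewrite /s divfK// gt_eqF.
have s2 : `|s| <= 1/2.
  rewrite /s normrM normfV (gtr0_norm gx0) ler_pdivrMr// normrM (gtr0_norm a0).
  apply: (@le_trans _ _ (a * rho^-1)); first by rewrite ler_pM2l// slope_bound.
  rewrite ler_pdivrMr//; nra.
move: s2; rewrite ler_norml => /andP[s2 s2'].
have H (u : R) : -(1/2) <= u <= 1/2 -> 0 <= a / (1 - u) <= a *+ 2.
  move=> u2; have u0 : 0 < 1 - u by lra.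
  by rewrite divr_ge0 ?(ltW a0) ?(ltW u0)//= ler_pdivrMr//; nra.
split.
  have -> : x + w = (1 - s) *: (x + (a / (1 - s)) *: e i).
    by rewrite wE; apply/rowP => j; rewrite !mxE; field; lra.
  rewrite gZ; last lra.
  have [+ _] := @sublinear_chord _ _ i x (H s ltac:(lra)) a20.
  rewrite -/(slope _ _ _) -/p => h.
  have s1 : 0 < 1 - s by lra.
  have := h; rewrite -(ler_pM2l s1) => /le_lt_trans; apply.
  rewrite (_ : (1 - s) * _ = g x - s * g x + a * p + (1 - s) * (D2 (a *+ 2) i x / 2)); last first.
    by field; lra.
  rewrite sE; nra.
have -> : x - w = (1 + s) *: (x - (a / (1 + s)) *: e i).
  by rewrite wE; apply/rowP => j; rewrite !mxE; field; lra.
rewrite gZ; last lra.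
have Hs := H (- s) ltac:(lra); rewrite opprK in Hs.
have [_] := @sublinear_chord _ _ i x Hs a20.
rewrite -/(slope _ _ _) -/p => h.
have s1 : 0 < 1 + s by lra.
have := h; rewrite -(ler_pM2l s1) => /le_lt_trans; apply.
rewrite (_ : (1 + s) * _ = g x + s * g x - a * p + (1 + s) * (D2 (a *+ 2) i x / 2)); last first.
  by field; lra.
rewrite sE; nra.
Qed.

(** Push [x] along each row of [W] with the sign of the coefficient: the point
    is a convex combination of [x] and of these ends. *)
Lemma cross_polytope (W : 'M[R]_d) x (c : 'rV[R]_d) :
  (forall l, g (x + row l W) < 1 /\ g (x - row l W) < 1) -> g x < 1 ->
  \sum_l `|c ord0 l| <= 1 -> g (x + c *m W) < 1.
Proof.
move=> gW gx c1.
pose v l := x + Num.sg (c ord0 l) *: row l W.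
have gv l : g (v l) < 1.
  rewrite /v; have [gp gm] := gW l.
  by case: sgrP => _; rewrite ?scale0r ?addr0 ?scale1r ?scaleN1r.
have -> : x + c *m W =
    (1 - \sum_l `|c ord0 l|) *: x + \sum_l `|c ord0 l| *: v l.
  rewrite (eq_bigr (fun l => `|c ord0 l| *: x + c ord0 l *: row l W)); last first.
    by move=> l _; rewrite /v scalerDr scalerA mulrC -numEsg.
  rewrite big_split/= -scaler_suml addrA -scalerDl subrK scale1r.
  by rewrite mulmx_sum_row.
apply: le_lt_trans (gD _ _) _; rewrite gZ ?subr_ge0//.
have := sublinear_sum (fun l => `|c ord0 l| *: v l).
rewrite [leRHS](eq_bigr (fun l => `|c ord0 l| * g (v l))); last first.
  by move=> l _; rewrite gZ.
have [M [M1 gM vM]] : exists M, [/\ M < 1, g x <= M & forall l, g (v l) <= M].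
  exists (\big[Order.max/g x]_l g (v l)); split.
  - by apply: bigmax_lt => // l _; exact: gv.
  - exact: bigmax_ge_id.
  - by move=> l; exact: le_bigmax.
have : \sum_l `|c ord0 l| * g (v l) <= (\sum_l `|c ord0 l|) * M.
  by rewrite mulr_suml; apply: ler_sum => l _; rewrite ler_wpM2l.
have : 0 <= \sum_l `|c ord0 l| by apply: sumr_ge0.
move: c1; set S := \sum_l `|_|; move=> *; nra.
Qed.

End sublinear.

(** * Volumes of layers and of points of large second difference *)

Lemma measure_multiplicity d (T : measurableType d) (R : realType)
    (mu : {measure set T -> \bar R}) (I : finType) (F : I -> set T) (E : set T) (k : R) :
  0 <= k -> measurable E -> (forall i, measurable (F i)) ->
  (forall x, \sum_i (\1_(F i) x : R) <= k * \1_E x) ->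
  (\sum_i mu (F i) <= k%:E * mu E)%E.
Proof.
move=> k0 mE mF Fk.
rewrite -[X in (_ * mu X)%E](setIT E) -integral_indic// -ge0_integralZl_EFin//; last first.
  by apply/measurable_EFinP.
under eq_bigr => i _ do rewrite -{1}(setIT (F i)) -integral_indic//.
rewrite -ge0_integral_sum//; last first.
  by move=> i; apply/measurable_EFinP.
apply: ge0_le_integral => //.
- by move=> x _; rewrite sume_ge0.
- by apply: emeasurable_sum => i; exact/measurable_EFinP.
- apply: measurable_funeM; exact/measurable_EFinP.
- by move=> x _; rewrite sumEFin lee_fin.
Qed.

Lemma measure_fin_cover d (T : measurableType d) (R : realType)
    (mu : {measure set T -> \bar R}) (I : finType) (F : I -> set T) (E : set T) :
  measurable E -> (forall i, measurable (F i)) -> E `<=` \bigcup_i F i ->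
  (mu E <= \sum_i mu (F i))%E.
Proof.
move=> mE mF EF.
rewrite -[X in (mu X <= _)%E](setIT E) -integral_indic//.
under eq_bigr => i _ do rewrite -{1}(setIT (F i)) -integral_indic//.
rewrite -ge0_integral_sum//; last first.
  by move=> i; apply/measurable_EFinP.
apply: ge0_le_integral => //.
- exact/measurable_EFinP.
- by apply: emeasurable_sum => i; exact/measurable_EFinP.
- move=> x _; rewrite sumEFin lee_fin indicE.
  have [Ex|Ex] := pselect (E x); last by rewrite memNset//= sumr_ge0.
  have [i _ Fix] := EF x Ex; rewrite mem_set//= (bigD1 i)//= indicE mem_set//=.
  by rewrite lerDl sumr_ge0.
Qed.

Lemma measurable_preimage_itv d (T : measurableType d) (R : realType)
    (f : T -> measurableTypeR R) (i : interval R) :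
  measurable_fun setT f -> measurable [set x | (f x : R) \in i].
Proof.
move=> mf; rewrite -[X in measurable X]setTI.
exact: (mf measurableT _ (measurable_itv i)).
Qed.

Lemma measurable_norm_le_rV (R : realType) d (r : R) : 0 <= r ->
  measurable [set x : 'rV[R]_d | `|x| <= r].
Proof.
move=> r0; rewrite (_ : mkset _ = [set v : 'rV[R]_d | forall i, v ord0 i \in `[- r, r]]).
  exact: measurable_box_rV.
apply/seteqP; split=> x /= h.
  by move=> j; rewrite in_itv/= -ler_norml; exact: le_trans (rV_coord_le_norm _ _) h.
by apply: rV_norm_le => // j; have := h j; rewrite in_itv/= -ler_norml.
Qed.

Lemma lebesgue_rV_homothety (R : realType) d (r : R) (A : set 'rV[R]_d) :
  0 < r -> measurable A ->
  lebesgue_measure_rV ((fun v => r^-1 *: v) @^-1` A) =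
  ((r ^+ d)%:E * lebesgue_measure_rV A)%E.
Proof.
move=> r0 mA; pose D := diag_mx (const_mx r : 'rV[R]_d).
have uD : D \in unitmx by apply: unitmx_diag => i; rewrite mxE gt_eqF.
have -> : r ^+ d = jac D.
  rewrite jac_diag => [|i]; last by rewrite mxE.
  by under eq_bigr do rewrite mxE; rewrite prodr_const card_ord.
rewrite -lebesgue_rV_linear//; congr (lebesgue_measure_rV _).
suff E (v : 'rV[R]_d) : v *m invmx D = r^-1 *: v.
  by apply/seteqP; split=> v /=; rewrite E.
have vD : v = (r^-1 *: v) *m D.
  by rewrite /D mul_mx_diag; apply/rowP => i; rewrite !mxE mulrAC mulVf ?mul1r// gt_eqF.
by rewrite [in LHS]vD mulmxK.
Qed.

Lemma bernoulli_ineq (R : realFieldType) (x : R) m : 0 <= x <= 1 ->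
  1 - m%:R * x <= (1 - x) ^+ m.
Proof.
move=> /andP[x0 x1]; elim: m => [|m IH]; first by rewrite expr0 mul0r subr0.
have : 0 <= (m%:R : R) by []. rewrite exprS -natr1.
move: IH; set y := _ ^+ m; set z := m%:R; nra.
Qed.

Section layers.
Context (R : realType) (d : nat) (g : 'rV[R]_d -> R).
Hypothesis gZ : forall r x, 0 <= r -> g (r *: x) = r * g x.
Local Notation lam := (@lebesgue_measure_rV R d).

(** The copies of a thin layer shrunk by the powers of [1 - eta] are disjoint,
    and about [1 / eta] of them keep at least half of the size. *)
Lemma layer_volume (eta : R) (S T : set 'rV[R]_d) : 0 < eta <= 1 / 2 ->
  measurable S -> measurable T ->
  (forall x, S x -> 1 - eta < g x <= 1) ->
  (forall r x, 1 / 2 <= r <= 1 -> S x -> T (r *: x)) ->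
  (lam S <= (4 * 2 ^+ d * eta)%:E * lam T)%E.
Proof.
move=> /andP[eta0 eta2] mS mT gS ST.
(* with this many copies the smallest ratio, (1 - eta) ^ M, is still at least
   1 - M eta >= 1 / 2 *)
set M := Num.truncn (1 / (2 * eta)).
have e2 : 0 < 2 * eta by lra.
have /andP[Ml Mu] : (M%:R : R) <= 1 / (2 * eta) < M.+1%:R.
  by apply: truncn_itv; rewrite divr_ge0// ltW.
have M1 : 1 <= M%:R :> R.
  by rewrite ler1n /M truncn_ge_nat ?divr_ge0 ?(ltW e2)// ler_pdivlMr//; lra.
have eM : 1 <= 4 * eta * M%:R.
  by move: Mu; rewrite ltr_pdivrMr// -natr1; nra.
have Me : M%:R * eta <= 1 / 2.
  by move: Ml; rewrite ler_pdivlMr//; lra.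
set r := 1 - eta; have r0 : 0 < r by rewrite /r; lra.
have r1 : r <= 1 by rewrite /r; lra.
have rm0 m : 0 < r ^+ m by rewrite exprn_gt0.
have rm m : (m <= M)%N -> 1 / 2 <= r ^+ m <= 1.
  move=> mM; rewrite exprn_ile1 ?(ltW r0)// andbT.
  have := @bernoulli_ineq _ eta m; rewrite -/r => /(_ ltac:(lra)).
  have : m%:R <= M%:R :> R by rewrite ler_nat.
  nra.
pose F (m : 'I_M) : set 'rV[R]_d := (fun v => (r ^+ m)^-1 *: v) @^-1` S.
have mF m : measurable (F m).
  rewrite -[X in measurable X]setTI; apply: measurable_funZ_rV => //.
have gF m x : F m x -> r ^+ m.+1 < g x <= r ^+ m.
  move=> /gS /andP[]; rewrite gZ ?invr_ge0 ?(ltW (rm0 m))// mulrC.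
  by rewrite ltr_pdivlMr// ler_pdivrMr// mul1r -exprS => -> ->.
have FT m : F m `<=` T.
  move=> x Fx; rewrite -[x](scalerKV (lt0r_neq0 (rm0 m))); apply: ST => //.
  by apply: rm; exact: ltnW.
have Fdisj m m' x : F m x -> F m' x -> (m < m')%N -> False.
  move=> /gF/andP[h _] /gF/andP[_ h'] mm'.
  have : r ^+ m' <= r ^+ m.+1 by rewrite ler_wiXn2l// (ltW r0).
  by move: (lt_le_trans h h') => /lt_le_trans h2 /h2; rewrite ltxx.
have : (\sum_m lam (F m) <= 1%:E * lam T)%E.
  apply: measure_multiplicity => // x; rewrite mul1r.
  have [[m Fm]|nF] := pselect (exists m, F m x); last first.
    rewrite big1 => [|m _]; first by rewrite indicE.
    by rewrite indicE memNset// => Fm; apply: nF; exists m.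
  rewrite (bigD1 m)//= big1 ?addr0 => [|m' m'm].
    by rewrite !indicE !mem_set//; exact: FT Fm.
  rewrite indicE memNset// => Fm'; move: m'm; rewrite -val_eqE/= neq_ltn.
  by move=> /orP[|]; [exact: Fdisj Fm' Fm|exact: Fdisj Fm Fm'].
rewrite mul1e => sumF.
have : ((M%:R * (1 / 2) ^+ d)%:E * lam S <= lam T)%E.
  apply: le_trans sumF.
  have -> : (M%:R * (1 / 2) ^+ d)%:E = (\sum_(m < M) ((1 / 2 : R) ^+ d)%:E)%E.
    by rewrite sumEFin sumr_const card_ord mulr_natl.
  rewrite ge0_sume_distrl; last by move=> m _; rewrite lee_fin exprn_ge0.
  apply: lee_sum => m _; rewrite lebesgue_rV_homothety//.
  apply: lee_wpmul2r; first exact: measure_ge0.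
  rewrite lee_fin; have /andP[h _] := rm m (ltnW (ltn_ord m)).
  by apply: lerXn2r => //; rewrite nnegrE ?divr_ge0 ?(ltW (rm0 m)).
set c := M%:R * _; move=> cS.
have c1 : 1 <= 4 * 2 ^+ d * eta * c.
  rewrite /c (_ : _ * _ = 4 * eta * M%:R * (2 ^+ d * (1 / 2) ^+ d)); last by ring.
  by rewrite -exprMn (_ : 2 * (1 / 2) = 1 :> R) ?expr1n ?mulr1//; field.
apply: (@le_trans _ _ ((4 * 2 ^+ d * eta * c)%:E * lam S)%E).
  rewrite -[leLHS]mul1e; apply: lee_wpmul2r; first exact: measure_ge0.
  by rewrite lee_fin.
rewrite EFinM -muleA; apply: lee_wpmul2l => //.
by rewrite lee_fin !mulr_ge0// ?exprn_ge0// ltW.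
Qed.

End layers.

Section second_difference_volume.
Context (R : realType) (d : nat) (g : 'rV[R]_d -> R) (rho : R).
Hypothesis rho0 : 0 < rho.
Hypothesis gD : forall x y, g (x + y) <= g x + g y.
Hypothesis gZ : forall r x, 0 <= r -> g (r *: x) = r * g x.
Hypothesis g_le : forall x, g x <= rho^-1 * `|x|.
Local Notation lam := (@lebesgue_measure_rV R d).
Local Notation e i := (delta_mx ord0 i : 'rV[R]_d).
Local Notation D2 := (second_diff g).

Lemma measurable_sublinear d' (T : measurableType d') (f : T -> 'rV[R]_d) :
  measurable_fun setT f -> measurable_fun setT (fun x => g (f x) : measurableTypeR R).
Proof.
move=> mf; apply: (@measurableT_comp _ _ _ _ _ _ (g : 'rV[R]_d -> measurableTypeR R)) => //.
by apply: continuous_measurable_rV; exact: (continuous_sublinear rho0 gD g_le).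
Qed.

Lemma measurable_shift_rV (w : 'rV[R]_d) : measurable_fun setT (fun x : 'rV[R]_d => x + w).
Proof. by apply: measurable_funD_rV => //; exact: measurable_cst. Qed.

Lemma measurable_second_diff b i :
  measurable_fun setT (D2 b i : 'rV[R]_d -> measurableTypeR R).
Proof.
rewrite /second_diff; apply: measurable_funB; first apply: measurable_funD.
- apply: measurable_sublinear; exact: measurable_shift_rV.
- apply: measurable_sublinear; exact: measurable_shift_rV.
- rewrite (_ : (fun _ => _) = fun x => g x + g x); last by apply/funext => x; rewrite mulr2n.
  by apply: measurable_funD; apply: measurable_sublinear.
Qed.

(** Along an arithmetic progression the second differences telescope to a
    difference of first differences, which is of order [b]; so few of them
    exceed [delta]. *)
Lemma second_diff_volume (b delta : R) (i : 'I_d) : 0 < b <= 1 -> 0 < delta ->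
  (lam [set x : 'rV[R]_d | (`|x| <= 3)%R /\ (delta < D2 b i x)%R] <=
   (2 * 6 ^+ d / rho * (b ^+ 2 / delta))%:E)%E.
Proof.
move=> /andP[b0 b1] delta0.
set B := [set x | _].
have mnorm : measurable [set x : 'rV[R]_d | `|x| <= 3] by exact: measurable_norm_le_rV.
have mD : measurable [set x : 'rV[R]_d | delta < D2 b i x].
  rewrite (_ : mkset _ = [set x | D2 b i x \in `]delta, +oo[]).
    exact: measurable_preimage_itv (measurable_second_diff b i).
  by apply/seteqP; split=> x /=; rewrite in_itv/= andbT.
(* S is a slab of width b, and the progression of step b along the axis i
   started in S sweeps the cube *)
pose lo (j : 'I_d) : R := -3; pose hi j : R := if j == i then -3 + b else 3.
pose S : set 'rV[R]_d := [set v | forall j, v ord0 j \in `[lo j, hi j]].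
have mS : measurable S by exact: measurable_box_rV.
have lamS : (lam S <= (6 ^+ d * b)%:E)%E.
  rewrite lebesgue_measure_rV_box; last by move=> j; rewrite /lo /hi; case: ifP => _; lra.
  rewrite lee_fin (bigD1 i)//= {1}/hi eqxx /lo mulrC.
  rewrite (_ : -3 + b - -3 = b); last by ring.
  apply: ler_wpM2r; first exact: ltW.
  apply: (@le_trans _ _ (\prod_(j < d | j != i) (6 : R))).
    by apply: ler_prod => j ji; rewrite /hi (negbTE ji); lra.
  rewrite prodr_const; apply: ler_weXn2l; first lra.
  by rewrite -[leqRHS]card_ord; exact: max_card.
set N := (Num.truncn (6 / b)).+1.
have NE : 6 / b < N%:R by exact: truncnS_gt.
pose U (m : 'I_N) : set 'rV[R]_d := S `&` [set x | delta < D2 b i (x + (m%:R * b) *: e i)].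
have mU m : measurable (U m).
  apply: measurableI => //; rewrite -[X in measurable X]setTI.
  exact: (measurable_shift_rV _ measurableT mD).
pose V (m : 'I_N) : set 'rV[R]_d := (fun v => v - (m%:R * b) *: e i) @^-1` U m.
have mV m : measurable (V m).
  by rewrite -[X in measurable X]setTI; exact: (measurable_shift_rV _ measurableT (mU m)).
have BV : B `<=` \bigcup_m V m.
  move=> x [x3 Dx]; set t := (x ord0 i + 3) / b.
  have := le_trans (rV_coord_le_norm x i) x3; rewrite ler_norml => /andP[xi xi'].
  have t0 : 0 <= t by rewrite divr_ge0 ?(ltW b0)//; lra.
  have /andP[tl tu] := truncn_itv t0.
  have tN : (Num.truncn t < N)%N.
    rewrite ltnS; apply: le_truncn.
    by rewrite ler_pM2r ?invr_gt0//; lra.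
  exists (Ordinal tN) => //=; split => /=; last by rewrite subrK.
  move=> j; rewrite in_itv/= /lo /hi !mxE eqxx/=.
  have := le_trans (rV_coord_le_norm x j) x3; rewrite ler_norml => /andP[xj xj'].
  case: eqP => [->|_]; last by rewrite mulr0 subr0 xj.
  move: tl tu; rewrite mulr1 ler_pdivlMr// ltr_pdivrMr// -natr1; lra.
have sumU x : \sum_m (\1_(U m) x : R) <= 2 * b / (rho * delta) * \1_S x.
  have [Sx|Sx] := pselect (S x); last first.
    rewrite [leLHS]big1 ?indicE ?memNset ?mulr0// => m _.
    by rewrite indicE memNset// => -[].
  rewrite indicE mem_set// mulr1 ler_pdivlMr ?mulr_gt0//.
  pose G (m : nat) := g (x + (m%:R * b) *: e i) - g (x + ((m%:R - 1) * b) *: e i).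
  have tele : \sum_(m < N) D2 b i (x + (m%:R * b) *: e i) = G N - G 0.
    rewrite -(big_mkord xpredT (fun m => D2 b i (x + (m%:R * b) *: e i))).
    rewrite -(telescope_sumr G)//; apply: eq_bigr => m _.
    rewrite /second_diff /G -natr1 addrK -!addrA -scalerDl -scalerBl.
    rewrite (_ : m%:R * b + b = (m%:R + 1) * b); last by ring.
    rewrite (_ : m%:R * b - b = (m%:R - 1) * b); last by ring.
    by ring.
  have GN : G N <= rho^-1 * b.
    rewrite /G lerBlDl; have := sublinear_lip gD g_le (x + ((N%:R - 1) * b) *: e i) (b *: e i).
    rewrite -addrA -scalerDl (_ : (N%:R - 1) * b + b = N%:R * b); last by ring.
    move=> /le_trans; apply; rewrite lerD2l ler_pM2l ?invr_gt0//.
    by rewrite normrZ gtr0_norm// -[leRHS]mulr1 ler_pM2l ?rV_norm_delta.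
  have G0 : - G 0 <= rho^-1 * b.
    rewrite /G opprB lerBlDl mul0r scale0r addr0 sub0r.
    have := sublinear_lip gD g_le x ((-1 * b) *: e i) => /le_trans; apply.
    rewrite lerD2l ler_pM2l ?invr_gt0// normrZ mulN1r normrN.
    by rewrite gtr0_norm// -[leRHS]mulr1 ler_pM2l ?rV_norm_delta.
  have cnt : (\sum_m (\1_(U m) x : R)) * delta <=
      \sum_(m < N) D2 b i (x + (m%:R * b) *: e i).
    rewrite mulr_suml; apply: ler_sum => m _; rewrite indicE.
    have [[_ /= Ux]|Ux] := pselect (U m x); first by rewrite mem_set ?mul1r ?ltW.
    by rewrite memNset// mul0r (second_diff_ge0 gD gZ).
  rewrite mulrCA; rewrite -ler_pdivlMl//; apply: le_trans cnt _; rewrite tele.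
  by rewrite mulrC -[leRHS]mulrA; lra.
apply: le_trans (measure_fin_cover lam _ mV BV) _.
  exact: measurableI.
have -> : (\sum_m lam (V m) = \sum_m lam (U m))%E.
  by apply: eq_bigr => m _; exact: lebesgue_rV_shift.
apply: le_trans (measure_multiplicity lam _ mS mU sumU) _.
  by rewrite divr_ge0 ?mulr_ge0 ?ltW.
apply: (@le_trans _ _ ((2 * b / (rho * delta))%:E * (6 ^+ d * b)%:E)%E).
  by apply: lee_wpmul2l => //; rewrite lee_fin divr_ge0 ?mulr_ge0 ?ltW.
rewrite -EFinM lee_fin le_eqVlt; apply/orP; left; apply/eqP.
by field; rewrite !gt_eqF.
Qed.

End second_difference_volume.

(** * Cells: points trapped by the orthants of a parallelotope *)

(** Points in the [2 ^ d] open orthants have the origin in their hull: pair the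
    points whose sign patterns differ in one coordinate only, and cancel that
    coordinate. *)
Lemma orthant_trap (R : realType) d (C : set 'rV[R]_d)
    (c : {ffun 'I_d -> bool} -> 'rV[R]_d) :
  convex_in C -> (forall s, C (c s)) ->
  (forall (s : {ffun 'I_d -> bool}) i, 0 < (-1) ^+ (s i) * c s ord0 i) -> C 0.
Proof.
move=> cC Cc cs.
have H m : (m <= d)%N -> forall s : {ffun 'I_d -> bool}, exists z : 'rV[R]_d,
    [/\ C z, forall i : 'I_d, (i < m)%N -> z ord0 i = 0 &
     forall i : 'I_d, (m <= i)%N -> 0 < (-1) ^+ (s i) * z ord0 i].
  elim: m => [_ s|m IH md s]; first by exists (c s); split => // i _; exact: cs.
  pose i0 := Ordinal md.
  pose st b : {ffun 'I_d -> bool} := [ffun i => if i == i0 then b else s i].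
  have [z1 [Cz1 z10 z1s]] := IH (ltnW md) (st false).
  have [z2 [Cz2 z20 z2s]] := IH (ltnW md) (st true).
  have := z1s i0 (leqnn _); have := z2s i0 (leqnn _).
  rewrite !ffunE eqxx expr0 expr1 mul1r mulN1r => h2 h1.
  set p := z1 ord0 i0 in h1; set n := z2 ord0 i0 in h2.
  have pn : 0 < p - n by lra.
  pose t := - n / (p - n).
  have t01 : 0 < t < 1.
    by rewrite /t ltr_pdivlMr// ltr_pdivrMr//; apply/andP; split; lra.
  exists (t *: z1 + (1 - t) *: z2); split.
  - by apply: cC => //; lra.
  - move=> i; rewrite ltnS leq_eqVlt => /orP[/eqP im|im].
      have -> : i = i0 by apply/val_inj.
      by rewrite !mxE -/p -/n /t; field; lra.
    by rewrite !mxE z10// z20// !mulr0 addr0.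
  - move=> i mi; have ii0 : (i == i0) = false.
      by apply/negbTE; rewrite -val_eqE/= gtn_eqF.
    have := z1s i (ltnW mi); have := z2s i (ltnW mi); rewrite !ffunE ii0 !mxE.
    move: (z1 _ _) (z2 _ _) ((-1) ^+ s i) => u v w; nra.
have [z [Cz z0 _]] := H d (leqnn d) [ffun=> true].
by rewrite (_ : 0 = z)//; apply/rowP => i; rewrite z0// mxE.
Qed.

(** [A s] is meant to be the set of the pairs [(x, y)] with [y] in the orthant of
    signs [s] of a parallelotope centred at [x]; the last clause keeps from this
    geometry only that [x] is trapped.  Sets of pairs make the measurability in
    [x] part of the notion. *)
Definition cell (R : realType) d (P : set 'rV[R]_d -> \bar R) (p : R)
    (G : set 'rV[R]_d) (A : {ffun 'I_d -> bool} -> set ('rV[R]_d * 'rV[R]_d)) :=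
  [/\ measurable G, forall s, measurable (A s),
   forall x s, G x -> (p%:E <= P (xsection (A s) x))%E &
   forall x y, G x -> (forall s, A s (x, y s)) ->
     (forall s, y s <> x) /\ forall C, convex_in C -> (forall s, C (y s)) -> C x].

Section frames.
Context (R : realType) (d : nat) (d0 : (0 < d)%N).
Local Notation mR := (measurableTypeR R).
Local Notation lam := (@lebesgue_measure_rV R d).

Lemma measurable_funV d' (T : measurableType d') (f : T -> mR) :
  measurable_fun setT f -> measurable_fun setT (fun x => (f x : R)^-1 : mR).
Proof.
move=> mf; have -> : (fun x => (f x : R)^-1) =
    (fun x => (f x : R) * powR ((f x : R) ^+ 2) (-1)).
  apply/funext => x; rewrite powR_inv1 ?sqr_ge0//.
  have [->|fx] := eqVneq (f x : R) 0; first by rewrite invr0 mul0r.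
  by rewrite expr2 invfM mulrA divff// mul1r.
apply: measurable_funM => //.
apply: (@measurableT_comp _ _ _ _ _ _ (fun z : mR => powR z (-1) : mR)).
  exact: measurable_powR.
exact: measurable_funX.
Qed.

Lemma measurable_funM_mx d' (T : measurableType d') (f : T -> 'rV[R]_d)
    (M : T -> 'M[R]_d) :
  measurable_fun setT f ->
  (forall j k, measurable_fun setT (fun x => M x j k : mR)) ->
  measurable_fun setT (fun x => f x *m M x).
Proof.
move=> mf mM; apply: measurable_rVP => i.
rewrite (_ : (fun _ => _) = (fun x => \sum_j f x ord0 j * M x j i)); last first.
  by apply/funext => x; rewrite mxE.
apply: measurable_sum => j; apply: measurable_funM; last exact: mM.
by apply: (@measurableT_comp _ _ _ _ _ _ (fun v : 'rV[R]_d => v ord0 j : mR)) => //;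
  exact: measurable_coord_rV.
Qed.

(** Of side [1 / d], so that the coefficients have total size at most 1 and the
    orthants stay in the cross-polytope spanned by the edges. *)
Definition orthant_box (s : {ffun 'I_d -> bool}) : set 'rV[R]_d :=
  [set v | forall l, (-1) ^+ (s l) * v ord0 l \in `]0, d%:R^-1[].

Lemma orthant_boxE s : orthant_box s = [set v : 'rV[R]_d | forall l,
  (if s l then `](- d%:R^-1), 0[ else `]0, d%:R^-1[)%classic (v ord0 l)].
Proof.
apply/seteqP; split=> v /= h l; have := h l; case: (s l) => /=;
  by rewrite !in_itv/= ?expr1 ?expr0 ?mul1r ?mulN1r => /andP[]; lra.
Qed.

Let dV0 : 0 < d%:R^-1 :> R. Proof. by rewrite invr_gt0 ltr0n. Qed.

Lemma measurable_orthant_box s : measurable (orthant_box s).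
Proof.
rewrite orthant_boxE.
apply: (@measurable_prod_rV R d (fun l => (if s l then `](- d%:R^-1), 0[ else `]0, d%:R^-1[)%classic)) => l.
by case: (s l); exact: measurable_itv.
Qed.

Lemma lebesgue_orthant_box s : lam (orthant_box s) = (d%:R^-1 ^+ d)%:E.
Proof.
rewrite orthant_boxE.
rewrite (@lebesgue_rV_prod R d (fun l => (if s l then `](- d%:R^-1), 0[ else `]0, d%:R^-1[)%classic)); last first.
  by move=> l; case: (s l); exact: measurable_itv.
rewrite (eq_bigr (fun=> (d%:R^-1)%:E)) => [|l _].
  by rewrite prodEFin prodr_const card_ord.
by case: (s l) => /=; rewrite lebesgue_measure_itv/= lte_fin ?oppr_lt0 dV0 -?EFinB ?sub0r ?opprK ?subr0.
Qed.

Variables (P : set 'rV[R]_d -> \bar R) (K : set 'rV[R]_d) (kap : R).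

Hypothesis kap0 : 0 <= kap.
Hypothesis PE : forall B, measurable B -> P B = (kap%:E * lam (B `&` K))%E.

(** The orthants are the images of those of the unit frame by the affine map
    [c |-> x + c *m W]; [cc] is its inverse, given as a measurable function
    because [W] depends on [x]. *)
Lemma cell_of_frame (G : set 'rV[R]_d) (J : R) (cc : 'rV[R]_d * 'rV[R]_d -> 'rV[R]_d) :
  measurable G -> measurable_fun setT cc -> 0 <= J ->
  (forall x, G x -> exists W, [/\ W \in unitmx, J <= jac W,
     forall y, cc (x, y) = (y - x) *m invmx W &
     forall c : 'rV[R]_d, \sum_l `|c ord0 l| <= 1 -> K (x + c *m W)]) ->
  cell P (kap * (J * d%:R^-1 ^+ d)) G (fun s => cc @^-1` orthant_box s).
Proof.
move=> mG mcc J0 HG.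
have mA s : measurable (cc @^-1` orthant_box s).
  by rewrite -[X in measurable X]setTI; exact: (mcc measurableT _ (measurable_orthant_box s)).
split => //.
- move=> x s /HG[W [uW JW ccE KW]].
  have -> : xsection (cc @^-1` orthant_box s) x =
      (fun v => v + (- x)) @^-1` ((fun v => v *m invmx W) @^-1` orthant_box s).
    by apply/seteqP; split=> y; rewrite /xsection /= inE /= ccE.
  set B := (fun v => v *m invmx W) @^-1` _.
  have mB : measurable B by exact: (measurable_mulmx_preimage (invmx W) (measurable_orthant_box s)).
  have mB' : measurable ((fun v => v + (- x)) @^-1` B).
    by rewrite -[X in measurable X]setTI; exact: (measurable_shift_rV _ measurableT mB).
  rewrite (PE mB') EFinM; apply: lee_wpmul2l; first by rewrite lee_fin.
  rewrite setIidl; last first.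
    move=> y /= By; rewrite -[y](subrKC x) -[y - x](mulmxKV uW); apply: KW.
    apply: (@le_trans _ _ (\sum_(l < d) d%:R^-1)); last first.
      by rewrite sumr_const card_ord -[X in X <= _]mulr_natr mulVf// pnatr_eq0 -lt0n.
    apply: ler_sum => l _; have := By l; rewrite in_itv/= => /andP[h0 /ltW h1].
    by rewrite -(gtr0_norm h0) normrM normrX normrN1 expr1n mul1r in h1.
  rewrite lebesgue_rV_shift// lebesgue_rV_linear//; last exact: measurable_orthant_box.
  rewrite lebesgue_orthant_box -EFinM lee_fin; apply: ler_wpM2r => //.
- move=> x y /HG[W [uW _ ccE _]] Ay.
  have {}Ay s : orthant_box s ((y s - x) *m invmx W) by rewrite -ccE; exact: Ay.
  split=> [s ys|C cC Cy].
    have := Ay s (Ordinal d0); rewrite ys subrr mul0mx mxE mulr0 in_itv/= ltxx//.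
  have : [set z | C (x + z *m W)] 0.
    apply: (@orthant_trap R d _ (fun s => (y s - x) *m invmx W)).
    - move=> u v t Cu Cv t01 /=.
      rewrite (_ : _ + _ = t *: (x + u *m W) + (1 - t) *: (x + v *m W)); first exact: cC.
      rewrite mulmxDl -!scalemxAl !scalerDr addrACA -scalerDl.
      by rewrite (_ : t + (1 - t) = 1) ?scale1r//; ring.
    - by move=> s /=; rewrite mulmxKV// subrKC.
    - by move=> s i; have := Ay s i; rewrite in_itv => /andP[].
  by rewrite /= mul0mx addr0.
Qed.

End frames.

(** * The cells of a convex set normalised by cubes *)

Section frame.
Context (R : realType) (d : nat) (i : 'I_d).
Local Notation mR := (measurableTypeR R).

Lemma invmx_eq (A B : 'M[R]_d) : A *m B = 1%:M -> invmx A = B.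
Proof.
by move=> AB; have [uA _] := mulmx1_unit AB; rewrite -[B](mulKmx uA) AB mulmx1.
Qed.

(** The matrix [frame] has the rows [a e_l - s_l x] for [l <> i] and [+- delta x]
    for [l = i] (see [row_frame]).  Written as a product of a shear, a diagonal
    matrix and a shear, it has an explicit inverse and volume factor. *)
Definition frame_from (x : 'rV[R]_d) : 'rV[R]_d := (x ord0 i)^-1 *: x - delta_mx ord0 i.

Definition frame_into (delta : R) (s x : 'rV[R]_d) : 'rV[R]_d :=
  \row_l (if l == i then 0 else - (s ord0 l * x ord0 i) / (delta * `|x ord0 i|)).

Definition frame_diag (a delta : R) (x : 'rV[R]_d) : 'rV[R]_d :=
  \row_l (if l == i then delta * `|x ord0 i| else a).

Definition frame a delta s x : 'M[R]_d :=
  (1%:M + (frame_into delta s x)^T *m delta_mx ord0 i) *m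
  diag_mx (frame_diag a delta x) *m (1%:M + delta_mx i ord0 *m frame_from x).

Definition frame_inv a delta s x : 'M[R]_d :=
  (1%:M - delta_mx i ord0 *m frame_from x) *m
  (diag_mx (\row_l (frame_diag a delta x ord0 l)^-1) *m
  (1%:M - (frame_into delta s x)^T *m delta_mx ord0 i)).

Variables (a delta : R) (s x : 'rV[R]_d).
Hypotheses (a0 : 0 < a) (delta0 : 0 < delta) (xi0 : x ord0 i != 0).

Let from0 : frame_from x ord0 i = 0.
Proof. by rewrite !mxE !eqxx mulVf// subrr. Qed.

Let into0 : frame_into delta s x ord0 i = 0.
Proof. by rewrite mxE eqxx. Qed.

Let diag_gt0 l : 0 < frame_diag a delta x ord0 l.
Proof. by rewrite mxE; case: ifP => _//; rewrite mulr_gt0// normr_gt0. Qed.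

Lemma frameP :
  [/\ frame a delta s x \in unitmx,
     invmx (frame a delta s x) = frame_inv a delta s x &
     jac (frame a delta s x) = a ^+ d.-1 * (delta * `|x ord0 i|)].
Proof.
have [u1 j1] := jac_shear_into into0.
have [u2 j2] := jac_shear_from from0.
have dn0 l : frame_diag a delta x ord0 l != 0 by rewrite gt_eqF.
have uD := unitmx_diag dn0.
have u12 : (1%:M + (frame_into delta s x)^T *m delta_mx ord0 i) *m
  diag_mx (frame_diag a delta x) \in unitmx by rewrite unitmx_mul u1.
split; first by rewrite unitmx_mul u12.
- rewrite invmxM// invmxM// /frame_inv.
  rewrite (invmx_eq (square0_unit (shear_from_sqr0 from0))).
  by rewrite (invmx_eq (square0_unit (shear_into_sqr0 into0))) (invmx_eq (diag_mx_inv dn0)).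
- rewrite jacM// jacM// j1 j2 mul1r mulr1 jac_diag// (bigD1 i)//= mxE eqxx mulrC.
  congr (_ * _); rewrite (eq_bigr (fun=> a)) => [|l li]; last by rewrite mxE (negbTE li).
  rewrite prodr_const; congr (_ ^+ _).
  by rewrite -[in RHS](card_ord d) -(cardC1 i); apply: eq_card => l; rewrite !inE.
Qed.

Lemma row_frame l : row l (frame a delta s x) =
  if l == i then (delta * `|x ord0 i| / x ord0 i) *: x
  else a *: delta_mx ord0 l - s ord0 l *: x.
Proof.
apply/rowP => k; rewrite /frame mulmxDr mulmx1 mulmxA -colE mul_mx_diag !mxE !big_ord1 !mxE big_ord1 !mxE.
rewrite !eqxx/=; have [->|li] := eqVneq l i; rewrite !mxE ?eqxx/=.
  by rewrite (eq_sym k); case: eqVneq => [<-|_] /=; field.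
have dx : delta * `|x ord0 i| != 0 by rewrite mulf_neq0 ?normr_eq0// gt_eqF.
have [->|ki] := eqVneq k i; rewrite ?(negbTE li) /=.
  by rewrite eq_sym (negbTE li) /=; field; rewrite xi0 normr_eq0 xi0 gt_eqF.
rewrite (eq_sym l k); case: eqVneq => _ /=;
  by field; rewrite xi0 normr_eq0 xi0 gt_eqF.
Qed.

End frame.

Lemma measurable_frame_inv (R : realType) d (i : 'I_d) (a delta : R)
    (s : 'rV[R]_d -> 'rV[R]_d) :
  (forall l, measurable_fun setT (fun x => s x ord0 l : measurableTypeR R)) ->
  measurable_fun setT (fun p : 'rV[R]_d * 'rV[R]_d =>
    (p.2 - p.1) *m frame_inv i a delta (s p.1) p.1).
Proof.
move=> ms.
have mx l : measurable_fun setT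
    (fun p : 'rV[R]_d * 'rV[R]_d => p.1 ord0 l : measurableTypeR R).
  apply: (measurableT_comp (@measurable_coord_rV R d l)); exact: measurable_fst.
have mxV l := measurable_funV (mx l).
have mnx : measurable_fun setT
    (fun p : 'rV[R]_d * 'rV[R]_d => delta * `|p.1 ord0 i| : measurableTypeR R).
  apply: measurable_funM; first exact: measurable_cst.
  exact: (measurableT_comp (@normr_measurable R setT) (mx i)).
have mc (c : R) : measurable_fun setT
  (fun p : 'rV[R]_d * 'rV[R]_d => c : measurableTypeR R) by exact: measurable_cst.
rewrite (_ : (fun _ => _) = (fun p : 'rV[R]_d * 'rV[R]_d => (p.2 - p.1) *m
  (1%:M - delta_mx i ord0 *m frame_from i p.1) *m
  diag_mx (\row_l (frame_diag i a delta p.1 ord0 l)^-1) *m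
  (1%:M - (frame_into i delta (s p.1) p.1)^T *m delta_mx ord0 i))); last first.
  by apply/funext => p; rewrite /frame_inv !mulmxA.
apply: measurable_funM_mx; first apply: measurable_funM_mx;
  first apply: measurable_funM_mx.
- apply: measurable_funD_rV; first exact: measurable_snd.
  rewrite (_ : (fun _ => _) = fun p : 'rV[R]_d * 'rV[R]_d => (-1) *: p.1).
    apply: measurable_funZ_rV; [exact: measurable_cst|exact: measurable_fst].
  by apply/funext => p; rewrite scaleN1r.
- move=> j k; rewrite (_ : (fun _ => _) = fun p : 'rV[R]_d * 'rV[R]_d =>
    (j == k)%:R - (j == i)%:R * ((p.1 ord0 i)^-1 * p.1 ord0 k - (k == i)%:R)).
    apply: measurable_funB; first exact: mc.
    apply: measurable_funM; first exact: mc.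
    apply: measurable_funB; last exact: mc.
    by apply: measurable_funM; [exact: mxV|exact: mx].
  by apply/funext => p; rewrite !mxE big_ord1 !mxE !eqxx andbT.
- move=> j k; rewrite (_ : (fun _ => _) = fun p : 'rV[R]_d * 'rV[R]_d =>
    (if j == i then delta * `|p.1 ord0 i| else a)^-1 * (j == k)%:R).
    apply: measurable_funM; last exact: mc.
    by apply: measurable_funV; case: (j == i); [exact: mnx|exact: mc].
  by apply/funext => p; rewrite !mxE mulr_natr.
- move=> j k; rewrite (_ : (fun _ => _) = fun p : 'rV[R]_d * 'rV[R]_d =>
    (j == k)%:R - (if j == i then 0 else - (s p.1 ord0 j * p.1 ord0 i) /
       (delta * `|p.1 ord0 i|)) * (k == i)%:R).
    apply: measurable_funB; first exact: mc.
    apply: measurable_funM; last exact: mc.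
    case: (j == i); first exact: mc.
    apply: measurable_funM; last exact: measurable_funV.
    apply: (measurableT_comp (@oppr_measurable R setT)).
    apply: measurable_funM; last exact: mx.
    by apply: (measurableT_comp (ms j)); exact: measurable_fst.
  by apply/funext => p; rewrite !mxE big_ord1 !mxE !eqxx.
Qed.

(** At scale [k], with [n] of order [k ^ (d + 1)]: the exceptional set has
    measure of order [k ^ -2], the measure of the cells at level [j] is at most
    [D ^ j] times that, and [n] times the measure of their orthants is at least
    of order [2 ^ j]. *)
Definition cell_cover (R : realType) d (c C D : R) (P : set 'rV[R]_d -> \bar R)
    (K : set 'rV[R]_d) (k : nat) :=
  exists J (E : set 'rV[R]_d) (G : 'I_J.+1 * 'I_d -> set 'rV[R]_d)
    (A : 'I_J.+1 * 'I_d -> {ffun 'I_d -> bool} -> set ('rV[R]_d * 'rV[R]_d)),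
  [/\ measurable E, (P E <= (C / k%:R ^+ 2)%:E)%E, K `<=` E `|` \bigcup_t G t &
   forall t : 'I_J.+1 * 'I_d, cell P (c * 2 ^+ t.1 / k%:R ^+ d.+1) (G t) (A t) /\
     (P (G t) <= (C * D ^+ t.1 / k%:R ^+ 2)%:E)%E].

Section cover.
Context (R : realType) (d : nat) (g : 'rV[R]_d -> R) (rho : R).
Hypothesis d2 : (2 <= d)%N.
Hypothesis rho0 : 0 < rho.
Hypothesis rho1 : rho <= 1.
Hypothesis gD : forall x y, g (x + y) <= g x + g y.
Hypothesis gZ : forall r x, 0 <= r -> g (r *: x) = r * g x.
Hypothesis g_le : forall x, g x <= rho^-1 * `|x|.
Hypothesis g_ge : forall x, `|x| <= 3 * g x.
Variables (P : set 'rV[R]_d -> \bar R) (K : set 'rV[R]_d) (kap klo khi : R).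

Hypothesis gK : forall x, g x < 1 -> K x.
Hypothesis Kg : forall x, K x -> g x <= 1.
Hypothesis mK : measurable K.
Hypothesis klo0 : 0 < klo.
Hypothesis kloE : klo <= kap.
Hypothesis khiE : kap <= khi.
Hypothesis PE : forall B, measurable B -> P B = (kap%:E * lebesgue_measure_rV (B `&` K))%E.
Hypothesis P1 : forall B, measurable B -> (P B <= 1)%E.
Local Notation lam := (@lebesgue_measure_rV R d).
Local Notation D2 := (second_diff g).
Local Notation mR := (measurableTypeR R).

Let d0 : (0 < d)%N. Proof. exact: leq_trans d2. Qed.
Let kap0 : 0 < kap. Proof. exact: lt_le_trans kloE. Qed.

Let mg : measurable_fun setT (g : 'rV[R]_d -> mR).
Proof. by apply: (measurable_sublinear rho0 gD g_le). Qed.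

Let mD2 b i : measurable_fun setT (D2 b i : 'rV[R]_d -> mR).
Proof. exact: (measurable_second_diff rho0 gD g_le). Qed.

Lemma cell_le p p' G A : p' <= p -> cell P p G A -> cell P p' G A.
Proof.
move=> pp' [mG mA PA AG]; split => // x s Gx; apply: le_trans (PA x s Gx).
by rewrite lee_fin.
Qed.

Lemma measurable_slope b l : measurable_fun setT (slope g b l : 'rV[R]_d -> mR).
Proof.
apply: measurable_funM; last exact: measurable_cst.
by apply: measurable_funB; apply: (measurable_sublinear rho0 gD g_le);
  exact: measurable_shift_rV.
Qed.

(** One edge along [x], of length proportional to the depth [delta], and [d - 1]
    tilted edges of length [a]. *)
Lemma graded_cell (a delta : R) (i : 'I_d) (G : set 'rV[R]_d) :
  0 < delta -> delta <= 1 -> 0 < a -> a <= rho / 4 -> measurable G ->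
  (forall x, G x -> [/\ 1 / 2 <= g x, g x <= 1 - delta,
    forall l, D2 (a *+ 2) l x <= delta & rho / 2 <= `|x ord0 i|]) ->
  exists A, cell P (kap * ((a ^+ d.-1 * (delta * (rho / 2))) * d%:R^-1 ^+ d)) G A.
Proof.
move=> delta0 delta1 a0 ar mG GP.
pose s (x : 'rV[R]_d) : 'rV[R]_d := \row_l (a * slope g (a *+ 2) l x / g x).
have ms l : measurable_fun setT (fun x => s x ord0 l : mR).
  rewrite (_ : (fun _ => _) = fun x => a * slope g (a *+ 2) l x * (g x)^-1); last first.
    by apply/funext => x; rewrite mxE.
  apply: measurable_funM; last exact: measurable_funV.
  by apply: measurable_funM; [exact: measurable_cst|exact: measurable_slope].
have := @cell_of_frame R d d0 P K kap (ltW kap0) PE G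
  (a ^+ d.-1 * (delta * (rho / 2))) _ mG (measurable_frame_inv i a delta ms).
move=> H; eexists; apply: H.
  by rewrite !mulr_ge0 ?exprn_ge0 ?invr_ge0 ?(ltW a0) ?(ltW delta0) ?(ltW rho0).
move=> x /GP[g2 gd Dx xi].
have xi0 : x ord0 i != 0 by rewrite -normr_gt0; apply: lt_le_trans xi; rewrite divr_gt0.
have [uW iW jW] := frameP (s x) a0 delta0 xi0.
exists (frame i a delta (s x) x); split => //.
- rewrite jW; apply: ler_wpM2l; first by rewrite exprn_ge0// ltW.
  by apply: ler_wpM2l => //; exact: ltW.
- by move=> y; rewrite iW.
move=> c c1; apply: gK; apply: (cross_polytope gD gZ) => //; last by lra.
move=> l; rewrite row_frame//; case: ifP => [_|li].
  have : delta * `|x ord0 i| / x ord0 i = delta \/ delta * `|x ord0 i| / x ord0 i = - delta.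
    by case: (ger0P (x ord0 i)) => _; [left|right]; field.
  have h (r : R) : -1 <= r -> g (x + r *: x) = (1 + r) * g x.
    by move=> r1; rewrite -{1}[x]scale1r -scalerDl gZ//; lra.
  by case=> ->; rewrite -?scaleNr !h; nra.
have := @tilted_segment R d g rho rho0 gD gZ g_le delta a l x delta0 a0 ar g2 gd (Dx l) _ erefl.
by rewrite mxE.
Qed.

(** Far from the boundary small cubes do. *)
Lemma central_cell (eta : R) (G : set 'rV[R]_d) : 0 < eta ->
  measurable G -> (forall x, G x -> g x <= 1 - eta) ->
  exists A, cell P (kap * ((rho * eta / 2) ^+ d * d%:R^-1 ^+ d)) G A.
Proof.
move=> eta0 mG Ge; set w := rho * eta / 2.
have w0 : 0 < w by rewrite /w !mulr_gt0.
pose W := diag_mx (const_mx w : 'rV[R]_d).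
have uW : W \in unitmx by apply: unitmx_diag => l; rewrite mxE gt_eqF.
have mcc : measurable_fun setT (fun p : 'rV[R]_d * 'rV[R]_d => (p.2 - p.1) *m invmx W).
  apply: measurable_funM_rV; apply: measurable_funD_rV; first exact: measurable_snd.
  rewrite (_ : (fun _ => _) = fun p : 'rV[R]_d * 'rV[R]_d => (-1) *: p.1).
    apply: measurable_funZ_rV; [exact: measurable_cst|exact: measurable_fst].
  by apply/funext => p; rewrite scaleN1r.
have := @cell_of_frame R d d0 P K kap (ltW kap0) PE G (w ^+ d) _ mG mcc.
move=> H; eexists; apply: H; first by rewrite exprn_ge0// ltW.
move=> x /Ge gx; exists W; split => //.
  rewrite jac_diag => [|l]; last by rewrite mxE.
  by rewrite (eq_bigr (fun=> w)) => [|l _]; rewrite ?mxE// prodr_const card_ord.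
move=> c c1; apply: gK; apply: le_lt_trans (sublinear_lip gD g_le _ _) _.
have : `|c *m W| <= w.
  apply: rV_norm_le; first exact: ltW.
  move=> l; rewrite mul_mx_diag !mxE normrM (gtr0_norm w0).
  rewrite -[leRHS]mul1r ler_pM2r//; apply: le_trans c1.
  by rewrite (bigD1 l)//= lerDl sumr_ge0.
move=> cw; have : rho^-1 * `|c *m W| <= eta / 2.
  by rewrite ler_pdivrMl//; apply: le_trans cw _; rewrite /w mulrA.
by lra.
Qed.

Let Q3 : set 'rV[R]_d := [set x | `|x| <= 3].
Let lamQ3 : lam Q3 = (6 ^+ d)%:E.
Proof.
rewrite (_ : Q3 = [set v : 'rV[R]_d | forall i, v ord0 i \in `[(-3), 3]]).
  rewrite (@lebesgue_measure_rV_box R d (fun=> -3) (fun=> 3)); last by move=> _; lra.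
  rewrite (eq_bigr (fun=> 6)) => [|j _]; last by lra.
  by rewrite prodr_const card_ord.
apply/seteqP; split=> x /= h.
  by move=> j; rewrite in_itv/= -ler_norml; exact: le_trans (rV_coord_le_norm _ _) h.
by apply: rV_norm_le => // j; have := h j; rewrite in_itv/= -ler_norml.
Qed.

Let P_le_lam B : measurable B -> (P B <= khi%:E * lam B)%E.
Proof.
move=> mB; rewrite PE//; apply: lee_pmul => //; rewrite ?lee_fin ?(ltW kap0)//.
by apply: le_measure; rewrite ?inE//; exact: measurableI.
Qed.

Let layer (e e' : R) : set 'rV[R]_d := [set x | 1 - e < g x <= 1 - e'].

Let mlayer e e' : measurable (layer e e').
Proof.
rewrite (_ : layer e e' = [set x | g x \in `](1 - e), (1 - e')]]).
  exact: measurable_preimage_itv.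
by apply/seteqP; split=> x /=; rewrite in_itv.
Qed.

Let C1 : R := khi * (4 * 2 ^+ d * 6 ^+ d) + 2.

Let khi0 : 0 < khi. Proof. exact: lt_le_trans khiE. Qed.

(* for thick layers the bound is trivial, as P is at most 1 *)
Let P_layer e e' : 0 < e -> 0 <= e' -> (P (layer e e') <= (C1 * e)%:E)%E.
Proof.
move=> e0 e'0; have [e2|e2] := leP e (1/2); last first.
  apply: le_trans (P1 (mlayer _ _)) _; rewrite lee_fin /C1.
  have : 0 <= khi * (4 * 2 ^+ d * 6 ^+ d) by rewrite !mulr_ge0 ?exprn_ge0 ?(ltW khi0).
  nra.
apply: le_trans (P_le_lam (mlayer _ _)) _.
apply: (@le_trans _ _ (khi%:E * ((4 * 2 ^+ d * e)%:E * lam Q3))%E).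
  apply: lee_wpmul2l; first by rewrite lee_fin ltW.
  apply: (layer_volume gZ) => //; first by rewrite e0.
  - exact: measurable_norm_le_rV.
  - by move=> x /= /andP[-> h]; rewrite (le_trans h)//; lra.
  - move=> r x /andP[r2 r1] /= /andP[_ gx]; have := g_ge x => h.
    by rewrite /Q3 /= normrZ ger0_norm; nra.
rewrite lamQ3 -!EFinM lee_fin /C1; nra.
Qed.

Let bad e e' b l : set 'rV[R]_d := layer e e' `&` [set x | e' < D2 b l x].

Let mbad e e' b l : measurable (bad e e' b l).
Proof.
apply: measurableI => //.
rewrite (_ : mkset _ = [set x | D2 b l x \in `]e', +oo[]).
  exact: measurable_preimage_itv.
by apply/seteqP; split=> x /=; rewrite in_itv/= andbT.
Qed.

Let C2 : R := khi * (4 * 2 ^+ d * (4 * 6 ^+ d / rho)).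

(* The condition on second differences is compatible with shrinking by a factor
   between 1 / 2 and 1 at the price of halving the threshold, so that the layer
   gets its share of the set of large second differences. *)
Let P_bad e e' b l : 0 < e' -> 0 < e <= 1 / 2 -> 0 < b <= 1 ->
  (P (bad e e' b l) <= (C2 * (e / e' * b ^+ 2))%:E)%E.
Proof.
move=> e'0 e2 b1; apply: le_trans (P_le_lam (mbad _ _ _ _)) _.
pose T : set 'rV[R]_d := [set x | `|x| <= 3 /\ e' / 2 < D2 b l x].
have mT : measurable T.
  rewrite (_ : T = [set x | `|x| <= 3] `&` [set x | D2 b l x \in `](e' / 2), +oo[]).
    by apply: measurableI; [exact: measurable_norm_le_rV|exact: measurable_preimage_itv].
  by apply/seteqP; split=> x /=; rewrite in_itv/= andbT.
apply: (@le_trans _ _ (khi%:E * ((4 * 2 ^+ d * e)%:E * (2 * 6 ^+ d / rho * (b ^+ 2 / (e' / 2)))%:E))%E).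
  apply: lee_wpmul2l; first by rewrite lee_fin ltW.
  apply: (@le_trans _ _ ((4 * 2 ^+ d * e)%:E * lam T)%E); last first.
    apply: lee_wpmul2l; first by rewrite lee_fin !mulr_ge0 ?exprn_ge0//; lra.
    by apply: (second_diff_volume rho0 gD gZ g_le) => //; lra.
  apply: (layer_volume gZ) => //.
  - by move=> x [/= /andP[-> h] _]; rewrite (le_trans h)//; lra.
  - move=> r x /andP[r2 r1] [/= /andP[_ gx] Dx]; have := g_ge x => h.
    split; first by rewrite /= normrZ ger0_norm; nra.
    have r0 : 0 < r by lra.
    rewrite second_diff_scale//.
    have : D2 b l x <= D2 (b / r) l x.
      have /andP[b0 _] := b1.
      by apply: (second_diff_mono gD gZ); rewrite b0 ler_pdivlMr//; nra.
    move=> hD; have : r * D2 b l x <= r * D2 (b / r) l x by rewrite ler_pM2l.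
    nra.
rewrite -!EFinM lee_fin le_eqVlt; apply/orP; left; apply/eqP; rewrite /C2.
by field; rewrite !gt_eqF.
Qed.

(* From one layer to the next the depth is multiplied by D while the short edges
   are halved: the volume a ^ (d - 1) delta grows by the factor 2 ^ (d - 1). *)
Let DN := (4 ^ d.-1)%N.
Let D : R := DN%:R.
Let C3 : R := C2 * D.
Let eta : R := (2 * D)^-1.

Definition cover_lower : R :=
  klo * d%:R^-1 ^+ d * ((rho / 8) ^+ d.-1 * (rho / 2)) * (rho * eta / 2) ^+ d.

Definition cover_upper : R := C1 + C1 * D + 2 * D + 2 * d%:R * C3.

Let DE : D = 4 ^+ d.-1. Proof. by rewrite /D natrX. Qed.

Let D4 : 4 <= D.
Proof.
rewrite DE -[leLHS]expr1; apply: ler_weXn2l; first by lra.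
by rewrite -ltnS prednK.
Qed.

Lemma cover_lower_gt0 : 0 < cover_lower.
Proof.
have dV : 0 < d%:R^-1 :> R by rewrite invr_gt0 ltr0n.
have e0 : 0 < eta by rewrite /eta invr_gt0; have := D4; lra.
by rewrite /cover_lower !(mulr_gt0, exprn_gt0, divr_gt0).
Qed.

(** The layers of depth [D ^ j / k ^ 2], up to a depth of order 1.  In each of
    them the exceptional set has measure of order [a j ^ 2], with
    [a j = O(2 ^ -j / k)]; these sum up to [O(k ^ -2)].  The central cell is
    counted as the last layer. *)
Lemma cell_coverP k : (0 < k)%N -> cell_cover cover_lower cover_upper D P K k.
Proof.
move=> k0; have kR : 1 <= k%:R :> R by rewrite ler1n.
have kR0 : 0 < k%:R :> R by lra.
have k20 : 0 < k%:R ^+ 2 :> R by rewrite exprn_gt0.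
have D0 : 0 < D by have := D4; lra.
have exJ : exists J, (k ^ 2 < 2 * DN ^ J.+1)%N.
  exists (k ^ 2)%N; apply: (@leq_trans (2 ^ (k ^ 2).+1)).
    by rewrite (leq_trans (ltn_expl _ (ltnSn 1)))// leq_exp2l.
  apply: leq_trans (leq_pmull _ _) => //; rewrite leq_exp2r//.
  rewrite /DN -(prednK (_ : 0 < d.-1)%N); last by rewrite -ltnS prednK.
  by rewrite expnS; apply: leq_trans (leq_pmulr _ _); rewrite ?expn_gt0.
(* the first J with D ^ (J + 1) / k ^ 2 above 1 / 2 *)
have [J JP Jmin] := ex_minnP exJ.
pose delta j : R := D ^+ j / k%:R ^+ 2.
pose a j : R := (rho / 8) / (k%:R * 2 ^+ j).
have delta0 j : 0 < delta j by rewrite divr_gt0// exprn_gt0.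
have deltaS j : delta j.+1 = D * delta j by rewrite /delta exprS mulrA.
have a0 j : 0 < a j by rewrite !divr_gt0// mulr_gt0// exprn_gt0.
have ar j : a j <= rho / 8.
  rewrite ler_pdivrMr ?mulr_gt0 ?exprn_gt0// ler_peMr ?divr_ge0 ?(ltW rho0)//.
  by rewrite -[leLHS]mulr1; apply: ler_pM => //; rewrite exprn_ege1// ler1n.
have Jsmall j : (j < J)%N -> delta j.+1 <= 1 / 2.
  move=> jJ; rewrite /delta ler_pdivrMr//.
  have : ~~ (k ^ 2 < 2 * DN ^ j.+1)%N by apply/negP => /Jmin; rewrite leqNgt jJ.
  rewrite -leqNgt -(ler_nat R) natrM (natrX _ DN) (natrX _ k) -/D; lra.
have Jbig : eta <= delta J.
  move: JP; rewrite -(ltr_nat R) natrM (natrX _ DN) (natrX _ k) -/D /delta /eta => h.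
  rewrite ler_pdivlMr// ler_pdivrMl; last by rewrite mulr_gt0.
  by rewrite -mulrA -exprS ltW.
pose G0 (j : nat) (i : 'I_d) : set 'rV[R]_d := layer (delta j.+1) (delta j) `&`
  [set x | (forall l, D2 (a j *+ 2) l x <= delta j) /\ rho / 2 <= `|x ord0 i|].
pose Gc : set 'rV[R]_d := [set x | g x <= 1 - delta J].
pose G (t : 'I_J.+1 * 'I_d) := if (t.1 < J)%N then G0 t.1 t.2 else Gc.
have mG0 j i : measurable (G0 j i).
  apply: measurableI => //.
  rewrite (_ : mkset _ = (\bigcap_(l in [set: 'I_d]) [set x | D2 (a j *+ 2) l x \in `]-oo, delta j]])
     `&` [set x | `|x ord0 i| \in `[rho / 2, +oo[]).
    apply: measurableI; first by apply: fin_bigcap_measurable => // l _; exact: measurable_preimage_itv.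
    apply: measurable_preimage_itv.
    exact: (measurableT_comp (@normr_measurable R setT) (@measurable_coord_rV R d i)).
  apply/seteqP; split=> x /= [h1 h2]; split; rewrite ?in_itv/= ?andbT//.
  - by move=> l _; rewrite /= in_itv/=.
  - by move=> l; have := h1 l I; rewrite /= in_itv/=.
  - by move: h2; rewrite in_itv/= andbT.
have mGc : measurable Gc.
  rewrite (_ : Gc = [set x | g x \in `]-oo, (1 - delta J)]]).
    exact: measurable_preimage_itv.
  by apply/seteqP; split=> x /=; rewrite in_itv.
have mG t : measurable (G t) by rewrite /G; case: ifP.
pose E : set 'rV[R]_d := layer (delta 0) 0 `|`
  \bigcup_t (fun t : 'I_J * 'I_d => bad (delta t.1.+1) (delta t.1) (a t.1 *+ 2) t.2) t.
have aD j : a j ^+ d.-1 * delta j =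
    (rho / 8) ^+ d.-1 * (2 ^+ j) ^+ d.-1 / k%:R ^+ d.+1.
  rewrite /a /delta expr_div_n [(k%:R * _) ^+ _]exprMn.
  have -> : D ^+ j = (2 ^+ j) ^+ d.-1 * (2 ^+ j) ^+ d.-1.
    by rewrite DE -expr2 -!exprM (_ : 4 = 2 ^+ 2) -?exprM; [congr (_ ^+ _); ring|ring].
  have -> : d.+1 = (d.-1 + 2)%N by rewrite addn2 prednK.
  rewrite exprD; move: (expf_neq0 d.-1 (lt0r_neq0 kR0)).
  have : (2 ^+ j) ^+ d.-1 != 0 :> R by rewrite !expf_neq0.
  set r := (rho / 8) ^+ d.-1; set u := (2 ^+ j) ^+ d.-1; set v := k%:R ^+ d.-1 => u0 v0.
  by field; rewrite u0 v0 lt0r_neq0.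
have two_pow j : 2 ^+ j <= (2 ^+ j) ^+ d.-1 :> R.
  rewrite -[leLHS]expr1; apply: ler_weXn2l; first by rewrite exprn_ege1// ler1n.
  by rewrite -ltnS prednK.
have kd0 : 0 < k%:R ^+ d.+1 :> R by rewrite exprn_gt0.
have eta0 : 0 < eta by rewrite /eta invr_gt0 mulr_gt0.
have eta1 : eta <= 1 by rewrite /eta invf_le1 ?mulr_gt0//; have := D4; lra.
have dV0 : 0 < d%:R^-1 ^+ d :> R by rewrite exprn_gt0// invr_gt0 ltr0n.
have le1X (r : R) n : 0 < r -> r <= 1 -> r ^+ n <= 1.
  by move=> r0 r1; rewrite exprn_ile1// ltW.
have r0 : 0 < rho := rho0; have r1 : rho <= 1 := rho1.
set theta := (rho * eta / 2) ^+ d.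
have theta0 : 0 < theta by rewrite exprn_gt0// !mulr_gt0.
have theta1 : theta <= 1.
  have : rho * eta <= 1 by rewrite -[leRHS]mulr1; apply: ler_pM => //; exact: ltW.
  by move=> h; apply: le1X; [rewrite !mulr_gt0|lra].
set psi := (rho / 8) ^+ d.-1 * (rho / 2).
have psi0 : 0 < psi by rewrite mulr_gt0// ?exprn_gt0// divr_gt0.
have psi1 : psi <= 1.
  have h : (rho / 8) ^+ d.-1 <= 1.
    by apply: le1X; [rewrite divr_gt0|rewrite ler_pdivrMr//; have := rho1; lra].
  have h0 : 0 < (rho / 8) ^+ d.-1 by rewrite exprn_gt0// divr_gt0.
  by rewrite /psi; move: h h0; move: (_ ^+ _) => y; nra.
have lowE : cover_lower = klo * d%:R^-1 ^+ d * psi * theta by [].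
have two_J : 2 ^+ J <= k%:R ^+ d.+1 :> R.
  apply: (@le_trans _ _ (k%:R ^+ 2)); last by rewrite ler_weXn2l.
  case: (posnP J) => [->|J0]; first by rewrite expr0 exprn_ege1.
  have /Jsmall : (J.-1 < J)%N by rewrite prednK.
  rewrite prednK// /delta ler_pdivrMr// => h.
  apply: (@le_trans _ _ (D ^+ J)); last by lra.
  by apply: lerXn2r; rewrite ?nnegrE ?(ltW D0)//; have := D4; lra.
have cellG (t : 'I_J.+1 * 'I_d) :
    exists A, cell P (cover_lower * 2 ^+ t.1 / k%:R ^+ d.+1) (G t) A.
  rewrite /G; case: ifPn => tJ.
    have [|||A AP] := @graded_cell (a t.1) (delta t.1) t.2 _ (delta0 _) _ (a0 _) _ (mG0 t.1 t.2).
    - by have := Jsmall _ tJ; rewrite deltaS; have := D4; have := delta0 t.1; nra.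
    - by have := ar t.1; lra.
    - move=> x [/andP[g1 g2] [Dx xi]]; split => //.
      by have := Jsmall _ tJ; lra.
    exists A; apply: cell_le AP.
    rewrite mulrA [a _ ^+ _ * _]mulrA aD lowE.
    rewrite (_ : _ / _ = (d%:R^-1 ^+ d * psi / k%:R ^+ d.+1) * (klo * theta * 2 ^+ t.1)); last by ring.
    rewrite [leRHS](_ : _ = (d%:R^-1 ^+ d * psi / k%:R ^+ d.+1) * (kap * (2 ^+ t.1) ^+ d.-1)); last first.
      by rewrite /psi; ring.
    apply: ler_wpM2l; first by apply: divr_ge0; [apply: mulr_ge0|]; exact: ltW.
    apply: ler_pM => //; rewrite ?mulr_ge0 ?(ltW klo0) ?(ltW theta0) ?exprn_ge0//.
    by apply: le_trans kloE; rewrite ler_piMr// ltW.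
  have [|A AP] := @central_cell eta Gc eta0 mGc.
    by move=> x; rewrite /Gc /= => h; apply: le_trans h _; rewrite lerD2l lerN2.
  have tE : t.1 = J :> nat.
    by apply/eqP; rewrite eqn_leq [(J <= _)%N]leqNgt tJ andbT -ltnS ltn_ord.
  exists A; apply: cell_le AP; rewrite -/theta tE lowE.
  rewrite (_ : _ / _ = (theta * d%:R^-1 ^+ d) * ((klo * psi) * (2 ^+ J / k%:R ^+ d.+1))); last by ring.
  rewrite [leRHS]mulrC; apply: ler_wpM2l; first by rewrite mulr_ge0 ?ltW.
  have : 2 ^+ J / k%:R ^+ d.+1 <= 1 :> R by rewrite ler_pdivrMr// mul1r.
  have : 0 <= 2 ^+ J / k%:R ^+ d.+1 :> R by rewrite divr_ge0 ?exprn_ge0.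
  move: (_ / _) => v v0 v1.
  have h : klo * psi <= kap by apply: le_trans kloE; rewrite ler_piMr// ltW.
  have : 0 < klo * psi by rewrite mulr_gt0.
  nra.
have [A AP] := choice cellG.
have P_mono B B' : measurable B -> measurable B' -> B `<=` B' -> (P B <= P B')%E.
  move=> mB mB' BB'; rewrite !PE//; apply: lee_wpmul2l; first by rewrite lee_fin ltW.
  by apply: le_measure; rewrite ?inE; [exact: measurableI|exact: measurableI|exact: setSI].
pose Ub := \bigcup_t (fun t : 'I_J * 'I_d => bad (delta t.1.+1) (delta t.1) (a t.1 *+ 2) t.2) t.
have mUb : measurable Ub by apply: fin_bigcup_measurable => //.
have mE : measurable E by apply: measurableU.
have C20 : 0 < C2 by rewrite /C2 !(mulr_gt0, exprn_gt0, invr_gt0).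
have C30 : 0 < C3 by rewrite /C3 mulr_gt0.
have C10 : 0 < C1 by rewrite /C1 addr_gt0// !(mulr_gt0, exprn_gt0).
have PUb : (P Ub <= (2 * d%:R * C3 / k%:R ^+ 2)%:E)%E.
  rewrite PE// setI_bigcupl.
  have mI (t : 'I_J * 'I_d) : measurable
     (bad (delta t.1.+1) (delta t.1) (a t.1 *+ 2) t.2 `&` K) by exact: measurableI.
  apply: (@le_trans _ _ (kap%:E * \sum_(t : 'I_J * 'I_d)
     lam (bad (delta t.1.+1) (delta t.1) (a t.1 *+ 2) t.2 `&` K))%E).
    apply: lee_wpmul2l; first by rewrite lee_fin ltW.
    by apply: measure_fin_cover => //; apply: fin_bigcup_measurable.
  rewrite ge0_sume_distrr//.
  apply: (@le_trans _ _ (\sum_(t : 'I_J * 'I_d) (C3 / k%:R ^+ 2 * (1 / 4) ^+ t.1)%:E)%E).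
    apply: lee_sum => t _; rewrite -PE//.
    have tJ : (t.1 < J)%N by exact: ltn_ord.
    apply: le_trans (@P_bad _ _ _ t.2 (delta0 t.1) _ _) _.
    - by rewrite delta0 Jsmall.
    - by rewrite pmulrn_lgt0// a0/=; have := ar t.1; lra.
    rewrite lee_fin deltaS mulfK ?lt0r_neq0// /C3.
    rewrite (_ : C2 * (D * _) = C2 * D / k%:R ^+ 2 * (4 * (rho / 8) ^+ 2 * (1 / 4) ^+ t.1)).
      apply: ler_wpM2l; first by apply: ltW; rewrite !(mulr_gt0, invr_gt0).
      rewrite -[leRHS]mul1r; apply: ler_wpM2r; first by rewrite exprn_ge0.
      by nra.
    have -> : (1 / 4) ^+ t.1 = ((2 ^+ t.1) ^+ 2)^-1 :> R.
      by rewrite -exprM mulnC exprM -exprVn; congr (_ ^+ _); field.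
    have u0 : 2 ^+ t.1 != 0 :> R by rewrite expf_neq0.
    by rewrite /a; move: u0 (lt0r_neq0 kR0); move: (2 ^+ t.1) => u u0 kn0; field; rewrite u0 kn0.
  rewrite sumEFin lee_fin -(pair_bigA _ (fun (j : 'I_J) (l : 'I_d) => C3 / k%:R ^+ 2 * (1 / 4) ^+ j))/=.
  have geom n : \sum_(j < n) (1 / 4 : R) ^+ j = 4 / 3 * (1 - (1 / 4) ^+ n).
    elim: n => [|n IH]; first by rewrite big_ord0 expr0 subrr mulr0.
    by rewrite big_ord_recr /= IH exprS; field.
  rewrite (eq_bigr (fun j : 'I_J => d%:R * C3 / k%:R ^+ 2 * (1 / 4) ^+ j)) => [|j _]; last first.
    by rewrite sumr_const card_ord -[LHS]mulr_natl; ring.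
  rewrite -mulr_sumr geom [leRHS](_ : _ = d%:R * C3 / k%:R ^+ 2 * 2); last by ring.
  apply: ler_wpM2l; last by have : 0 <= (1 / 4 : R) ^+ J by []; lra.
  by apply: ltW; rewrite !(mulr_gt0, invr_gt0)// ltr0n.
have upper0 : 0 < 2 * d%:R * C3 by apply: mulr_gt0 => //; apply: mulr_gt0 => //; rewrite ltr0n.
exists J, E, G, A; split => //.
- apply: (@le_trans _ _ (P (layer (delta 0%N) 0%R) + P Ub)%E).
    rewrite !PE//= -ge0_muleDr//; apply: lee_wpmul2l; first by rewrite lee_fin ltW.
    by rewrite setIUl; apply: measureU2; exact: measurableI.
  apply: le_trans (leeD (P_layer (delta0 0) (lexx 0)) PUb) _.
  rewrite -EFinD lee_fin /delta expr0 mulrA mulr1 -mulrDl.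
  apply: ler_wpM2r; first by rewrite invr_ge0 ltW.
  rewrite /cover_upper; have : 0 < C1 * D by rewrite mulr_gt0.
  by have := D0; lra.
- move=> x Kx; have gx := Kg Kx.
  have [g0|g0] := ltP (1 - delta 0) (g x).
    by left; left; rewrite /layer /= subr0 g0.
  have H m : (m <= J)%N -> g x <= 1 - delta m \/
      exists2 j, (j < m)%N & 1 - delta j.+1 < g x <= 1 - delta j.
    elim: m => [_|m IH mJ]; first by left.
    have [h|[j jm hj]] := IH (ltnW mJ); last by right; exists j => //; exact: ltnW.
    have [h'|h'] := leP (g x) (1 - delta m.+1); first by left.
    by right; exists m => //; rewrite h' h.
  have [h|[j jJ hj]] := H J (leqnn _).
    right; exists (ord_max, Ordinal d0) => //.
    by rewrite /G /= ltnn.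
  have [[l Dl]|nD] := pselect (exists l, delta j < D2 (a j *+ 2) l x).
    by left; right; exists (Ordinal jJ, l).
  right; have [i xi] := rV_norm_attained x d0.
  exists (Ordinal (ltnW jJ : (j < J.+1)%N), i) => //.
  rewrite /G /= jJ; split => //=; split.
    by move=> l; rewrite leNgt; apply/negP => hl; apply: nD; exists l.
  rewrite -xi; have := g_le x; rewrite ler_pdivlMl//.
  by have := Jsmall _ jJ; move: hj => /andP[hj _]; nra.
- move=> t; split; first exact: AP.
  rewrite /G; case: ifPn => tJ.
    apply: le_trans (P_mono _ _ (mG0 _ _) (mlayer _ _) (@subIsetl _ _ _)) _.
    apply: le_trans (P_layer (delta0 _) (ltW (delta0 _))) _.
    rewrite lee_fin deltaS /delta mulrA -[leRHS]mulrA.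
    apply: ler_wpM2r; first by rewrite divr_ge0 ?ltW// exprn_gt0.
    by rewrite /cover_upper; move: upper0 C10 D0; lra.
  have tE : t.1 = J :> nat.
    by apply/eqP; rewrite eqn_leq [(J <= _)%N]leqNgt tJ andbT -ltnS ltn_ord.
  apply: le_trans (P1 mGc) _; rewrite lee_fin tE.
  apply: (@le_trans _ _ (2 * D * delta J)).
    by rewrite -ler_pdivrMl ?mulr_gt0// mulr1.
  rewrite mulrA; apply: ler_wpM2r; first by rewrite invr_ge0 ltW.
  apply: ler_wpM2r; first by rewrite exprn_ge0// ltW.
  have : 0 < C1 * D by rewrite mulr_gt0.
  by rewrite /cover_upper; move: upper0 C10; lra.
Qed.

End cover.

(** * Normalisation of a convex body *)

Lemma convex_setP (R : realType) (V : lmodType R) (C : set V) :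
  convex_set C <-> convex_in C.
Proof.
split=> [cC x y t Cx Cy /andP[t0 t1]|cC].
  have := cC x y (Itv01 t0 t1) (mem_set Cx) (mem_set Cy).
  by move/set_mem.
apply/convex_setW => x y /set_mem Cx /set_mem Cy k k0 k1.
by apply/mem_set; apply: (cC x y k%:num Cx Cy); rewrite (ltW k0) (ltW k1).
Qed.

Lemma convex_in_sum (R : realType) (V : lmodType R) (C : set V) n
    (w : 'I_n -> R) (p : 'I_n -> V) :
  convex_in C -> (forall i, 0 <= w i) -> \sum_i w i = 1 -> (forall i, C (p i)) ->
  C (\sum_i w i *: p i).
Proof.
move=> cC; elim: n w p => [|n IH] w p w0 w1 Cp.
  by move: w1; rewrite big_ord0 => /esym/eqP; rewrite oner_eq0.
move: w1; rewrite !big_ord_recl; set s := \sum_(i < n) _ => w1.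
have s0 : 0 <= s by apply: sumr_ge0.
have w00 := w0 ord0.
have [sz|sn] := eqVneq s 0.
  have wz i : w (lift ord0 i) = 0.
    by have /psumr_eq0P := sz; apply => // j _.
  rewrite big1 ?addr0; last by move=> i _; rewrite wz scale0r.
  by rewrite (_ : w ord0 = 1) ?scale1r//; lra.
have Cs : C (\sum_i (w (lift ord0 i) / s) *: p (lift ord0 i)).
  apply: IH => //; first by move=> i; rewrite divr_ge0.
  by rewrite -mulr_suml divff.
have := cC _ _ (w ord0) (Cp ord0) Cs.
rewrite scaler_sumr (_ : 1 - w ord0 = s); last by lra.
rewrite [X in _ + X](eq_bigr (fun i => w (lift ord0 i) *: p (lift ord0 i))); last first.
  by move=> i _; rewrite scalerA mulrC divfK.
by apply; rewrite w00; lra.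
Qed.

Section gauge.
Context (R : realType) (d : nat) (K : set 'rV[R]_d) (rho : R).
Hypothesis rho0 : 0 < rho.
Hypothesis cK : convex_in K.
Hypothesis Kin : forall x, `|x| <= rho -> K x.
Hypothesis Kout : forall x, K x -> `|x| <= 3.

Definition gauge_set (x : 'rV[R]_d) : set R := [set t | 0 < t /\ K (t^-1 *: x)].

Definition gauge (x : 'rV[R]_d) : R := inf (gauge_set x).

Let K0 : K 0. Proof. by apply: Kin; rewrite normr0 ltW. Qed.

Lemma gauge_set_big x t : 0 < t -> rho^-1 * `|x| <= t -> gauge_set x t.
Proof.
move=> t0 xt; split=> //; apply: Kin.
by rewrite normrZ normfV (gtr0_norm t0) ler_pdivrMl// mulrC -ler_pdivrMl.
Qed.

Let has_lb x : has_lbound (gauge_set x).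
Proof. by exists 0 => t [/ltW]. Qed.

Let has_infg x : has_inf (gauge_set x).
Proof.
split=> //; exists (rho^-1 * `|x| + 1); apply: gauge_set_big.
  by rewrite ltr_wpDl// mulr_ge0// invr_ge0 ltW.
by rewrite lerDl.
Qed.

Lemma gauge_le_mem x t : gauge_set x t -> gauge x <= t.
Proof. by move=> h; apply: ge_inf. Qed.

Lemma gauge_mem x t : gauge x < t -> gauge_set x t.
Proof.
move=> gt; have [s [s0 Ks] st] : exists2 s, gauge_set x s & s < t.
  have t_gt : 0 < t - gauge x by lra.
  have [s hs h] := inf_adherent t_gt (has_infg x).
  by exists s => //; move: h; rewrite -/(gauge x); lra.
have t0 : 0 < t by exact: lt_trans st.
split=> //; have := @cK _ _ (s / t) Ks K0; rewrite scaler0 addr0 scalerA (_ : s / t / s = t^-1); last first.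
  by field; rewrite !gt_eqF.
by apply; rewrite divr_ge0 ?(ltW s0) ?(ltW t0)//= ler_pdivrMr// mul1r ltW.
Qed.

Lemma gauge_ge0 x : 0 <= gauge x.
Proof. by apply: lb_le_inf; [case: (has_infg x)|move=> t [/ltW]]. Qed.

Lemma gauge_le x : gauge x <= rho^-1 * `|x|.
Proof.
have h0 : 0 <= rho^-1 * `|x| by rewrite mulr_ge0// invr_ge0 ltW.
apply/ler_addgt0Pr => e e0; apply: gauge_le_mem; apply: gauge_set_big; lra.
Qed.

Lemma gauge_ge x : `|x| <= 3 * gauge x.
Proof.
rewrite -ler_pdivrMl//; apply: lb_le_inf; first by case: (has_infg x).
move=> t [t0 /Kout]; rewrite normrZ normfV (gtr0_norm t0) ler_pdivrMl//; lra.
Qed.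

Lemma gaugeD x y : gauge (x + y) <= gauge x + gauge y.
Proof.
apply/ler_addgt0Pr => e e0.
have [s0 Ks] := @gauge_mem x (gauge x + e / 2) ltac:(lra).
have [t0 Kt] := @gauge_mem y (gauge y + e / 2) ltac:(lra).
move: Ks Kt s0 t0; set s := gauge x + _; set t := gauge y + _ => Ks Kt s0 t0.
have -> : gauge x + gauge y + e = s + t by rewrite /s /t; lra.
apply: gauge_le_mem; split; first exact: addr_gt0.
have := @cK _ _ (s / (s + t)) Ks Kt.
rewrite (_ : _ + _ = (s + t)^-1 *: (x + y)); last first.
  apply/rowP => j; rewrite !mxE; field; rewrite !gt_eqF//; exact: addr_gt0.
have st0 := addr_gt0 s0 t0.
by apply; rewrite divr_ge0 ?(ltW s0) ?(ltW st0)//= ler_pdivrMr// mul1r; lra.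
Qed.

Lemma gaugeZ r x : 0 <= r -> gauge (r *: x) = r * gauge x.
Proof.
have half s y : 0 < s -> gauge (s *: y) <= s * gauge y.
  move=> s0; apply/ler_addgt0Pr => e e0.
  have [t0 Kt] := @gauge_mem y (gauge y + e / s) ltac:(rewrite ltrDl divr_gt0//).
  have -> : s * gauge y + e = s * (gauge y + e / s) by field; rewrite gt_eqF.
  apply: gauge_le_mem; split; first exact: mulr_gt0.
  by rewrite scalerA invfM mulrAC mulVf ?mul1r// gt_eqF.
rewrite le_eqVlt => /predU1P[<-|r0].
  rewrite scale0r mul0r; apply/eqP; rewrite eq_le gauge_ge0 andbT.
  by have := gauge_le 0; rewrite normr0 mulr0.
apply/eqP; rewrite eq_le half//= -ler_pdivlMl//.
rewrite -[x in leLHS](scalerK (lt0r_neq0 r0)); apply: half; by rewrite invr_gt0.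
Qed.

Lemma gauge_lt1 x : gauge x < 1 -> K x.
Proof. by move/gauge_mem => [_]; rewrite invr1 scale1r. Qed.

Lemma gauge_le1 x : K x -> gauge x <= 1.
Proof. by move=> Kx; apply: gauge_le_mem; split=> //; rewrite invr1 scale1r. Qed.

End gauge.

Section norm_bound_det.
Context (R : realType) (d : nat).
Implicit Types V : 'M[R]_d.

Lemma norm_det_le V (M : R) : 0 <= M -> (forall i j, `|V i j| <= M) ->
  `|\det V| <= d`!%:R * M ^+ d.
Proof.
move=> M0 VM; apply: le_trans (ler_norm_sum _ _ _) _.
apply: (@le_trans _ _ (\sum_(s : 'S_d) M ^+ d)).
  apply: ler_sum => s _; rewrite normrM normrX normrN1 expr1n mul1r normr_prod.
  apply: (@le_trans _ _ (\prod_(i < d) M)); last by rewrite prodr_const card_ord.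
  by apply: ler_prod => i _; rewrite normr_ge0 VM.
by rewrite sumr_const card_Sn mulr_natl.
Qed.

(** Cramer's rule. *)
Lemma det_replace_row V (c : 'rV[R]_d) i :
  \det (\matrix_(k, l) (if k == i then (c *m V) ord0 l else V k l)) =
  c ord0 i * \det V.
Proof.
pose U : 'M[R]_d := \matrix_(k, l) (if k == i then c ord0 l else (k == l)%:R).
have -> : \matrix_(k, l) (if k == i then (c *m V) ord0 l else V k l) = U *m V.
  apply/matrixP => k l; rewrite !mxE; case: eqP => ki.
    by apply: eq_bigr => j _; rewrite !mxE ki eqxx.
  rewrite (bigD1 k)//= !mxE (introF eqP ki) eqxx mul1r big1 ?addr0// => j jk.
  by rewrite !mxE (introF eqP ki) eq_sym (negbTE jk) mul0r.
rewrite det_mulmx; congr (_ * _).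
rewrite (expand_det_col _ i) (bigD1 i)//= big1 ?addr0 => [|k ki]; last first.
  by rewrite mxE (negbTE ki) mul0r.
rewrite mxE eqxx /cofactor addnn -mul2n exprM sqrrN expr1n expr1n mul1r.
rewrite (_ : row' i (col' i U) = 1%:M) ?det1 ?mulr1//.
apply/matrixP => k l; rewrite !mxE eq_sym (negbTE (neq_lift _ _)).
by rewrite (inj_eq lift_inj).
Qed.

End norm_bound_det.

Section position.
Context (R : realType) (d : nat).

(** Take a simplex with vertices in [K], one of them fixed, of at least half the
    maximal volume: by Cramer's rule the points of [K] have coordinates at most 2
    in the basis of its edges.  A cube fits in the simplex around its centroid. *)
Lemma affine_position (K : convex_body R d) (rho : R) : (0 < d)%N ->
  rho * (d%:R * d.+1%:R) <= 1 ->
  exists (V : 'M[R]_d) (o : 'rV[R]_d), [/\ V \in unitmx,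
    forall c : 'rV[R]_d, `|c| <= rho -> body K (o + c *m V) &
    forall c : 'rV[R]_d, body K (o + c *m V) -> `|c| <= 3].
Proof.
move=> d0 rhod.
have cK : convex_in (body K) by apply/convex_setP; exact: body_convex.
have [x0 x0int] := body_interior K.
have Kx0 : body K x0 by exact: interior_subset x0int.
have [M [Mr KM]] := compact_bounded (body_compact (c := K)).
pose B : R := `|M| + 1.
have KB x : body K x -> `|x| <= B.
  by apply: KM; rewrite /B (le_lt_trans (ler_norm _))// ltrDl.
have B0 : 0 <= B by rewrite /B addr_ge0.
pose good (V : 'M[R]_d) := forall i, body K (x0 + row i V).
pose S : set R := [set r | exists2 V, good V & r = `|\det V|].
have Sub : has_ubound S.
  exists (d`!%:R * (B + B) ^+ d) => r [V Vg ->].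
  apply: norm_det_le => [|i j]; first by rewrite addr_ge0.
  have -> : V i j = row i V ord0 j by rewrite mxE.
  apply: le_trans (rV_coord_le_norm _ _) _.
  rewrite -[row i V](addKr x0); apply: le_trans (ler_normD _ _) _.
  by rewrite normrN lerD ?KB.
have [r [r0 rS]] : exists r, 0 < r /\ S r.
  have /nbhs_ballP[e /= e0 xeK] := x0int.
  pose V : 'M[R]_d := (e / 2)%:M.
  exists `|\det V|; split.
    by rewrite normr_gt0 det_scalar expf_neq0// gt_eqF// divr_gt0.
  exists V => // i; apply: xeK; rewrite -ball_normE/= opprD addNKr normrN.
  apply: (@le_lt_trans _ _ (e / 2)); last by rewrite ltr_pdivrMr//; lra.
  apply: rV_norm_le => [|j]; first by rewrite divr_ge0// ltW.
  have e20 : 0 <= e / 2 by rewrite divr_ge0// ltW.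
  by rewrite !mxE; case: eqP => _; rewrite ?mulr1n ?mulr0n ?normr0// ger0_norm.
have supS : has_sup S by split=> //; exists r.
have rsup : r <= sup S by exact: ub_le_sup.
have [_ [V Vg ->] hV] := sup_adherent (ltac:(lra) : 0 < sup S / 2) supS.
have detV0 : 0 < `|\det V| by lra.
have uV : V \in unitmx by rewrite unitmxE unitfE -normr_gt0.
have coord (c : 'rV[R]_d) i : body K (x0 + c *m V) -> `|c ord0 i| <= 2.
  move=> Kc; pose V' : 'M[R]_d := \matrix_(k, l) (if k == i then (c *m V) ord0 l else V k l).
  have : S `|\det V'|.
    exists V' => // k; have [ki|ki] := eqVneq k i.
      by rewrite (_ : row k V' = c *m V)//; apply/rowP => l; rewrite !mxE ki eqxx.
    rewrite (_ : row k V' = row k V); first exact: Vg.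
    by apply/rowP => l; rewrite !mxE (negbTE ki).
  move=> /(ub_le_sup Sub); rewrite det_replace_row normrM => h.
  rewrite -(ler_pM2r detV0); apply: le_trans h _; lra.
have d1R : 0 < d.+1%:R :> R by rewrite ltr0n.
have dR : 1 <= d%:R :> R by rewrite ler1n.
have [q [q0 q1 qd]] : exists q : R, [/\ 0 < q, q <= 1 & q * d.+1%:R = 1].
  exists (d.+1%:R^-1); rewrite invr_gt0 d1R mulVf ?gt_eqF//.
  by rewrite invf_le1// ler1n.
have qd1 : d%:R * q = 1 - q by move: qd; rewrite -natr1; lra.
have drho : d%:R * rho <= q.
  rewrite -(ler_pM2r d1R) qd; apply: le_trans rhod.
  by rewrite mulrA [d%:R * rho]mulrC.
pose u : 'rV[R]_d := const_mx q.
exists V, (x0 + u *m V); split => // c.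
  move=> crho; rewrite -addrA -mulmxDl.
  have rho0 : 0 <= rho by apply: le_trans crho.
  have b0 i : 0 <= (u + c) ord0 i.
    have := le_trans (rV_coord_le_norm c i) crho; rewrite ler_norml => /andP[h _].
    by rewrite !mxE; nra.
  have b1 : \sum_i (u + c) ord0 i <= 1.
    apply: (@le_trans _ _ (\sum_(i < d) (q + rho))).
      apply: ler_sum => i _; rewrite !mxE lerD2l.
      by have := le_trans (rV_coord_le_norm c i) crho; rewrite ler_norml => /andP[_ h].
    by rewrite sumr_const card_ord -[leLHS]mulr_natl mulrDr qd1; lra.
  pose w (i : 'I_d.+1) := oapp (fun j => (u + c) ord0 j) (1 - \sum_i (u + c) ord0 i) (unlift ord0 i).
  pose p (i : 'I_d.+1) := oapp (fun j => x0 + row j V) x0 (unlift ord0 i).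
  have wS j : w (lift ord0 j) = (u + c) ord0 j by rewrite /w liftK.
  have pS j : p (lift ord0 j) = x0 + row j V by rewrite /p liftK.
  have w0 : w ord0 = 1 - \sum_i (u + c) ord0 i by rewrite /w unlift_none.
  have p0 : p ord0 = x0 by rewrite /p unlift_none.
  have -> : x0 + (u + c) *m V = \sum_i w i *: p i.
    rewrite big_ord_recl w0 p0 mulmx_sum_row.
    rewrite [in RHS](eq_bigr (fun j => (u + c) ord0 j *: x0 + (u + c) ord0 j *: row j V)); last first.
      by move=> j _; rewrite wS pS scalerDr.
    by rewrite big_split/= -scaler_suml addrA -scalerDl subrK scale1r.
  apply: convex_in_sum => // [i||i].
  - by case: (unliftP ord0 i) => [j|] ->; rewrite ?wS// w0 subr_ge0.
  - by rewrite big_ord_recl w0 (eq_bigr _ (fun j _ => wS j)) subrK.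
  - by case: (unliftP ord0 i) => [j|] ->; rewrite ?pS ?p0//; exact: Vg.
rewrite -addrA -mulmxDl => Kc; apply: rV_norm_le => // i.
have := coord _ i Kc; rewrite !mxE.
rewrite !ler_norml => /andP[h3 h4]; apply/andP; split; lra.
Qed.

End position.

Section transport.
Context (R : realType) (d : nat) (V : 'M[R]_d) (o : 'rV[R]_d).
Hypothesis uV : V \in unitmx.
Local Notation lam := (@lebesgue_measure_rV R d).

Definition affine_coord (x : 'rV[R]_d) : 'rV[R]_d := (x - o) *m invmx V.
Local Notation Psi := affine_coord.

Lemma affine_coordK x : o + Psi x *m V = x.
Proof. by rewrite /affine_coord mulmxKV// subrKC. Qed.

Lemma measurable_affine_coord : measurable_fun setT Psi.
Proof. by apply: measurable_funM_rV; exact: measurable_shift_rV. Qed.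

Lemma measurable_affine_preimage A : measurable A -> measurable (Psi @^-1` A).
Proof.
by move=> mA; rewrite -[X in measurable X]setTI; exact: (measurable_affine_coord measurableT mA).
Qed.

Lemma lebesgue_affine_preimage A : measurable A ->
  lam (Psi @^-1` A) = ((jac V)%:E * lam A)%E.
Proof.
move=> mA; rewrite -lebesgue_rV_linear//.
by rewrite -[RHS](lebesgue_rV_shift (- o))//; exact: measurable_mulmx_preimage.
Qed.

Lemma convex_in_affine (C : set 'rV[R]_d) : convex_in C ->
  convex_in [set c | C (o + c *m V)].
Proof.
move=> cC u v t Cu Cv t01 /=.
rewrite (_ : _ + _ = t *: (o + u *m V) + (1 - t) *: (o + v *m V)); first exact: cC.
rewrite mulmxDl -!scalemxAl !scalerDr addrACA -scalerDl.
by rewrite (_ : t + (1 - t) = 1) ?scale1r//; ring.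
Qed.

(** Affine maps preserve convex hulls, hence trapping. *)
Lemma cell_cover_transport (c C D : R) (P : set 'rV[R]_d -> \bar R)
    (K : set 'rV[R]_d) k :
  cell_cover c C D (fun B => P (Psi @^-1` B)) [set v | K (o + v *m V)] k ->
  cell_cover c C D P K k.
Proof.
move=> [J [E [G [A [mE PE KEG cG]]]]].
pose Psi2 (p : 'rV[R]_d * 'rV[R]_d) := (Psi p.1, Psi p.2).
have mPsi2 : measurable_fun setT Psi2.
  by apply: measurable_fun_pair; apply: (measurableT_comp measurable_affine_coord);
    [exact: measurable_fst|exact: measurable_snd].
exists J, (Psi @^-1` E), (fun t => Psi @^-1` G t), (fun t s => Psi2 @^-1` A t s).
split => //.
- exact: measurable_affine_preimage.
- move=> x Kx; have : (E `|` \bigcup_t G t) (Psi x).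
    by apply: KEG; rewrite /= affine_coordK.
  by case=> [|[t _ Gt]]; [left|right; exists t].
move=> t; have [[mG mA PA AG] PG] := cG t; split => //; split.
- exact: measurable_affine_preimage.
- by move=> s; rewrite -[X in measurable X]setTI; exact: (mPsi2 measurableT _ (mA s)).
- move=> x s /= Gx; apply: le_trans (PA _ s Gx) _; rewrite le_eqVlt; apply/orP; left.
  by apply/eqP; congr P; apply/seteqP; split=> y; rewrite /xsection /= !inE.
- move=> x y Gx Ay; have [yx hC] := AG (Psi x) (fun s => Psi (y s)) Gx Ay.
  split=> [s yxs|C' cC' Cy]; first by apply: (yx s); rewrite yxs.
  rewrite -(affine_coordK x); apply: (hC [set v | C' (o + v *m V)]).
    exact: convex_in_affine.
  by move=> s /=; rewrite affine_coordK.
Qed.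

End transport.

Section uniform_cover.
Context (R : realType) (d : nat).
Local Notation lam := (@lebesgue_measure_rV R d).

Lemma lebesgue_norm_le (r : R) : 0 <= r ->
  lam [set x | `|x| <= r] = ((2 * r) ^+ d)%:E.
Proof.
move=> r0; rewrite (_ : mkset _ = [set v : 'rV[R]_d | forall i, v ord0 i \in `[(- r), r]]).
  rewrite (@lebesgue_measure_rV_box R d (fun=> - r) (fun=> r)); last by move=> _; lra.
  rewrite (eq_bigr (fun=> 2 * r)) => [|j _]; last by ring.
  by rewrite prodr_const card_ord.
apply/seteqP; split=> x /= h.
  by move=> j; rewrite in_itv/= -ler_norml; exact: le_trans (rV_coord_le_norm _ _) h.
by apply: rV_norm_le => // j; have := h j; rewrite in_itv/= -ler_norml.
Qed.

Lemma cell_cover_uniform : (2 <= d)%N -> exists c C D : R, [/\ 0 < c, 0 < C, 1 <= D &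
  forall (K : convex_body R d) k, (0 < k)%N ->
    cell_cover c C D (uniform_law K) K k].
Proof.
move=> d2; have d0 : (0 < d)%N by exact: leq_trans d2.
have ddR : 1 <= d%:R * d.+1%:R :> R by rewrite -natrM ler1n muln_gt0 d0.
have dd0 : 0 < d%:R * d.+1%:R :> R by lra.
pose rho : R := (d%:R * d.+1%:R)^-1.
have rho0 : 0 < rho by rewrite invr_gt0.
have rho1 : rho <= 1 by rewrite invf_le1.
have six : 0 < (2 * 3) ^+ d :> R by rewrite exprn_gt0// mulr_gt0.
pose klo : R := ((2 * 3) ^+ d)^-1; pose khi : R := ((2 * rho) ^+ d)^-1.
have klo0 : 0 < klo by rewrite invr_gt0.
pose D : R := (4 ^ d.-1)%:R.
have D1 : 1 <= D by rewrite ler1n expn_gt0.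
exists (cover_lower d rho klo), (`|cover_upper d rho khi| + 1), D; split => //.
  exact: cover_lower_gt0.
move=> K k k0.
have [V [z [uV Kin Kout]]] : exists (V : 'M[R]_d) (o : 'rV[R]_d), [/\ V \in unitmx,
    forall c : 'rV[R]_d, `|c| <= rho -> body K (o + c *m V) &
    forall c : 'rV[R]_d, body K (o + c *m V) -> `|c| <= 3].
  by apply: affine_position => //; rewrite mulVf ?gt_eqF.
have cK : convex_in (body K) by apply/convex_setP; exact: body_convex.
pose K' : set 'rV[R]_d := [set c | body K (z + c *m V)].
have mK : measurable (body K) by exact: measurable_body.
have Psi_K' : affine_coord V z @^-1` K' = body K.
  by apply/seteqP; split => x; rewrite /K' /= affine_coordK.
have mK' : measurable K'.
  rewrite (_ : K' = (fun c => z + c *m V) @^-1` body K)//.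
  rewrite -[X in measurable X]setTI.
  have mPhi : measurable_fun setT (fun c : 'rV[R]_d => z + c *m V).
    by apply: measurable_funD_rV; [exact: measurable_cst|exact: measurable_funM_rV].
  exact: (mPhi measurableT _ mK).
have cK' : convex_in K' by exact: convex_in_affine.
have lamK : lam (body K) = ((jac V)%:E * lam K')%E by rewrite -(lebesgue_affine_preimage z uV mK') Psi_K'.
have lo : (((2 * rho) ^+ d)%:E <= lam K')%E.
  rewrite -(lebesgue_norm_le (ltW rho0)); apply: le_measure => [||c].
  - by rewrite inE; apply: measurable_norm_le_rV; exact: ltW.
  - by rewrite inE.
  - exact: Kin.
have hi : (lam K' <= ((2 * 3) ^+ d)%:E)%E.
  rewrite -(@lebesgue_norm_le 3)//; apply: le_measure => [||c].
  - by rewrite inE.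
  - by rewrite inE; exact: measurable_norm_le_rV.
  - exact: Kout.
have finK' : lam K' \is a fin_num by rewrite ge0_fin_numE// (le_lt_trans hi)// ltry.
pose L := fine (lam K'); have LE : lam K' = L%:E by rewrite fineK.
rewrite LE !lee_fin in lo hi.
have r2 : 0 < (2 * rho) ^+ d by rewrite exprn_gt0// mulr_gt0.
have L0 : 0 < L by exact: lt_le_trans lo.
have j0 := jac_gt0 uV.
have PE B : measurable B -> uniform_law K (affine_coord V z @^-1` B) =
    ((L^-1)%:E * lam (B `&` K'))%E.
  move=> mB; rewrite /uniform_law lamK LE -EFinM /=.
  rewrite -{1}Psi_K' -preimage_setI lebesgue_affine_preimage//; last exact: measurableI.
  by rewrite muleC muleA -EFinM invfM mulrAC mulVf ?mul1r ?gt_eqF.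
apply: (cell_cover_transport uV).
have := @cell_coverP R d (gauge K') rho d2 rho0 rho1
  (gaugeD rho0 cK' Kin) (gaugeZ rho0 cK' Kin) (gauge_le rho0 Kin) (gauge_ge rho0 Kin Kout)
  (fun B => uniform_law K (affine_coord V z @^-1` B)) K' L^-1 klo khi
  (gauge_lt1 rho0 cK' Kin) (@gauge_le1 R d K') mK' klo0.
case/(_ _ _ PE _ k k0) => //.
- by rewrite lef_pV2 ?posrE.
- by rewrite lef_pV2 ?posrE.
- move=> B mB; apply: probability_le1; exact: measurable_affine_preimage.
move=> J [E [G [A [mE PEE KEG cG]]]]; exists J, E, G, A; split; [exact: mE| |exact: KEG|].
  apply: le_trans PEE _; rewrite lee_fin ler_pM2r ?invr_gt0 ?exprn_gt0 ?ltr0n//.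
  by rewrite (le_trans (ler_norm _))// lerDl.
move=> t; have [cGt PGt] := cG t; split=> //; apply: le_trans PGt _.
rewrite lee_fin ler_pM2r ?invr_gt0 ?exprn_gt0 ?ltr0n//; apply: ler_wpM2r.
  by rewrite exprn_ge0//; lra.
by rewrite (le_trans (ler_norm _))// lerDl.
Qed.

End uniform_cover.

(** * Independent points: conditioning and binomial moments *)

Section iid.
Context d (T : measurableType d) (R : realType) (P : probability T R).
Local Notation tm := (tuple_measure P).
Local Open Scope ereal_scope.

Lemma integral_tuple_cons n (f : n.+1.-tuple T -> \bar R) :
  measurable_fun setT f -> (forall t, 0 <= f t) ->
  \int[tm n.+1]_t f t = \int[P]_x \int[tm n]_t f [tuple of x :: t].
Proof.
move=> mf f0.
have mc := @measurable_tuple_cons _ T n.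
transitivity (\int[(P \x tm n)]_p (f \o (fun p : T * n.-tuple T => [tuple of p.1 :: p.2])) p).
  exact: (@ge0_integral_pushforward _ _ _ _ R _ mc (P \x tm n) setT f).
rewrite fubini_tonelli1// => [|p]; [exact: (measurableT_comp mf mc)|exact: f0].
Qed.

Lemma measurable_cat_tuple n1 n2 :
  measurable_fun setT (fun p : n1.-tuple T * n2.-tuple T => cat_tuple p.1 p.2).
Proof.
apply/measurable_fun_tnthP => i; case: (splitP i) => j ij.
  rewrite (_ : _ \o _ = (fun p : n1.-tuple T * n2.-tuple T => tnth p.1 j)).
    apply: (@measurableT_comp _ _ _ _ _ _ (fun t : n1.-tuple T => tnth t j)) => //.
    exact: measurable_tnth.
  apply/funext => p /=; rewrite (_ : i = lshift n2 j) ?tnth_lshift//.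
  exact/val_inj.
rewrite (_ : _ \o _ = (fun p : n1.-tuple T * n2.-tuple T => tnth p.2 j)).
  apply: (@measurableT_comp _ _ _ _ _ _ (fun t : n2.-tuple T => tnth t j)) => //.
  exact: measurable_tnth.
apply/funext => p /=; rewrite (_ : i = rshift n1 j) ?tnth_rshift//.
exact/val_inj.
Qed.

Lemma integral_tuple_cat n1 n2 (f : (n1 + n2).-tuple T -> \bar R) :
  measurable_fun setT f -> (forall t, 0 <= f t) ->
  \int[tm (n1 + n2)]_t f t = \int[tm n1]_x \int[tm n2]_y f (cat_tuple x y).
Proof.
have mcat n (g : (n + n2).-tuple T -> \bar R) : measurable_fun setT g ->
    measurable_fun setT (fun p : n.-tuple T * n2.-tuple T => g (cat_tuple p.1 p.2)).
  by move=> mg; apply: (measurableT_comp mg); exact: measurable_cat_tuple.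
have mint n (g : (n + n2).-tuple T -> \bar R) : measurable_fun setT g ->
    (forall t, 0 <= g t) ->
    measurable_fun setT (fun x : n.-tuple T => \int[tm n2]_y g (cat_tuple x y)).
  move=> mg g0; apply: (@measurable_fun_fubini_tonelli_F _ _ _ _ _ (tm n2)
    (fun p : n.-tuple T * n2.-tuple T => g (cat_tuple p.1 p.2))).
    exact: mcat.
  by move=> p; exact: g0.
elim: n1 f => [|n1 IH] f mf f0.
  rewrite [RHS](@integral_dirac _ _ _ R _ measurableT); last exact: mint.
  rewrite diracT mul1e; apply: eq_integral => y _; congr f; exact/val_inj.
rewrite [LHS](@integral_tuple_cons (n1 + n2) f)// integral_tuple_cons//; last 2 first.
- exact: mint.
- by move=> x; apply: integral_ge0.
apply: eq_integral => x _.
have mx : measurable_fun setT (fun t : (n1 + n2).-tuple T => [tuple of x :: t]).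
  by apply: measurable_cons; [exact: measurable_cst|exact: measurable_id].
rewrite (IH (fun t => f [tuple of x :: t]))//; last exact: (measurableT_comp mf mx).
apply: eq_integral => X _; apply: eq_integral => y _; congr f; exact/val_inj.
Qed.

Definition hits (Z : set T) (s : seq T) : nat := count (fun x => x \in Z) s.

Lemma hitsE n (Z : set T) (t : n.-tuple T) :
  hits Z t = (\sum_(i < n) (tnth t i \in Z))%N.
Proof. by rewrite /hits -sum1_count big_mkcond big_tuple. Qed.

(** The set and the points may depend on a common parameter: the set is going to
    be random, determined by another part of the sample. *)
Lemma measurable_hits d' (S : measurableType d') n (Z : S -> set T)
    (f : S -> n.-tuple T) (h : nat -> \bar R) :
  (forall i, measurable [set s | Z s (tnth (f s) i)]) ->
  measurable_fun setT (fun s => h (hits (Z s) (f s))).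
Proof.
move=> mZ; apply: (@measurableT_comp _ _ _ _ _ _ h).
  by move=> _ Y mY.
rewrite (_ : (fun s => _) = (fun s => \sum_(i < n) (tnth (f s) i \in Z s))%N); last first.
  by apply/funext => s; rewrite hitsE.
have mi i : measurable_fun setT (fun s => (tnth (f s) i \in Z s) : nat).
  apply: (@measurableT_comp _ _ _ _ _ _ nat_of_bool); first by move=> _ Y _.
  apply: (@measurable_fun_bool _ _ _ _ true).
  rewrite setTI (_ : _ @^-1` _ = [set s | Z s (tnth (f s) i)])//.
  by apply/seteqP; split=> s /=; [move/set_mem|exact: mem_set].
have ms (r : seq 'I_n) :
    measurable_fun setT (fun s => \sum_(i <- r) (tnth (f s) i \in Z s))%N.
  elim: r => [|i r IH].
    by under eq_fun do rewrite big_nil; exact: measurable_cst.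
  by under eq_fun do rewrite big_cons; exact: measurable_fun_addn.
exact: ms.
Qed.

Lemma hits_cons n (Z : set T) x (t : n.-tuple T) :
  hits Z [tuple of x :: t] = ((x \in Z) + hits Z t)%N.
Proof. by []. Qed.

Lemma measurable_hits_tuple n (Z : set T) (h : nat -> \bar R) : measurable Z ->
  measurable_fun setT (fun t : n.-tuple T => h (hits Z t)).
Proof.
move=> mZ; apply: (@measurable_hits _ _ n (fun=> Z) id) => i.
rewrite -[X in measurable X]setTI; exact: (measurable_tnth i measurableT mZ).
Qed.

(** The binomial coefficient counts the [k]-subsets of the sample inside [Z]; the
    induction on [n] is Pascal's rule. *)
Lemma binomial_moment n k (Z : set T) : measurable Z ->
  \int[tm n]_t ('C(hits Z t, k)%:R : R)%:E = ('C(n, k)%:R * fine (P Z) ^+ k)%:E.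
Proof.
move=> mZ; set w := fine (P Z).
have PZ : P Z = w%:E by rewrite fineK// fin_num_measure.
have tmT m : tm m setT = 1 by exact: (probability_setT (iid_law P m)).
elim: n k => [|n IH] k.
  rewrite [LHS](@integral_dirac _ _ _ R _ measurableT); last first.
    exact: (@measurable_hits_tuple 0 Z (fun h => ('C(h, k)%:R : R)%:E)).
  rewrite diracT mul1e /hits/=.
  by case: k => [|k]; rewrite ?bin0 ?expr0 ?mulr1// bin0n mul0r.
rewrite integral_tuple_cons//; last first.
  exact: (@measurable_hits_tuple n.+1 Z (fun h => ('C(h, k)%:R : R)%:E)).
case: k => [|k].
  under eq_integral do under eq_integral do rewrite bin0.
  rewrite !bin0 mul1r expr0.
  under eq_integral do rewrite integral_cst// [X in _ * X]tmT mule1.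
  by rewrite integral_cst// [X in _ * X]probability_setT mule1.
pose a : R := ('C(n, k.+1)%:R * w ^+ k.+1)%R; pose b : R := ('C(n, k)%:R * w ^+ k)%R.
have w0 : (0 <= w)%R by rewrite fine_ge0.
transitivity (\int[P]_x (a%:E + b%:E * (\1_Z x)%:E)).
  apply: eq_integral => x _; rewrite indicE; have [xZ|xZ] := boolP (x \in Z).
    under eq_integral => t _ do rewrite hits_cons xZ add1n binS natrD EFinD.
    rewrite ge0_integralD//; last 2 first.
    - exact: (@measurable_hits_tuple n Z (fun h => ('C(h, k.+1)%:R : R)%:E)).
    - exact: (@measurable_hits_tuple n Z (fun h => ('C(h, k)%:R : R)%:E)).
    by rewrite !IH mule1.
  under eq_integral => t _ do rewrite hits_cons (negbTE xZ) add0n.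
  by rewrite IH mule0 adde0.
have a0 : (0 <= a)%R by rewrite mulr_ge0// exprn_ge0.
have b0 : (0 <= b)%R by rewrite mulr_ge0// exprn_ge0.
rewrite ge0_integralD//; last 2 first.
- by move=> x _; rewrite mule_ge0 ?lee_fin.
- by apply: measurable_funeM; exact/measurable_EFinP.
rewrite integral_cst// [X in _ * X]probability_setT mule1.
rewrite ge0_integralZl//; last exact/measurable_EFinP.
rewrite integral_indic// setIT [X in _ * X]PZ -EFinM -EFinD; congr EFin.
by rewrite /a /b binS natrD exprS; ring.
Qed.

Lemma bin_fact_le_expn n k : ('C(n, k) * k`! <= n ^ k)%N.
Proof.
rewrite bin_ffact; elim: k => [|k IH]; first by rewrite ffactn0.
by rewrite ffactnSr expnSr leq_mul// leq_subr.
Qed.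

Lemma fact_le_expn n : (n`! <= n ^ n)%N.
Proof. by rewrite -ffactnn -bin_ffact bin_fact_le_expn. Qed.

(** For [h > 2 q] the factors of the falling factorial are at least [h / 2]. *)
Lemma expn_le_bin h q : (0 < q)%N -> (h ^ q <= (2 * q) ^ q * (1 + 'C(h, q)))%N.
Proof.
move=> q0; have [hq|hq] := leqP h (2 * q).
  by rewrite mulnDr muln1 (leq_trans _ (leq_addr _ _))// leq_exp2r.
have ffact_ge k : (k <= q)%N -> ((h - q) ^ k <= h ^_ k)%N.
  elim: k => [|k IH] kq; first by rewrite ffactn0.
  by rewrite ffactnSr expnSr leq_mul ?IH ?(ltnW kq)// leq_sub2l// ltnW.
apply: (@leq_trans ((2 * (h - q)) ^ q)); first by rewrite leq_exp2r//; lia.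
rewrite !expnMn -mulnA leq_mul2l; apply/orP; right.
apply: leq_trans (ffact_ge q (leqnn q)) _.
rewrite -bin_ffact mulnC leq_mul ?fact_le_expn//; exact: leq_addl.
Qed.

Lemma hits_moment n q (Z : set T) : (0 < q)%N -> measurable Z ->
  \int[tm n]_t ((hits Z t)%:R ^+ q : R)%:E <=
  ((2 * q)%:R ^+ q * (1 + n%:R ^+ q * fine (P Z) ^+ q))%:E.
Proof.
move=> q0 mZ; set c : R := ((2 * q)%:R ^+ q)%R.
have c0 : (0 <= c)%R by rewrite exprn_ge0.
have w0 : (0 <= fine (P Z))%R by rewrite fine_ge0.
have mb := @measurable_hits_tuple n Z (fun h => ('C(h, q)%:R : R)%:E) mZ.
apply: (@le_trans _ _ (\int[tm n]_t (c%:E * (1 + ('C(hits Z t, q)%:R : R)%:E)))).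
  apply: ge0_le_integral => //.
  - exact: (@measurable_hits_tuple n Z (fun h => ((h%:R : R) ^+ q)%:E)).
  - by apply: measurable_funeM; apply: emeasurable_funD.
  - move=> t _; rewrite -EFinD -EFinM lee_fin /c.
    by have := expn_le_bin (hits Z t) q0; rewrite -(ler_nat R) natrM natrD !natrX.
rewrite ge0_integralZl//; last 2 first.
- by apply: emeasurable_funD.
- by move=> t _; rewrite adde_ge0.
rewrite ge0_integralD// integral_cst// binomial_moment// mul1e.
rewrite [X in X + _](probability_setT (iid_law P n)) -EFinD -EFinM lee_fin.
apply: ler_wpM2l => //; rewrite lerD2l; apply: ler_wpM2r; first by rewrite exprn_ge0.
rewrite -natrX ler_nat; apply: leq_trans (bin_fact_le_expn n q).
by rewrite leq_pmulr// fact_gt0.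
Qed.

End iid.

(** * The points left exposed by a sample *)

Section missed.
Context (R : realType) (d : nat) (P : probability 'rV[R]_d R).
Local Notation tm := (tuple_measure P).
Local Notation V := 'rV[R]_d.

Definition missed m (G : set V) (A : {ffun 'I_d -> bool} -> set (V * V))
    (Y : m.-tuple V) : set V :=
  [set x | G x /\ exists s, forall l, ~ A s (x, tnth Y l)].

Lemma measurable_missed m p G A : cell P p G A ->
  measurable [set r : m.-tuple V * V | missed G A r.1 r.2].
Proof.
move=> [mG mA _ _].
rewrite (_ : mkset _ = (snd @^-1` G) `&` \bigcup_s \bigcap_l
    ~` ((fun r : m.-tuple V * V => (r.2, tnth r.1 l)) @^-1` A s)); last first.
  apply/seteqP; split=> [r [Gr [s rs]]|r [Gr [s _ rs]]].
    by split=> //; exists s => // l _; exact: rs.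
  by split=> //; exists s => l; exact: rs.
apply: measurableI.
  by rewrite -[X in measurable X]setTI; exact: measurable_snd.
apply: fin_bigcup_measurable => // s _; apply: fin_bigcap_measurable => // l _.
apply: measurableC; rewrite -[X in measurable X]setTI.
have mf : measurable_fun setT (fun r : m.-tuple V * V => (r.2, tnth r.1 l)).
  apply: measurable_fun_pair; first exact: measurable_snd.
  by apply: (@measurableT_comp _ _ _ _ _ _ (fun t : m.-tuple V => tnth t l)) => //;
    exact: measurable_tnth.
exact: (mf measurableT _ (mA s)).
Qed.

Lemma xsection_set (T1 T2 : Type) (F : T1 -> set T2) x :
  xsection [set r : T1 * T2 | F r.1 r.2] x = F x.
Proof. by apply/seteqP; split=> y; rewrite /xsection /= inE. Qed.

Lemma ysection_set (T1 T2 : Type) (F : T1 -> set T2) y :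
  ysection [set r : T1 * T2 | F r.1 r.2] y = [set x | F x y].
Proof. by apply/seteqP; split=> x; rewrite /ysection /= inE. Qed.

Local Open Scope ereal_scope.

(** Integrate first over the sample: a given point of [G] has one of its
    [2 ^ d] orthants missed with probability at most
    [2 ^ d (1 - p) ^ m]. *)
Lemma missed_integral m p G A : cell P p G A ->
  \int[tm m]_Y P (missed G A Y) <=
  ((2 ^+ d * expR (- (m%:R * p)))%:E * P G).
Proof.
move=> cA; have [mG mA PA _] := cA; have mW := @measurable_missed m _ _ _ cA.
set X := [set r : m.-tuple V * V | missed G A r.1 r.2] in mW.
have -> : \int[tm m]_Y P (missed G A Y) = \int[tm m]_Y P (xsection X Y).
  by apply: eq_integral => Y _; rewrite /X xsection_set.
rewrite product_measure_swap//.
set e := (2 ^+ d * _)%R.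
have e0 : (0 <= e)%R by rewrite mulr_ge0 ?exprn_ge0 ?expR_ge0.
rewrite -[X in _ <= _ * P X](setIT G) -integral_indic// -ge0_integralZl_EFin//; last first.
  exact/measurable_EFinP.
apply: ge0_le_integral => //.
- exact: (measurable_fun_ysection (tm m) mW).
- by apply: measurable_funeM; exact/measurable_EFinP.
move=> x _; rewrite indicE /X ysection_set.
have [Gx|nGx] := pselect (G x); last first.
  rewrite memNset// mule0 (_ : mkset _ = set0) ?measure0//.
  by apply/seteqP; split=> // Y [].
rewrite mem_set// mule1.
pose U (s : {ffun 'I_d -> bool}) : set (m.-tuple V) :=
  [set Y | forall l, (~` xsection (A s) x) (tnth Y l)].
have mAs s : measurable (xsection (A s) x) by exact: measurable_xsection.
have mU s : measurable (U s).
  rewrite (_ : U s = \bigcap_l ((fun Y => tnth Y l) @^-1` (~` xsection (A s) x))).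
    apply: fin_bigcap_measurable => // l _; rewrite -[X in measurable X]setTI.
    by apply: measurable_tnth => //; exact: measurableC.
  by apply/seteqP; split=> Y h l; [move=> _|]; exact: h.
have mWx : measurable [set Y : m.-tuple V | missed G A Y x].
  by have := measurable_ysection x mW; rewrite /X ysection_set.
apply: le_trans (measure_fin_cover (tm m) mWx mU _) _.
  move=> Y /= [_ [s hs]]; exists s => // l /=.
  by rewrite /xsection /= inE; exact: hs.
have -> : e%:E = \sum_(s : {ffun 'I_d -> bool}) (expR (- p) ^+ m)%:E.
  rewrite sumEFin sumr_const card_ffun card_bool card_ord /e -[in RHS]mulr_natl natrX.
  by rewrite -expRM_natl mulrN.
apply: lee_sum => s _.
rewrite [X in X <= _](_ : _ = \prod_(l < m) P (~` xsection (A s) x)); last first.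
  by apply: (@tuple_measure_box _ _ _ P m (fun=> ~` xsection (A s) x)) => _; exact: measurableC.
set B := xsection (A s) x in mAs *; have mB : measurable B := mAs s.
have [r [r0 rp ->]] : exists r : R, [/\ (0 <= r)%R, (r <= expR (- p))%R & P (~` B) = r%:E].
  have Pfin : P (~` B) \is a fin_num by rewrite fin_num_measure//; exact: measurableC.
  exists (fine (P (~` B))); split; [by rewrite fine_ge0| |by rewrite fineK].
  rewrite -lee_fin fineK//; apply: (@le_trans _ _ (1 - p)%:E); last first.
    by rewrite lee_fin; exact: expR_ge1Dx.
  by rewrite probability_setC// EFinB leeB//; exact: PA.
rewrite prodEFin prodr_const card_ord lee_fin.
by apply: lerXn2r => //; rewrite nnegrE// expR_ge0.
Qed.

(** The missed part has measure at most [M], which turns the moment of order [q]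
    into a first moment. *)
Lemma missed_moment m q p G A (M : R) : (0 < q)%N -> cell P p G A ->
  P G <= M%:E ->
  \int[tm m]_Y (fine (P (missed G A Y)) ^+ q)%:E <=
  (2 ^+ d * expR (- (m%:R * p)) * M ^+ q)%:E.
Proof.
move=> q0 cA PG; have [mG mA _ _] := cA; have mW := @measurable_missed m _ _ _ cA.
have mWY (Y : m.-tuple V) : measurable (missed G A Y).
  by have := measurable_xsection Y mW; rewrite xsection_set.
have finW (Y : m.-tuple V) : P (missed G A Y) \is a fin_num by rewrite fin_num_measure.
have WM (Y : m.-tuple V) : (0 <= fine (P (missed G A Y)) <= M)%R.
  rewrite fine_ge0//= -lee_fin fineK//; apply: le_trans PG.
  by apply: le_measure; rewrite ?inE// => x [].
have M0 : (0 <= M)%R by rewrite -lee_fin; apply: le_trans PG.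
have mPW : measurable_fun setT (fun Y : m.-tuple V => P (missed G A Y)).
  rewrite (_ : (fun Y => _) = P \o xsection [set r : m.-tuple V * V | missed G A r.1 r.2]).
    exact: measurable_fun_xsection.
  by apply/funext => Y; rewrite /= xsection_set.
have mfW : measurable_fun setT (fun Y : m.-tuple V => fine (P (missed G A Y)) : R).
  exact: (measurableT_comp (@fine_measurable R _ measurableT) mPW).
apply: (@le_trans _ _ (\int[tm m]_Y ((M ^+ q.-1)%:E * P (missed G A Y)))).
  apply: ge0_le_integral => //.
  - by move=> Y _; rewrite lee_fin exprn_ge0// fine_ge0.
  - by apply/measurable_EFinP; exact: measurable_funX.
  - exact: measurable_funeM.
  - move=> Y _; rewrite -[P _]fineK// -EFinM lee_fin -{1}(prednK q0) exprSr.
    have /andP[h0 h1] := WM Y; apply: ler_wpM2r => //.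
    by apply: lerXn2r => //; rewrite nnegrE.
rewrite ge0_integralZl_EFin//; last by rewrite exprn_ge0.
apply: (@le_trans _ _ ((M ^+ q.-1)%:E * ((2 ^+ d * expR (- (m%:R * p)))%:E * M%:E))).
  apply: lee_wpmul2l; first by rewrite lee_fin exprn_ge0.
  by apply: le_trans (missed_integral m cA) _; exact: lee_wpmul2l.
rewrite -!EFinM lee_fin -{2}(prednK q0) exprSr le_eqVlt; apply/orP; left; apply/eqP.
by ring.
Qed.

End missed.

Section real_bounds.
Context (R : realType).

(** The bound [1 + y <= expR y] at [y = x / r]. *)
Lemma expRN_le_pow (x : R) r : (0 < r)%N -> 0 < x ->
  expR (- x) <= (r%:R / x) ^+ r.
Proof.
move=> r0 x0; have rR : 0 < r%:R :> R by rewrite ltr0n.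
have -> : - x = r%:R * - (x / r%:R) by field; rewrite gt_eqF.
rewrite expRM_natl; apply: lerXn2r; rewrite ?nnegrE ?expR_ge0 ?divr_ge0 ?(ltW rR) ?(ltW x0)//.
rewrite expRN -[leRHS]invrK lef_pV2 ?posrE ?expR_gt0 ?invr_gt0 ?divr_gt0// invf_div.
by apply: le_trans (expR_ge1Dx _); rewrite lerDr.
Qed.

Lemma weighted_sum_pow (I : finType) (c v : I -> R) (S : R) q : (0 < q)%N ->
  (forall i, 0 <= c i) -> (forall i, 0 <= v i) -> \sum_i c i <= S ->
  (\sum_i c i * v i) ^+ q <= S ^+ q * \sum_i v i ^+ q.
Proof.
move=> q0 c0 v0 cS.
have S0 : 0 <= S by apply: le_trans cS; rewrite sumr_ge0.
have [[i0 _]|nI] := pselect (exists i : I, True); last first.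
  rewrite [leLHS](_ : _ = 0); first by rewrite mulr_ge0 ?exprn_ge0// sumr_ge0// => i _; rewrite exprn_ge0.
  by rewrite big1 ?expr0n ?(gtn_eqF q0)// => i _; case: nI; exists i.
pose j := [arg max_(i > i0) v i]%O.
have vj i : v i <= v j by rewrite /j; case: arg_maxP => // k _; exact.
apply: (@le_trans _ _ ((S * v j) ^+ q)).
  apply: lerXn2r; rewrite ?nnegrE ?mulr_ge0//.
    by rewrite sumr_ge0// => i _; rewrite mulr_ge0.
  apply: (@le_trans _ _ ((\sum_i c i) * v j)); last exact: ler_wpM2r.
  by rewrite mulr_suml; apply: ler_sum => i _; exact: ler_wpM2l.
rewrite exprMn; apply: ler_wpM2l; first exact: exprn_ge0.
by rewrite (bigD1 j)//= lerDl sumr_ge0// => i _; rewrite exprn_ge0.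
Qed.

Lemma geometric_half_sum J : \sum_(j < J) (2^-1 : R) ^+ j <= 2.
Proof.
have -> : \sum_(j < J) (2^-1 : R) ^+ j = 2 - 2 * 2^-1 ^+ J.
  elim: J => [|J IH]; first by rewrite big_ord0 expr0; ring.
  by rewrite big_ord_recr /= IH exprS; field.
by have : 0 <= (2^-1 : R) ^+ J by []; lra.
Qed.

End real_bounds.

Lemma pow_add_le (R : realType) (x y : R) q : (0 < q)%N -> 0 <= x -> 0 <= y ->
  (x + y) ^+ q <= 2 ^+ q * (x ^+ q + y ^+ q).
Proof.
move=> q0 x0 y0.
have := @weighted_sum_pow R _ (fun=> 1) (fun b : bool => if b then x else y) 2 q q0.
rewrite !big_bool !mul1r; apply => //; first by case.
Qed.

Section exposed.
Context (R : realType) (d : nat).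
Local Notation V := 'rV[R]_d.

Lemma extreme_point_convex_in (S : set V) v :
  extreme_points (convex_hull S) v -> convex_in (convex_hull S `\ v).
Proof.
move=> [hv ev] x y t [hx xv] [hy yv] /andP[t0 t1].
have [tz|tn0] := eqVneq t 0.
  by rewrite tz scale0r add0r subr0 scale1r; split.
have [to|tn1] := eqVneq t 1.
  by rewrite to scale1r subrr scale0r addr0; split.
have t01 : 0 < t < 1 by rewrite !lt_neqAle t0 t1 (eq_sym 0) tn0 tn1.
split; last by move=> /esym vE; apply: xv; have [] := ev x y t hx hy t01 vE.
move=> C [cC SC]; have /convex_setP cC' := cC.
by apply: cC'; rewrite ?t0 ?t1//; [apply: hx|apply: hy].
Qed.

Lemma sub_convex_hull (S : set V) : S `<=` convex_hull S.
Proof. by move=> x Sx C [_]; exact. Qed.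

(** Removing a vertex from the hull leaves a convex set, so that other points of
    the hull cannot trap it. *)
Lemma vertex_missed m p (P : set V -> \bar R) G A (Y : m.-tuple V) (S : set V) v :
  cell P p G A -> G v -> [set` Y] `<=` S -> extreme_points (convex_hull S) v ->
  missed G A Y v.
Proof.
move=> [_ _ _ AG] Gv YS ev; split=> //; apply: contrapT => nm.
have /choice[l hl] s : exists l, A s (v, tnth Y l).
  by apply: contrapT => nl; apply: nm; exists s => l Al; apply: nl; exists l.
have [yv hC] := AG v (fun s => tnth Y (l s)) Gv hl.
have := hC _ (extreme_point_convex_in ev); case/(_ _); last by move=> _ /(_ erefl).
move=> s; split; last exact: yv.
by apply: sub_convex_hull; apply: YS; rewrite /= mem_tnth.
Qed.

Definition exposed J (K E : set V) (G : 'I_J.+1 * 'I_d -> set V)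
    (A : 'I_J.+1 * 'I_d -> {ffun 'I_d -> bool} -> set (V * V)) m (Y : m.-tuple V) : set V :=
  (~` K `|` E) `|` \bigcup_t missed (G t) (A t) Y.

(** The cells of level [j] have measure [O(D ^ j / k ^ 2)], and a sample of size
    of order [k ^ (d + 1)] misses their points with probability
    [O(exp (- c 2 ^ j))].  The moment of a sum over the levels is bounded by
    giving to the level [j] the weight [2 ^ -j]. *)
Lemma exposed_moment (c C D : R) q : (0 < d)%N -> (0 < q)%N -> 0 < c -> 0 < C -> 1 <= D ->
  exists2 B : R, 0 < B & forall (P : probability V R) (K : set V) k m,
  measurable K -> P (~` K) = 0%E -> (0 < k)%N -> (k ^ d.+1 <= 3 * m)%N ->
  cell_cover c C D P K k ->
  exists Z : m.-tuple V -> set V,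
  [/\ measurable [set r : m.-tuple V * V | Z r.1 r.2],
    forall Y (S : set V) v, [set` Y] `<=` S -> extreme_points (convex_hull S) v -> Z Y v &
    (\int[tuple_measure P m]_Y (fine (P (Z Y)) ^+ q)%:E <=
     (B / k%:R ^+ (2 * q))%:E)%E].
Proof.
move=> d0 q0 c0 C0 D1.
(* the power that replaces the exponential: it has to absorb the factors
   D ^ (j q) of the measures and 2 ^ (j q) of the weights, and leave 2 ^ -j *)
pose r := (Num.truncn ((2 * D) ^+ q * 2)).+1.
have rP : (2 * D) ^+ q * 2 <= 2 ^+ r.
  apply: (@le_trans _ _ r%:R); first exact/ltW/truncnS_gt.
  by rewrite -natrX ler_nat ltnW// ltn_expl.
have rR : 0 < r%:R :> R by rewrite ltr0n.
have dR : 0 < d%:R :> R by rewrite ltr0n.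
pose F : R := 2 ^+ d * C ^+ q * (3 * r%:R / c) ^+ r.
have F0 : 0 < F by rewrite /F !(mulr_gt0, exprn_gt0, invr_gt0).
pose B : R := 2 ^+ q * C ^+ q + 2 ^+ q * (d%:R * 2) ^+ q * (d%:R * 2 * F).
have d2R : 0 < d%:R * 2 :> R by exact: mulr_gt0.
exists B.
  apply: addr_gt0; first by apply: mulr_gt0; exact: exprn_gt0.
  by apply: mulr_gt0; [apply: mulr_gt0; exact: exprn_gt0|exact: mulr_gt0].
move=> P K k m mK PK k0 km [J [E [G [A [mE PE KEG cG]]]]].
have kR : 0 < k%:R :> R by rewrite ltr0n.
have k2 : 0 < k%:R ^+ 2 :> R by rewrite exprn_gt0.
exists (fun Y => exposed K E G A Y).
have mW t : measurable [set s : m.-tuple V * V | missed (G t) (A t) s.1 s.2].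
  by have [ct _] := cG t; exact: measurable_missed ct.
have mKE : measurable (~` K `|` E) by apply: measurableU => //; exact: measurableC.
have mZ : measurable [set s : m.-tuple V * V | exposed K E G A s.1 s.2].
  rewrite (_ : mkset _ = (snd @^-1` (~` K `|` E)) `|`
     \bigcup_t [set s : m.-tuple V * V | missed (G t) (A t) s.1 s.2])//.
  apply: measurableU; last by apply: fin_bigcup_measurable => // t _; exact: mW.
  by rewrite -[X in measurable X]setTI; exact: measurable_snd.
split => //.
  move=> Y S v YS ev; have [Kv|nKv] := pselect (K v); last by left; left.
  have [Ev|[t _ Gv]] := KEG v Kv; first by left; right.
  by right; exists t => //; apply: vertex_missed (cG t).1 Gv YS ev.
have mWY t (Y : m.-tuple V) : measurable (missed (G t) (A t) Y).
  by have := measurable_xsection Y (mW t); rewrite xsection_set.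
have mZY (Y : m.-tuple V) : measurable (exposed K E G A Y).
  by have := measurable_xsection Y mZ; rewrite xsection_set.
pose w t (Y : m.-tuple V) : R := fine (P (missed (G t) (A t) Y)).
have w0 t Y : 0 <= w t Y by rewrite fine_ge0.
have ZE (Y : m.-tuple V) : fine (P (exposed K E G A Y)) <= C / k%:R ^+ 2 + \sum_t w t Y.
  rewrite -lee_fin fineK ?fin_num_measure// EFinD -sumEFin.
  apply: le_trans (measureU2 _ _ _) _ => //.
    by apply: fin_bigcup_measurable => // t _; exact: mWY.
  apply: leeD.
    apply: le_trans (measureU2 _ _ _) _ => //; first exact: measurableC.
    by rewrite [X in (X + _)%E]PK add0e.
  apply: le_trans (measure_fin_cover P (fin_bigcup_measurable finite_finset (fun t _ => mWY t Y)) (mWY^~ Y) (@subset_refl _ _)) _.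
  by apply: lee_sum => t _; rewrite /w fineK// fin_num_measure.
pose b : R := (2 ^+ q * (d%:R * 2) ^+ q).
have b0 : 0 < b by apply: mulr_gt0; exact: exprn_gt0.
have ZqE (Y : m.-tuple V) : fine (P (exposed K E G A Y)) ^+ q <=
    2 ^+ q * (C / k%:R ^+ 2) ^+ q + \sum_(t : 'I_J.+1 * 'I_d) (b * (2 ^+ t.1) ^+ q) * w t Y ^+ q.
  apply: (@le_trans _ _ ((C / k%:R ^+ 2 + \sum_t w t Y) ^+ q)).
    apply: lerXn2r (ZE Y); rewrite nnegrE ?fine_ge0// addr_ge0 ?sumr_ge0//.
    by rewrite divr_ge0 ?ltW.
  have Sw0 : 0 <= \sum_t w t Y by apply: sumr_ge0.
  apply: le_trans (pow_add_le q0 _ Sw0) _; first by rewrite divr_ge0 ?ltW.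
  rewrite mulrDr lerD2l.
  have h : (\sum_t w t Y) ^+ q <= (d%:R * 2) ^+ q *
      \sum_(t : 'I_J.+1 * 'I_d) (2 ^+ t.1 * w t Y) ^+ q.
    rewrite (eq_bigr (fun t : 'I_J.+1 * 'I_d => 2^-1 ^+ t.1 * (2 ^+ t.1 * w t Y))) => [|t _]; last first.
      by rewrite mulrA -exprMn mulVf ?expr1n ?mul1r.
    apply: weighted_sum_pow => // [t|].
    - by rewrite mulr_ge0.
    - rewrite -(pair_bigA _ (fun (j : 'I_J.+1) (l : 'I_d) => 2^-1 ^+ j))/=.
      rewrite (eq_bigr (fun j : 'I_J.+1 => d%:R * 2^-1 ^+ j)) => [|j _].
        by rewrite -mulr_sumr ler_wpM2l// geometric_half_sum.
      by rewrite sumr_const card_ord -[LHS]mulr_natl.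
  apply: (@le_trans _ _ (2 ^+ q * ((d%:R * 2) ^+ q *
    \sum_(t : 'I_J.+1 * 'I_d) (2 ^+ t.1 * w t Y) ^+ q))); first exact: ler_wpM2l.
  rewrite mulrA mulr_sumr le_eqVlt; apply/orP; left; apply/eqP.
  by apply: eq_bigr => t _; rewrite [(2 ^+ t.1 * w t Y) ^+ q]exprMn mulrA.
have mw t : measurable_fun setT (fun Y : m.-tuple V => w t Y).
  apply: (@measurableT_comp _ _ _ _ _ _ (@fine R)); first exact: fine_measurable.
  rewrite (_ : (fun Y => _) = P \o xsection [set s : m.-tuple V * V | missed (G t) (A t) s.1 s.2]).
    exact: measurable_fun_xsection.
  by apply/funext => Y; rewrite /= xsection_set.
have mPZ : measurable_fun setT (fun Y : m.-tuple V => fine (P (exposed K E G A Y))).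
  apply: (@measurableT_comp _ _ _ _ _ _ (@fine R)); first exact: fine_measurable.
  rewrite (_ : (fun Y => _) = P \o xsection [set s : m.-tuple V * V | exposed K E G A s.1 s.2]).
    exact: measurable_fun_xsection.
  by apply/funext => Y; rewrite /= xsection_set.
pose b_ (t : 'I_J.+1 * 'I_d) : R := b * (2 ^+ t.1) ^+ q.
have b_0 t : 0 <= b_ t by rewrite mulr_ge0 ?exprn_ge0 ?ltW.
have mwq t : measurable_fun setT (fun Y : m.-tuple V => (w t Y ^+ q)%:E).
  by apply/measurable_EFinP; exact: measurable_funX.
apply: (@le_trans _ _ (\int[tuple_measure P m]_Y ((2 ^+ q * (C / k%:R ^+ 2) ^+ q)%:E +
   \sum_t (b_ t)%:E * (w t Y ^+ q)%:E))%E).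
  apply: ge0_le_integral => //.
  - by move=> Y _; rewrite lee_fin exprn_ge0// fine_ge0.
  - by apply/measurable_EFinP; exact: measurable_funX.
  - apply: emeasurable_funD => //; apply: emeasurable_sum => t.
    exact: measurable_funeM.
  - move=> Y _; rewrite [X in (_ <= _ + X)%E](_ : _ = (\sum_t b_ t * w t Y ^+ q)%:E); last first.
      by rewrite -sumEFin; apply: eq_bigr => t _; rewrite EFinM.
    by rewrite -EFinD lee_fin.
rewrite ge0_integralD//; last 3 first.
- by move=> Y _; rewrite lee_fin mulr_ge0 ?exprn_ge0// divr_ge0 ?ltW.
- by move=> Y _; apply: sume_ge0 => t _; rewrite mule_ge0// lee_fin// exprn_ge0.
- by apply: emeasurable_sum => t; exact: measurable_funeM.
rewrite integral_cst// [X in (_ * X)%E](probability_setT (iid_law P m)) mule1.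
rewrite ge0_integral_sum//; last 2 first.
- by move=> t; exact: measurable_funeM.
- by move=> t Y _; rewrite mule_ge0// lee_fin// exprn_ge0.
apply: (@le_trans _ _ ((2 ^+ q * (C / k%:R ^+ 2) ^+ q)%:E +
   \sum_(t : 'I_J.+1 * 'I_d) (b * F / k%:R ^+ (2 * q) * 2^-1 ^+ t.1)%:E)%E).
  apply: leeD => //; apply: lee_sum => t _.
  rewrite ge0_integralZl_EFin//; last by move=> Y _; rewrite lee_fin exprn_ge0.
  have [ct PG] := cG t.
  apply: (@le_trans _ _ ((b_ t)%:E * (2 ^+ d * expR (- (m%:R * (c * 2 ^+ t.1 / k%:R ^+ d.+1))) *
     (C * D ^+ t.1 / k%:R ^+ 2) ^+ q)%:E)%E).
    by apply: lee_wpmul2l; [rewrite lee_fin|exact: missed_moment q0 ct PG].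
  rewrite -EFinM lee_fin.
  set j := nat_of_ord t.1; set u : R := 2 ^+ j.
  have u0 : 0 < u by rewrite exprn_gt0.
  have kd : 0 < k%:R ^+ d.+1 :> R by rewrite exprn_gt0.
  have expB : expR (- (m%:R * (c * u / k%:R ^+ d.+1))) <= (3 * r%:R / c) ^+ r * (u^-1) ^+ r.
    apply: (@le_trans _ _ (expR (- (c * u / 3)))).
      rewrite ler_expR lerN2 mulrCA -!mulrA ler_pM2l// ler_pM2l//.
      rewrite ler_pdivlMr// ler_pdivrMl//.
      by move: km; rewrite -(ler_nat R) natrX natrM mulrC.
    apply: le_trans (expRN_le_pow (r := r) _ _) _ => //; first by rewrite !mulr_gt0.
    rewrite -exprMn le_eqVlt; apply/orP; left; apply/eqP; congr (_ ^+ _).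
    by field; rewrite !gt_eqF.
  have uD : (u * D ^+ j) ^+ q * (u^-1) ^+ r <= 2^-1 ^+ j.
    have -> : (u * D ^+ j) ^+ q * u^-1 ^+ r = ((2 * D) ^+ q * (2 ^+ r)^-1) ^+ j.
      have -> : (u * D ^+ j) ^+ q = ((2 * D) ^+ q) ^+ j.
        by rewrite /u -[2 ^+ j * _]exprMn -!exprM mulnC.
      have -> : u^-1 ^+ r = ((2 ^+ r)^-1) ^+ j by rewrite /u !exprVn -!exprM mulnC.
      by rewrite [RHS]exprMn.
    apply: lerXn2r; rewrite ?nnegrE ?mulr_ge0 ?invr_ge0 ?exprn_ge0 ?mulr_ge0//; first lra.
    by rewrite ler_pdivrMr ?exprn_gt0// [leRHS]mulrC ler_pdivlMr.
  rewrite /b_ -/j -/u /F.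
  have -> : (C * D ^+ j / k%:R ^+ 2) ^+ q = C ^+ q * (D ^+ j) ^+ q / k%:R ^+ (2 * q).
    by rewrite expr_div_n exprMn exprM.
  have kq : 0 < k%:R ^+ (2 * q) :> R by rewrite exprn_gt0.
  rewrite [leLHS](_ : _ = (b * 2 ^+ d * C ^+ q / k%:R ^+ (2 * q)) *
     ((u * D ^+ j) ^+ q * expR (- (m%:R * (c * u / k%:R ^+ d.+1))))); last first.
    by rewrite !exprMn; ring.
  rewrite [leRHS](_ : _ = (b * 2 ^+ d * C ^+ q / k%:R ^+ (2 * q)) *
     ((3 * r%:R / c) ^+ r * 2^-1 ^+ j)); last by ring.
  apply: ler_wpM2l; first by apply: ltW; rewrite !(mulr_gt0, exprn_gt0, invr_gt0).
  apply: (@le_trans _ _ ((u * D ^+ j) ^+ q * ((3 * r%:R / c) ^+ r * u^-1 ^+ r))).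
    apply: ler_wpM2l => //; apply: exprn_ge0; apply: mulr_ge0; first exact: ltW.
    by apply: exprn_ge0; lra.
  rewrite mulrCA; apply: ler_wpM2l => //.
  by rewrite exprn_ge0// ltW// !(mulr_gt0, invr_gt0).
rewrite sumEFin -EFinD lee_fin.
rewrite -(pair_bigA _ (fun (j : 'I_J.+1) (l : 'I_d) => b * F / k%:R ^+ (2 * q) * 2^-1 ^+ j))/=.
rewrite (eq_bigr (fun j : 'I_J.+1 => d%:R * (b * F / k%:R ^+ (2 * q)) * 2^-1 ^+ j)) => [|j _]; last first.
  by rewrite sumr_const card_ord -[LHS]mulr_natl mulrA.
rewrite -mulr_sumr expr_div_n -exprM /B -/b.
have kq : 0 < k%:R ^+ (2 * q) :> R by rewrite exprn_gt0.
apply: (@le_trans _ _ (2 ^+ q * (C ^+ q / k%:R ^+ (2 * q)) + d%:R * (b * F / k%:R ^+ (2 * q)) * 2)).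
  rewrite lerD2l; apply: ler_wpM2l; last exact: geometric_half_sum.
  by rewrite mulr_ge0 ?divr_ge0 ?(ltW (mulr_gt0 b0 F0)) ?(ltW kq).
rewrite le_eqVlt; apply/orP; left; apply/eqP; ring.
Qed.

End exposed.

(** * The moments of the number of vertices from above *)

(** Both integrals are suprema over the simple functions below the integrand, and
    every simple function below [f] is below [g].  The number of vertices is
    compared in this way with numbers of hits. *)
Lemma ge0_le_integral_any d (T : measurableType d) (R : realType)
    (mu : {measure set T -> \bar R}) (f g : T -> \bar R) :
  (forall x, 0 <= f x)%E -> (forall x, f x <= g x)%E ->
  (\int[mu]_x f x <= \int[mu]_x g x)%E.
Proof.
move=> f0 fg; have g0 x : (0 <= g x)%E by exact: le_trans (fg x).
rewrite !ge0_integralTE//; apply: le_ereal_sup => _ [h hf <-].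
by exists h => // x; apply: le_trans (hf x) (fg x).
Qed.

Section split_sample.
Context d (T : measurableType d) (R : realType) (P : probability T R).
Local Notation tm := (tuple_measure P).

Definition left_part m n (t : (m + n).-tuple T) : m.-tuple T :=
  [tuple tnth t (lshift n i) | i < m].

Definition right_part m n (t : (m + n).-tuple T) : n.-tuple T :=
  [tuple tnth t (rshift m i) | i < n].

Lemma left_part_cat m n (x : m.-tuple T) (y : n.-tuple T) :
  left_part (cat_tuple x y) = x.
Proof. by apply: eq_from_tnth => i; rewrite tnth_mktuple tnth_lshift. Qed.

Lemma right_part_cat m n (x : m.-tuple T) (y : n.-tuple T) :
  right_part (cat_tuple x y) = y.
Proof. by apply: eq_from_tnth => i; rewrite tnth_mktuple tnth_rshift. Qed.

Lemma cat_parts m n (t : (m + n).-tuple T) :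
  cat_tuple (left_part t) (right_part t) = t.
Proof.
apply: eq_from_tnth => i; case: (splitP i) => j ij.
  by rewrite (_ : i = lshift n j) ?tnth_lshift ?tnth_mktuple//; exact/val_inj.
by rewrite (_ : i = rshift m j) ?tnth_rshift ?tnth_mktuple//; exact/val_inj.
Qed.

Lemma measurable_left_part m n : measurable_fun setT (@left_part m n).
Proof.
apply/measurable_fun_tnthP => i.
rewrite (_ : _ \o _ = fun t : (m + n).-tuple T => tnth t (lshift n i)).
  exact: measurable_tnth.
by apply/funext => t /=; rewrite tnth_mktuple.
Qed.

Lemma measurable_right_part m n : measurable_fun setT (@right_part m n).
Proof.
apply/measurable_fun_tnthP => i.
rewrite (_ : _ \o _ = fun t : (m + n).-tuple T => tnth t (rshift m i)).
  exact: measurable_tnth.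
by apply/funext => t /=; rewrite tnth_mktuple.
Qed.

Lemma measurable_hits_part d' (S : measurableType d') m n (f : S -> m.-tuple T)
    (g : S -> n.-tuple T) (Z : m.-tuple T -> set T) (h : nat -> \bar R) :
  measurable_fun setT f -> measurable_fun setT g ->
  measurable [set r : m.-tuple T * T | Z r.1 r.2] ->
  measurable_fun setT (fun s => h (hits (Z (f s)) (g s))).
Proof.
move=> mf mg mZ; apply: (@measurable_hits _ T R _ S n (fun s => Z (f s)) g h) => i.
have mfg : measurable_fun setT (fun s => (f s, tnth (g s) i)).
  apply: measurable_fun_pair => //.
  by apply: (@measurableT_comp _ _ _ _ _ _ (fun t : n.-tuple T => tnth t i)) => //;
    exact: measurable_tnth.
by rewrite -[X in measurable X]setTI; exact: (mfg measurableT _ mZ).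
Qed.

(** Given [Y], the number of points of [X] in [Z Y] is binomial. *)
Lemma half_moment m n q (Z : m.-tuple T -> set T) (B : R) : (0 < q)%N -> 0 <= B ->
  measurable [set r : m.-tuple T * T | Z r.1 r.2] ->
  (\int[tm m]_Y (fine (P (Z Y)) ^+ q)%:E <= B%:E)%E ->
  (\int[tm m]_Y \int[tm n]_X ((hits (Z Y) X)%:R ^+ q : R)%:E <=
   ((2 * q)%:R ^+ q * (1 + n%:R ^+ q * B))%:E)%E.
Proof.
move=> q0 B0 mZ ZB; set c : R := (2 * q)%:R ^+ q.
have c0 : 0 <= c by rewrite exprn_ge0.
have mZY Y : measurable (Z Y).
  by have := measurable_xsection Y mZ; rewrite xsection_set.
have mPZ : measurable_fun setT (fun Y => fine (P (Z Y))).
  apply: (@measurableT_comp _ _ _ _ _ _ (@fine R)); first exact: fine_measurable.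
  rewrite (_ : (fun Y => _) = P \o xsection [set r : m.-tuple T * T | Z r.1 r.2]).
    exact: measurable_fun_xsection.
  by apply/funext => Y; rewrite /= xsection_set.
have mPZq : measurable_fun setT (fun Y => (fine (P (Z Y)) ^+ q)%:E).
  by apply/measurable_EFinP; exact: measurable_funX.
apply: (@le_trans _ _ (\int[tm m]_Y (c%:E * (1 + (n%:R ^+ q)%:E * (fine (P (Z Y)) ^+ q)%:E)))%E).
  apply: ge0_le_integral_any => Y.
    by apply: integral_ge0 => X _; rewrite lee_fin exprn_ge0.
  exact: (@hits_moment _ T R P n q (Z Y) q0 (mZY Y)).
have mM : measurable_fun setT (fun Y => (n%:R ^+ q)%:E * (fine (P (Z Y)) ^+ q)%:E)%E.
  exact: measurable_funeM.
have M0 Y : (0 <= (n%:R ^+ q)%:E * (fine (P (Z Y)) ^+ q)%:E)%E.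
  by rewrite -EFinM lee_fin mulr_ge0 ?exprn_ge0 ?fine_ge0.
rewrite ge0_integralZl_EFin//; last 2 first.
- by move=> Y _; rewrite adde_ge0.
- exact: emeasurable_funD.
rewrite ge0_integralD// integral_cst// mul1e ge0_integralZl_EFin//; last first.
- by move=> Y _; rewrite lee_fin exprn_ge0// fine_ge0.
rewrite [X in (X + _)%E](probability_setT (iid_law P m)) EFinM; apply: lee_wpmul2l.
  by rewrite lee_fin.
rewrite EFinD EFinM leeD2l//; apply: lee_wpmul2l => //.
Qed.

Lemma split_moment m n q (Z : m.-tuple T -> set T) (Z' : n.-tuple T -> set T) (B : R) :
  (0 < q)%N -> 0 <= B ->
  measurable [set r : m.-tuple T * T | Z r.1 r.2] ->
  measurable [set r : n.-tuple T * T | Z' r.1 r.2] ->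
  (\int[tm m]_Y (fine (P (Z Y)) ^+ q)%:E <= B%:E)%E ->
  (\int[tm n]_Y (fine (P (Z' Y)) ^+ q)%:E <= B%:E)%E ->
  forall f : (m + n).-tuple T -> nat,
  (forall x y, f (cat_tuple x y) <= hits (Z' y) x + hits (Z x) y)%N ->
  (\int[tm (m + n)]_t ((f t)%:R ^+ q : R)%:E <=
   (2 ^+ q * ((2 * q)%:R ^+ q * (1 + (m + n)%:R ^+ q * B) * 2))%:E)%E.
Proof.
move=> q0 B0 mZ mZ' ZB ZB' f fZ.
pose p (h : nat) : \bar R := (h%:R ^+ q)%:E.
have p0 h : (0 <= p h)%E by rewrite lee_fin exprn_ge0.
pose f1 (t : (m + n).-tuple T) := p (hits (Z' (right_part t)) (left_part t)).
pose f2 (t : (m + n).-tuple T) := p (hits (Z (left_part t)) (right_part t)).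
have mf1 : measurable_fun setT f1.
  by apply: measurable_hits_part mZ'; [exact: measurable_right_part|exact: measurable_left_part].
have mf2 : measurable_fun setT f2.
  by apply: measurable_hits_part mZ; [exact: measurable_left_part|exact: measurable_right_part].
have q2 : 0 <= 2 ^+ q :> R by rewrite exprn_ge0.
apply: (@le_trans _ _ (\int[tm (m + n)]_t ((2 ^+ q)%:E * (f1 t + f2 t)))%E).
  apply: ge0_le_integral_any => t; first by rewrite lee_fin exprn_ge0.
  rewrite -EFinD -EFinM lee_fin -[t in leLHS]cat_parts.
  apply: le_trans (pow_add_le q0 _ _) => //.
  by apply: lerXn2r; rewrite ?nnegrE// -natrD ler_nat.
rewrite ge0_integralZl_EFin//; last 2 first.
- by move=> t _; rewrite adde_ge0 ?p0.
- exact: emeasurable_funD.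
rewrite EFinM; apply: lee_wpmul2l; first by rewrite lee_fin.
rewrite ge0_integralD//; last 2 first.
- by move=> t _; exact: p0.
- by move=> t _; exact: p0.
have bound k : (k <= m + n)%N ->
    ((2 * q)%:R ^+ q * (1 + k%:R ^+ q * B) <= (2 * q)%:R ^+ q * (1 + (m + n)%:R ^+ q * B)).
  move=> kmn; apply: ler_wpM2l; first by rewrite exprn_ge0.
  rewrite lerD2l; apply: ler_wpM2r => //.
  by apply: lerXn2r; rewrite ?nnegrE// ler_nat.
rewrite [X in (_ <= X%:E)%E](_ : _ = (2 * q)%:R ^+ q * (1 + (m + n)%:R ^+ q * B) +
  (2 * q)%:R ^+ q * (1 + (m + n)%:R ^+ q * B)); last by ring.
rewrite EFinD; apply: leeD.
  apply: (@le_trans _ _ ((2 * q)%:R ^+ q * (1 + m%:R ^+ q * B))%:E); last first.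
    by rewrite lee_fin bound ?leq_addr.
  apply: le_trans (half_moment m q0 B0 mZ' ZB').
  rewrite integral_tuple_cat//; last by move=> t; exact: p0.
  under eq_integral => x _ do under eq_integral => y _ do
    rewrite /f1 left_part_cat right_part_cat.
  rewrite (fubini_tonelli (m1 := tm m) (m2 := tm n)
    (fun r : m.-tuple T * n.-tuple T => p (hits (Z' r.2) r.1)))//.
  by apply: measurable_hits_part mZ'; [exact: measurable_snd|exact: measurable_fst].
apply: (@le_trans _ _ ((2 * q)%:R ^+ q * (1 + n%:R ^+ q * B))%:E); last first.
  by rewrite lee_fin bound ?leq_addl.
apply: le_trans (half_moment n q0 B0 mZ ZB).
rewrite integral_tuple_cat//; last by move=> t; exact: p0.
by under eq_integral => x _ do under eq_integral => y _ do
  rewrite /f2 left_part_cat right_part_cat.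
Qed.

End split_sample.

Section upper_bound.
Context (R : realType) (d : nat).
Local Notation V := 'rV[R]_d.

Lemma n_vertices_le n (t : n.-tuple V) : (n_vertices t <= n)%N.
Proof.
rewrite /n_vertices -[leqRHS](size_tuple t); apply: uniq_leq_size; first exact: fset_uniq.
move=> v; rewrite in_fset_set; last exact: finite_vertices.
by move=> /set_mem /extreme_points_hull.
Qed.

(** Vertices are sample points, and those of one half are counted in the set
    exposed by the other half. *)
Lemma n_vertices_cat m n (x : m.-tuple V) (y : n.-tuple V) (Zx Zy : set V) :
  (forall v, extreme_points (convex_hull [set` cat_tuple x y]) v -> Zx v /\ Zy v) ->
  (n_vertices (cat_tuple x y) <= hits Zy x + hits Zx y)%N.
Proof.
move=> H; rewrite /hits -!size_filter -size_cat.
apply: uniq_leq_size; first exact: fset_uniq.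
move=> v; rewrite in_fset_set; last exact: finite_vertices.
move=> /set_mem ev; have [Zxv Zyv] := H v ev.
have := extreme_points_hull ev; rewrite /= mem_cat mem_cat !mem_filter.
by rewrite !mem_set.
Qed.

Lemma uniform_law_setC (K : convex_body R d) : uniform_law K (~` K) = 0%E.
Proof. by rewrite /uniform_law setICl measure0 mul0e. Qed.

Lemma vertices_upper q : (2 <= d)%N -> (0 < q)%N -> exists2 B : R, 0 < B &
  forall (K : convex_body R d) k m n, (0 < k)%N ->
    (k ^ d.+1 <= 3 * m)%N -> (k ^ d.+1 <= 3 * n)%N ->
    (\int[iid_law (uniform_law K) (m + n)]_t ((n_vertices t)%:R ^+ q : R)%:E <=
     (B * (1 + (m + n)%:R ^+ q / k%:R ^+ (2 * q)))%:E)%E.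
Proof.
move=> d2 q0; have [c [C [D [c0 C0 D1 cov]]]] := @cell_cover_uniform R d d2.
have [B B0 BP] := @exposed_moment R d c C D q (leq_trans (ltn0Sn 1) d2) q0 c0 C0 D1.
pose a : R := 2 ^+ q * (2 * q)%:R ^+ q * 2.
have a0 : 0 < a by rewrite !mulr_gt0 ?exprn_gt0 ?ltr0n ?muln_gt0.
exists (a * (1 + B)); first by rewrite mulr_gt0// addr_gt0.
move=> K k m n k0 km kn.
have mK : measurable (body K) by exact: measurable_body.
have [Z [mZ vZ ZB]] := BP _ _ _ _ mK (uniform_law_setC K) k0 km (cov K k k0).
have [Z' [mZ' vZ' ZB']] := BP _ _ _ _ mK (uniform_law_setC K) k0 kn (cov K k k0).
have kq : 0 < k%:R ^+ (2 * q) :> R by rewrite exprn_gt0// ltr0n.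
have B0' : 0 <= B / k%:R ^+ (2 * q) by rewrite divr_ge0 ?ltW.
have := split_moment q0 B0' mZ mZ' ZB ZB' (f := fun t => n_vertices t).
move=> /(_ _)/le_trans; apply.
  move=> x y; apply: n_vertices_cat => v ev; split.
    by apply: vZ ev => u; rewrite /= mem_cat => ->.
  by apply: vZ' ev => u; rewrite /= mem_cat => ->; rewrite orbT.
rewrite lee_fin (_ : 2 ^+ q * _ = a * (1 + (m + n)%:R ^+ q * (B / k%:R ^+ (2 * q)))); last first.
  by rewrite /a; ring.
rewrite -mulrA; apply: ler_wpM2l; first exact: ltW.
have : 0 <= (m + n)%:R ^+ q / k%:R ^+ (2 * q) :> R by rewrite divr_ge0 ?exprn_ge0.
rewrite mulrCA; move: (_ / _) => z z0; nra.
Qed.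

End upper_bound.

(** * Caps of a paraboloid *)

(** A sample point maximising a small strictly convex perturbation of the
    affine function is a vertex of the hull, and the perturbation is too small
    to push it out of the half-space. *)
Lemma vertex_in_halfspace (R : realType) d n (t : n.-tuple 'rV[R]_d)
    (l : 'rV[R]_d -> R) (c : R) w :
  (forall x y s, l (s *: x + (1 - s) *: y) = s * l x + (1 - s) * l y) ->
  w \in t -> c < l w ->
  exists2 v, extreme_points (convex_hull [set` t]) v & c < l v.
Proof.
move=> lin wt cw.
pose Q (v : 'rV[R]_d) : R := \sum_i v ord0 i ^+ 2.
have Q0 v : 0 <= Q v by apply: sumr_ge0 => i _; exact: sqr_ge0.
pose M : R := \sum_(i < n) Q (tnth t i).
have QM i : Q (tnth t i) <= M.
  by rewrite /M (bigD1 i)//= lerDl; apply: sumr_ge0 => j _; exact: Q0.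
have M0 : 0 <= M by apply: sumr_ge0 => j _; exact: Q0.
pose eps := (l w - c) / (M + 1).
have eps0 : 0 < eps by rewrite divr_gt0 ?subr_gt0// ltr_wpDl.
have epsM : eps * M < l w - c.
  rewrite /eps mulrAC ltr_pdivrMr ?ltr_wpDl//; have : 0 < l w - c by rewrite subr_gt0.
  nra.
pose F v := l v + eps * Q v.
have [i0 wi] := tnthP _ _ wt.
have [i _ /= iP] := @arg_maxP _ R 'I_n i0 xpredT (fun i => F (tnth t i)) isT.
exists (tnth t i); last first.
  have := iP i0 isT; rewrite -wi /F => h.
  have := QM i; have := Q0 w; nra.
have Qmix x y s : Q (s *: x + (1 - s) *: y) =
    s * Q x + (1 - s) * Q y - s * (1 - s) * Q (x - y).
  rewrite /Q !mulr_sumr -big_split/= -sumrB; apply: eq_bigr => j _.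
  by rewrite !mxE; ring.
have hF x : convex_hull [set` t] x -> F x <= F (tnth t i).
  move=> hx; apply: (hx [set u | F u <= F (tnth t i)]); split.
    apply/convex_setP => x1 y s /= x1F yF /andP[s0 s1]; rewrite /F lin Qmix.
    have mix A1 A2 G : A1 <= G -> A2 <= G -> s * A1 + (1 - s) * A2 <= G.
      by move=> h1 h2; nra.
    apply: le_trans (mix _ _ _ x1F yF); rewrite /F -subr_ge0.
    rewrite (_ : _ - _ = eps * (s * (1 - s) * Q (x1 - y))); last by ring.
    by rewrite mulr_ge0 ?(ltW eps0)// mulr_ge0// mulr_ge0// subr_ge0.
  by move=> y /= yt; have [j ->] := tnthP _ _ yt; exact: iP.
split; first by apply: sub_convex_hull; rewrite /= mem_tnth.
move=> x y s hx hy /andP[s0 s1] E.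
have [xF yF] := (hF x hx, hF y hy).
have z0 : Q (x - y) <= 0.
  have E' : F (tnth t i) = s * F x + (1 - s) * F y - eps * (s * (1 - s)) * Q (x - y).
    by rewrite {1}/F E lin Qmix /F; ring.
  have p0 : 0 < eps * (s * (1 - s)) by rewrite mulr_gt0// mulr_gt0// subr_gt0.
  rewrite -(pmulr_rle0 _ p0).
  nra.
have xy : x = y.
  apply/eqP; rewrite -subr_eq0; apply/eqP/rowP => j; rewrite [RHS]mxE; apply/eqP.
  rewrite -sqrf_eq0 eq_le sqr_ge0 andbT; apply: le_trans z0.
  by rewrite /Q (bigD1 j)//= lerDl; apply: sumr_ge0 => k _; exact: sqr_ge0.
by move: E; rewrite xy -scalerDl addrC subrK scale1r => ->.
Qed.

(** A vertex is a sample point, hence lies in [S], where the half-spaces are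
    disjoint: the vertices found in different ones differ. *)
Lemma n_vertices_disjoint (R : realType) d n (t : n.-tuple 'rV[R]_d) (I : finType)
    (l : I -> 'rV[R]_d -> R) (c : I -> R) (S : set 'rV[R]_d) :
  (forall a x y s, l a (s *: x + (1 - s) *: y) = s * l a x + (1 - s) * l a y) ->
  (forall i, S (tnth t i)) ->
  (forall a b v, S v -> c a < l a v -> c b < l b v -> a = b) ->
  (#|[pred a | [exists i, (c a < l a (tnth t i))%R]]| <= n_vertices t)%N.
Proof.
move=> lin St disj.
have tS v : v \in t -> S v by move=> /tnthP[i ->].
have /choice[f fP] a : exists v, [exists i, (c a < l a (tnth t i))%R] ->
    extreme_points (convex_hull [set` t]) v /\ c a < l a v.
  have [/existsP[i cl]|_] := boolP [exists i, (c a < l a (tnth t i))%R]; last by exists 0.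
  by have [v ev cv] := vertex_in_halfspace (lin a) (mem_tnth i t) cl; exists v.
rewrite cardE -(size_map f); apply: uniq_leq_size.
  rewrite map_inj_in_uniq ?enum_uniq// => a b; rewrite !mem_enum => ha hb fab.
  have [ea ca] := fP a ha; have [eb cb] := fP b hb.
  apply: (disj a b (f a) _ ca); last by rewrite fab.
  exact/tS/(extreme_points_hull ea).
move=> v /mapP[a]; rewrite mem_enum => ha ->.
rewrite in_fset_set; last exact: finite_vertices.
by apply/mem_set; have [] := fP a ha.
Qed.

Section paraboloid.
Context (R : realType) (e : nat) (e0 : (0 < e)%N).
Local Notation V := 'rV[R]_e.+1.

Definition base (v : V) (j : 'I_e) : R := v ord0 (lift ord0 j).

Definition paraboloid : set V :=
  [set v | \sum_j base v j ^+ 2 <= v ord0 ord0 /\ v ord0 ord0 <= 1].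

Lemma base_mix (x y : V) s j : base (s *: x + (1 - s) *: y) j =
  s * base x j + (1 - s) * base y j.
Proof. by rewrite /base !mxE. Qed.

Lemma paraboloid_convex : convex_set paraboloid.
Proof.
apply/convex_setP => x y s [x1 x2] [y1 y2] /andP[s0 s1].
have mix (A1 A2 B1 B2 : R) : A1 <= B1 -> A2 <= B2 ->
    s * A1 + (1 - s) * A2 <= s * B1 + (1 - s) * B2.
  by move=> h1 h2; nra.
split; rewrite !mxE; last by have := mix _ _ _ _ x2 y2; lra.
apply: le_trans (mix _ _ _ _ x1 y1).
rewrite !mulr_sumr -big_split/=; apply: ler_sum => j _.
rewrite base_mix -subr_ge0.
rewrite (_ : _ - _ = s * (1 - s) * (base x j - base y j) ^+ 2); last by ring.
by rewrite mulr_ge0 ?sqr_ge0// mulr_ge0// subr_ge0.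
Qed.

Lemma paraboloid_coord v i : paraboloid v -> v ord0 i \in `[- (1 : R), 1].
Proof.
move=> [v1 v2]; rewrite in_itv/=.
have s0 : 0 <= \sum_j base v j ^+ 2 by apply: sumr_ge0 => j _; exact: sqr_ge0.
case: (unliftP ord0 i) => [j|] ->; last by apply/andP; split; lra.
have : base v j ^+ 2 <= 1.
  apply: (@le_trans _ _ (\sum_j base v j ^+ 2)); last by lra.
  by rewrite (bigD1 j)//= lerDl; apply: sumr_ge0 => l _; exact: sqr_ge0.
by rewrite -/(base v j) => h; apply/andP; split; nra.
Qed.

Lemma paraboloid_compact : compact paraboloid.
Proof.
apply: (@subclosed_compact _ _ [set v : V | forall i, `[- (1 : R), 1]%classic (v ord0 i)]).
- have cc i : continuous (fun v : V => v ord0 i : R) by move=> v; exact: coord_continuous.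
  have cs : continuous (fun v : V => v ord0 ord0 - \sum_j base v j ^+ 2).
    have csum (r : seq 'I_e) : continuous (fun v : V => \sum_(j <- r) base v j ^+ 2).
      elim: r => [|j r IH] v.
        by under eq_fun do rewrite big_nil; exact: cst_continuous.
      under eq_fun do rewrite big_cons expr2.
      apply: (@continuousD _ _ _ (fun v : V => base v j * base v j)); last exact: IH.
      exact: (@continuousM _ _ (base^~ j) (base^~ j) v (cc _ v) (cc _ v)).
    move=> v; apply: (@continuousB _ _ _ (fun v : V => v ord0 ord0 : R)); first exact: cc.
    exact: csum.
  rewrite (_ : paraboloid =
      (fun v : V => v ord0 ord0 - \sum_j base v j ^+ 2) @^-1` [set x | 0 <= x] `&`
      (fun v : V => v ord0 ord0 : R) @^-1` [set x | x <= 1]); last first.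
    by apply/seteqP; split=> v; rewrite /paraboloid/= subr_ge0.
  apply: closedI.
    by apply: closed_comp; [move=> v _; exact: cs|exact: closed_ge].
  by apply: closed_comp; [move=> v _; exact: cc|exact: closed_le].
- by apply: (@rV_compact R e.+1 (fun=> `[- (1 : R), 1]%classic)) => i; exact: segment_compact.
- by move=> v pv i /=; exact: paraboloid_coord.
Qed.

Let eR : 1 <= e%:R :> R. Proof. by rewrite ler1n. Qed.

Lemma paraboloid_interior : paraboloid° !=set0.
Proof.
exists (2^-1 *: delta_mx ord0 ord0).
pose r : R := (4 * e%:R)^-1; have e1 := eR.
have er : e%:R * r = 4^-1 by rewrite /r; field; rewrite pnatr_eq0 -lt0n.
have r0 : 0 < r by rewrite invr_gt0; lra.
have r4 : r <= 4^-1 by nra.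
apply/nbhs_ballP; exists r => //= v [_ vr].
have vi i : `|(i == ord0)%:R / 2 - v ord0 i| < r.
  have := vr ord0 i; rewrite -ball_normE/= !mxE eqxx/=.
  by rewrite mulrC.
have v0 : `|2^-1 - v ord0 ord0| < r by have := vi ord0; rewrite eqxx mul1r.
move: v0; rewrite ltr_norml => /andP[v1 v2].
split; last by lra.
apply: (@le_trans _ _ (\sum_(j < e) r ^+ 2)).
  apply: ler_sum => j _; have := vi (lift ord0 j).
  rewrite -[lift ord0 j == ord0]negbK eq_sym neq_lift/= mul0r sub0r normrN -/(base v j).
  by move=> h; rewrite -real_normK ?num_real// lerXn2r ?nnegrE// ltW.
rewrite sumr_const card_ord -mulr_natl; nra.
Qed.

Definition paraboloid_body : convex_body R e.+1 :=
  ConvexBody paraboloid_compact paraboloid_convex paraboloid_interior.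

Lemma lebesgue_paraboloid_le :
  (lebesgue_measure_rV paraboloid <= (2 ^+ e.+1)%:E)%E.
Proof.
apply: (@le_trans _ _ (lebesgue_measure_rV [set v : V | forall i, v ord0 i \in `[-1, 1]])).
  apply: le_measure; rewrite ?inE; first exact: (measurable_body paraboloid_body).
    exact: measurable_box_rV.
  by move=> v pv i; exact: paraboloid_coord.
rewrite (@lebesgue_measure_rV_box R e.+1 (fun=> -1) (fun=> 1)); last by move=> _; lra.
by rewrite lee_fin prodr_const card_ord opprK lexx.
Qed.

Section caps.
Variables (k : nat) (k0 : (0 < k)%N).
Implicit Type a : {ffun 'I_e -> 'I_k}.

Let kR : 1 <= k%:R :> R. Proof. by rewrite ler1n. Qed.

(** The distance between neighbouring grid points; the bases of the caps have
    half of it as radius. *)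
Definition step : R := (2 * e%:R * k%:R)^-1.

Definition grid a (j : 'I_e) : R := (a j)%:R * step.

Definition depth : R := (step / 2) ^+ 2.

(** The cap is [cap_level a < cap_fun a v]: the point [v] is below the plane
    tangent to the paraboloid over the grid point, raised by [depth]. *)
Definition cap_fun a (v : V) : R := (\sum_j 2 * grid a j * base v j) - v ord0 ord0.

Definition cap_level a : R := (\sum_j grid a j ^+ 2) - depth.

Lemma step_gt0 : 0 < step.
Proof. by rewrite invr_gt0 !mulr_gt0//; move: eR kR; lra. Qed.

Lemma cap_fun_mix a x y s :
  cap_fun a (s *: x + (1 - s) *: y) = s * cap_fun a x + (1 - s) * cap_fun a y.
Proof.
rewrite /cap_fun !mulrBr !mulr_sumr !mxE.
under eq_bigr do rewrite base_mix.
rewrite (_ : \sum_j _ = \sum_j s * (2 * grid a j * base x j) +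
    \sum_j (1 - s) * (2 * grid a j * base y j)); first by ring.
by rewrite -big_split/=; apply: eq_bigr => j _; ring.
Qed.

(** In [v] the paraboloid is above its tangent plane by the squared distance of
    the base point to the grid point. *)
Lemma cap_base a v j : paraboloid v -> cap_level a < cap_fun a v ->
  `|base v j - grid a j| < step / 2.
Proof.
move=> [v1 _]; rewrite /cap_level /cap_fun => ca.
have sum_lt : \sum_j (base v j - grid a j) ^+ 2 < depth.
  rewrite (_ : \sum_j _ = \sum_j base v j ^+ 2 + \sum_j grid a j ^+ 2 -
      \sum_j 2 * grid a j * base v j); first by lra.
  by rewrite -big_split/= -sumrB; apply: eq_bigr => l _; ring.
have : (base v j - grid a j) ^+ 2 < (step / 2) ^+ 2.
  apply: le_lt_trans sum_lt.
  by rewrite (bigD1 j)//= lerDl; apply: sumr_ge0 => l _; exact: sqr_ge0.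
rewrite -[in X in X -> _]real_normK ?num_real//.
rewrite ltr_pXn2r// ?nnegrE//.
by rewrite divr_ge0// ltW// step_gt0.
Qed.

Lemma cap_disjoint a b v : paraboloid v ->
  cap_level a < cap_fun a v -> cap_level b < cap_fun b v -> a = b.
Proof.
move=> pv ha hb; apply/ffunP => j; apply/val_inj/eqP.
have := cap_base j pv ha; have := cap_base j pv hb.
rewrite !ltr_norml => /andP[b1 b2] /andP[a1 a2].
have lt1 (x y : nat) : x%:R * step < y%:R * step + step -> (x <= y)%N.
  by rewrite -[X in _ + X]mul1r -mulrDl ltr_pM2r ?step_gt0// natr1 ltr_nat ltnS.
rewrite eqn_leq; apply/andP; split; apply: lt1; move: a1 a2 b1 b2; rewrite /grid; lra.
Qed.

(* A box in the coordinates of the base and of the height over the tangent plane;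
   it is sheared into the cap. *)
Let eta : R := step / (4 * e%:R).

Let slope a : V := \row_i (if unlift ord0 i is Some j then 2 * grid a j else 0).

Let slope_base a j : slope a ord0 (lift ord0 j) = 2 * grid a j.
Proof. by rewrite mxE liftK. Qed.

Let slope_top a : slope a ord0 ord0 = 0.
Proof. by rewrite mxE unlift_none. Qed.

Let lower a i := if unlift ord0 i is Some j then grid a j - eta
  else depth / 2 - \sum_j grid a j ^+ 2.

Let upper a i := if unlift ord0 i is Some j then grid a j + eta
  else 3 * depth / 4 - \sum_j grid a j ^+ 2.

Let box a : set V := [set v | forall i, v ord0 i \in `[lower a i, upper a i]].

Let shear a : 'M[R]_e.+1 := 1%:M + (slope a)^T *m delta_mx ord0 ord0.

Let shear_inv a : invmx (shear a) = 1%:M - (slope a)^T *m delta_mx ord0 ord0.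
Proof.
apply: invmx_eq; rewrite /shear mulmxDl mul1mx mulmxBr mulmx1.
by rewrite shear_into_sqr0 ?slope_top// subr0 subrK.
Qed.

Let shear_coord a (v : V) i : (v *m invmx (shear a)) ord0 i =
  if unlift ord0 i is Some j then base v j else - cap_fun a v.
Proof.
rewrite shear_inv mulmxBr mulmx1 mulmxA.
case: (unliftP ord0 i) => [j|] ->.
  rewrite [LHS]mxE [X in _ + X]mxE [X in - X]mxE big_ord1 [delta_mx _ _ _ _]mxE.
  by rewrite eqxx/= mulr0 subr0.
rewrite [LHS]mxE [X in _ + X]mxE [X in - X]mxE big_ord1 [delta_mx _ _ _ _]mxE !eqxx mulr1.
rewrite mxE big_ord_recl mxE slope_top mulr0 add0r /cap_fun opprB; congr (_ - _).
by apply: eq_bigr => j _; rewrite [_^T _ _]mxE slope_base mulrC.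
Qed.

Let in_cap a : (fun v => v *m invmx (shear a)) @^-1` box a `<=`
  [set v | cap_level a < cap_fun a v] `&` paraboloid.
Proof.
move=> v vb; have st0 := step_gt0.
have ek : step * (2 * e%:R * k%:R) = 1.
  by rewrite mulVf// gt_eqF// !mulr_gt0//; move: eR kR; lra.
have depth0 : 0 < depth by rewrite exprn_gt0// divr_gt0.
have etaE : eta * (4 * e%:R) = step by rewrite divfK// gt_eqF// mulr_gt0//; move: eR; lra.
have eta0 : 0 < eta by rewrite divr_gt0// mulr_gt0//; move: eR; lra.
have := vb ord0; rewrite /= shear_coord /lower /upper unlift_none in_itv/= => /andP[v1 v2].
have vj j : `|base v j - grid a j| <= eta.
  have := vb (lift ord0 j); rewrite /= shear_coord /lower /upper liftK in_itv/=.
  by move=> /andP[h1 h2]; rewrite ler_norml; apply/andP; split; lra.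
have eta2 : e%:R * eta ^+ 2 <= depth / 2.
  rewrite (_ : depth = 4 * e%:R ^+ 2 * eta ^+ 2); last by rewrite /depth -etaE; field.
  have : 0 <= eta ^+ 2 by exact: sqr_ge0.
  move: (eta ^+ 2) (e%:R : R) eR => z x x1 z0; have : 0 <= z * x by rewrite mulr_ge0//; lra.
  nra.
have slopeE : cap_fun a v + v ord0 ord0 = \sum_j 2 * grid a j * base v j.
  by rewrite /cap_fun subrK.
have sq : \sum_j base v j ^+ 2 <= e%:R * eta ^+ 2 + \sum_j 2 * grid a j * base v j -
    \sum_j grid a j ^+ 2.
  rewrite (_ : e%:R * _ = \sum_(j < e) eta ^+ 2); last by rewrite sumr_const card_ord mulr_natl.
  rewrite -big_split/= -sumrB.
  apply: ler_sum => j _; have : (base v j - grid a j) ^+ 2 <= eta ^+ 2.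
    by rewrite -real_normK ?num_real// lerXn2r ?nnegrE ?(ltW eta0).
  by rewrite !expr2; lra.
pose rho := k%:R * step.
have rhoE : rho * (2 * e%:R) = 1 by rewrite -[RHS]ek /rho; ring.
have rho2 : step <= rho <= 2^-1.
  apply/andP; split; first by rewrite /rho ler_peMl ?(ltW st0).
  have r0 : 0 < rho by rewrite /rho mulr_gt0// ltr0n.
  by move: (e%:R : R) eR rhoE => x x1 h; nra.
have eta4 : eta <= rho / 4 by have := eR; move: rho2 => /andP[h1 h2]; nra.
have depth16 : depth <= 16^-1 by rewrite /depth; move: rho2 => /andP[h1 h2]; nra.
move: rho2 => /andP[st_rho rho2].
have flat : \sum_j 2 * grid a j * base v j - \sum_j grid a j ^+ 2 <= 3 / 8.
  rewrite -sumrB; apply: (@le_trans _ _ (\sum_(j < e) 3 / (8 * e%:R))); last first.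
    rewrite sumr_const card_ord -[leLHS]mulr_natl (_ : _ * _ = 3 / 8)//.
    by field; rewrite pnatr_eq0 -lt0n.
  apply: ler_sum => j _.
  have gE : grid a j <= rho by rewrite /grid /rho; apply: ler_wpM2r; [exact: ltW|rewrite ler_nat ltnW].
  have g0 : 0 <= grid a j by rewrite mulr_ge0// ltW.
  have := vj j; rewrite ler_norml => /andP[_ bg].
  rewrite (_ : 3 / (8 * e%:R) = 3 / 4 * rho); last first.
    by rewrite /rho /step; field; rewrite !pnatr_eq0 -!lt0n k0.
  have : grid a j * (base v j - grid a j) <= grid a j * (rho / 4).
    by apply: ler_wpM2l => //; lra.
  have : grid a j * (grid a j + rho / 2) <= rho * (grid a j + rho / 2).
    by apply: ler_wpM2r => //; lra.
  have : rho * (grid a j + rho / 2) <= rho * (3 / 4).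
    by apply: ler_wpM2l; lra.
  by move: (grid a j) (base v j) => g b; rewrite !expr2; lra.
split; first by rewrite /= /cap_level; lra.
split; first by lra.
lra.
Qed.

Lemma measurable_cap a : measurable [set v | cap_level a < cap_fun a v].
Proof.
have mf : measurable_fun setT (cap_fun a : V -> measurableTypeR R).
  apply: measurable_funB; last exact: measurable_coord_rV.
  apply: measurable_sum => j; apply: measurable_funM => //.
  exact: measurable_coord_rV.
rewrite -[X in measurable X]setTI (_ : mkset _ = cap_fun a @^-1` `]cap_level a, +oo[).
  by apply: mf => //; exact: measurable_itv.
by apply/seteqP; split=> v /=; rewrite in_itv/= andbT.
Qed.

Lemma cap_volume a :
  (((2 * eta) ^+ e * (depth / 4))%:E <=
   lebesgue_measure_rV ([set v | (cap_level a < cap_fun a v)%R] `&` paraboloid))%E.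
Proof.
have st0 := step_gt0.
have depth0 : 0 < depth by rewrite exprn_gt0// divr_gt0.
have eta0 : 0 < eta by rewrite divr_gt0// mulr_gt0//; move: eR; lra.
have mbox : measurable (box a) by exact: measurable_box_rV.
have ab : forall i, lower a i <= upper a i.
  by move=> i; rewrite /lower /upper; case: unlift => [j|]; lra.
have [uS jS] : shear a \in unitmx /\ jac (shear a) = 1.
  by apply: jac_shear_into; exact: slope_top.
apply: (@le_trans _ _ (lebesgue_measure_rV ((fun v => v *m invmx (shear a)) @^-1` box a))).
  rewrite lebesgue_rV_linear// jS mul1e lebesgue_measure_rV_box//.
  rewrite lee_fin big_ord_recl /lower /upper unlift_none.
  rewrite [X in _ <= _ * X](eq_bigr (fun=> 2 * eta)) => [|j _]; last by rewrite liftK; ring.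
  rewrite prodr_const card_ord mulrC; apply: ler_wpM2r; first by rewrite exprn_ge0// mulr_ge0// ltW.
  lra.
apply: le_measure; rewrite ?inE//.
- exact: measurable_mulmx_preimage.
- by apply: measurableI; [exact: measurable_cap|exact: (measurable_body paraboloid_body)].
Qed.

Lemma cap_probability a :
  (((4 * e%:R ^+ 2)^-1 ^+ e * (64 * e%:R ^+ 2)^-1 / 2 ^+ e.+1 / k%:R ^+ e.+2)%:E <=
   uniform_law paraboloid_body [set v | (cap_level a < cap_fun a v)%R])%E.
Proof.
rewrite /uniform_law.
have L0 : 0 < fine (lebesgue_measure_rV paraboloid).
  by rewrite fine_gt0// (lebesgue_body_gt0 paraboloid_body) (lebesgue_body_lty paraboloid_body).
have L1 : fine (lebesgue_measure_rV paraboloid) <= 2 ^+ e.+1.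
  by rewrite -lee_fin fineK ?lebesgue_paraboloid_le// ge0_fin_numE// (lebesgue_body_lty paraboloid_body).
apply: le_trans (lee_wpmul2r _ (cap_volume a)); last by rewrite lee_fin invr_ge0 ltW.
rewrite -EFinM lee_fin.
have st0 := step_gt0; have depth0 : 0 < depth by rewrite exprn_gt0// divr_gt0.
have eta0 : 0 < eta by rewrite divr_gt0// mulr_gt0//; move: eR; lra.
apply: (@le_trans _ _ ((2 * eta) ^+ e * (depth / 4) / 2 ^+ e.+1)); last first.
  apply: ler_wpM2l; last by rewrite lef_pV2// posrE exprn_gt0.
  apply: mulr_ge0; last by rewrite divr_ge0// ltW.
  by rewrite exprn_ge0// mulr_ge0// ltW.
rewrite (_ : 2 * eta = (4 * e%:R ^+ 2)^-1 / k%:R); last first.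
  by rewrite /eta /step; field; rewrite !pnatr_eq0 -!lt0n k0.
rewrite (_ : depth / 4 = (64 * e%:R ^+ 2)^-1 / k%:R ^+ 2); last first.
  by rewrite /depth /step; field; rewrite !pnatr_eq0 -!lt0n k0.
rewrite (_ : k%:R ^+ e.+2 = k%:R ^+ e * k%:R ^+ 2); last by rewrite -exprD addn2.
rewrite exprMn [k%:R^-1 ^+ e]exprVn [(k%:R ^+ e * _)^-1]invfM.
by rewrite le_eqVlt; apply/orP; left; apply/eqP; ring.
Qed.

End caps.
End paraboloid.

(** * Independent points hitting many sets *)

(** The tangent line of the power function at [mu]: integrated, and with the mean
    for [mu], it is Jensen's inequality. *)
Lemma tangent_pow (R : realFieldType) (x mu : R) q : 0 <= x -> 0 <= mu ->
  q.+1%:R * mu ^+ q * x <= x ^+ q.+1 + q%:R * mu ^+ q.+1.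
Proof.
move=> x0 mu0; elim: q => [|q IH]; first by rewrite !expr1 expr0 mul0r addr0 !mul1r.
have := ler_wpM2l x0 IH.
have m0 : 0 <= mu ^+ q by exact: exprn_ge0.
have : 0 <= q.+1%:R * mu ^+ q * ((x - mu) * (x - mu)).
  by rewrite -expr2 mulr_ge0 ?sqr_ge0// mulr_ge0.
rewrite !exprS -!natr1; move: (mu ^+ q) (x ^+ q) (q%:R : R) => z w y h1.
rewrite -subr_ge0 => h2; rewrite -subr_ge0.
rewrite (_ : _ - _ = (x * (x * w + y * (mu * z)) - x * ((y + 1) * z * x)) +
  (y + 1) * z * ((x - mu) * (x - mu))); last by ring.
by apply: addr_ge0.
Qed.

Lemma pow_complement_le (R : realFieldType) (p : R) n : 0 <= p <= 1 ->
  n%:R * p / (1 + n%:R * p) <= 1 - (1 - p) ^+ n.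
Proof.
move=> /andP[p0 p1]; have np0 : 0 <= n%:R * p by rewrite mulr_ge0.
have q0 : 0 <= (1 - p) ^+ n by rewrite exprn_ge0// subr_ge0.
have : (1 - p) ^+ n * (1 + n%:R * p) <= 1.
  elim: n {np0 q0} => [|n IH]; first by rewrite expr0 mul0r addr0 mulr1.
  apply: le_trans IH; rewrite exprS -natr1 -mulrA mulrCA.
  apply: ler_wpM2l; first by rewrite exprn_ge0// subr_ge0.
  have : 0 <= n%:R * p * p by rewrite !mulr_ge0.
  move: (n%:R : R) => z; nra.
rewrite ler_pdivrMr; last by lra.
move: ((1 - p) ^+ n) (n%:R * p) => u v; lra.
Qed.

Section hit_probability.
Context d (T : measurableType d) (R : realType) (P : probability T R).

Lemma measurable_tuple_box n (A : set T) : measurable A ->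
  measurable [set t : n.-tuple T | forall i, A (tnth t i)].
Proof.
move=> mA; rewrite (_ : mkset _ = \bigcap_(i in [set: 'I_n]) ((@tnth n T)^~ i @^-1` A)).
  apply: fin_bigcap_measurable => // i _.
  by rewrite -[X in measurable X]setTI; exact: measurable_tnth.
by apply/seteqP; split=> t /= h i; [move=> _|]; exact: h.
Qed.

(** All points are in [K], and one of them is in [C]: a difference of two product
    events. *)
Definition hit_event n (K C : set T) : set (n.-tuple T) :=
  [set t | forall i, K (tnth t i)] `\` [set t | forall i, (K `\` C) (tnth t i)].
Arguments hit_event n K C : clear implicits.

Lemma measurable_hit_event n (K C : set T) : measurable K -> measurable C ->
  measurable (hit_event n K C).
Proof.
by move=> mK mC; apply: measurableD; apply: measurable_tuple_box => //; exact: measurableD.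
Qed.

Lemma hit_event_probability n (K C : set T) (p : R) :
  measurable K -> measurable C -> P K = 1%E -> 0 <= p -> (p%:E <= P C)%E ->
  ((n%:R * p / (1 + n%:R * p))%:E <= iid_law P n (hit_event n K C))%E.
Proof.
move=> mK mC PK p0 pC.
have p1 : p <= 1 by rewrite -lee_fin; exact: le_trans pC (probability_le1 P mC).
have mKC : measurable (K `\` C) by exact: measurableD.
have mKn := @measurable_tuple_box n K mK; have mKCn := @measurable_tuple_box n _ mKC.
rewrite /hit_event (measureD mKn mKCn); last first.
  exact: le_lt_trans (probability_le1 (iid_law P n) mKn) (ltry 1).
rewrite setIidr; last by move=> t /= tKC i; case: (tKC i).
have boxE (A : set T) : measurable A ->
    iid_law P n [set t | forall i, A (tnth t i)] = (\prod_(i < n) P A)%E.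
  by move=> mA; exact: (@tuple_measure_box _ _ _ P n (fun=> A)).
rewrite [X in (X - _)%E](boxE K mK) [X in (_ - X)%E](boxE _ mKC).
rewrite PK big1_eq.
apply: (@le_trans _ _ (1 - (1 - p) ^+ n)%:E).
  by rewrite lee_fin; apply: pow_complement_le; rewrite p0.
have KC1 : (P (K `\` C) <= (1 - p)%:E)%E.
  apply: (@le_trans _ _ (P (~` C))).
    by apply: le_measure; rewrite ?inE//; exact: measurableC.
  by rewrite probability_setC// EFinB leeB.
rewrite EFinB leeB// -(fineK (fin_num_measure P _ mKC)) prodEFin prodr_const card_ord lee_fin.
apply: lerXn2r; rewrite ?nnegrE ?fine_ge0 ?subr_ge0//.
by rewrite -lee_fin fineK// fin_num_measure.
Qed.

(** Each set is hit with probability at least [c / (1 + c)], so that the expected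
    number of hit sets is at least the value [mu] where the tangent is taken. *)
Lemma hit_moment n q (I : finType) (K : set T) (C : I -> set T) (p c : R)
    (f : n.-tuple T -> nat) :
  (0 < q)%N -> measurable K -> (forall a, measurable (C a)) -> P K = 1%E ->
  0 <= p -> 0 <= c -> c <= n%:R * p -> (forall a, (p%:E <= P (C a))%E) ->
  (forall t, (forall i, K (tnth t i)) ->
     (#|[pred a | `[< exists i, C a (tnth t i) >]]| <= f t)%N) ->
  (((#|I|%:R * (c / (1 + c))) ^+ q)%:E <= \int[iid_law P n]_t ((f t)%:R ^+ q)%:E)%E.
Proof.
case: q => // q _ mK mC PK p0 c0 cnp pC ft.
set mu := #|I|%:R * (c / (1 + c)).
have mu0 : 0 <= mu by rewrite mulr_ge0// divr_ge0//; lra.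
pose g (t : n.-tuple T) : R := \sum_(a : I) \1_(hit_event n K (C a)) t.
have g0 t : 0 <= g t by apply: sumr_ge0 => a _; rewrite indicE.
have gf t : g t <= (f t)%:R.
  have [tK|ntK] := pselect (forall i, K (tnth t i)); last first.
    rewrite /g big1// => a _; rewrite indicE memNset//.
    by move=> [tK _]; exact: ntK.
  apply: le_trans (_ : _ <= #|[pred a | `[< exists i, C a (tnth t i) >]]|%:R) _; last first.
    by rewrite ler_nat ft.
  rewrite -sum1_card natr_sum big_mkcond/=; apply: ler_sum => a _.
  rewrite indicE inE; case: asboolP => [_|nC]; first by rewrite lern1 leq_b1.
  rewrite memNset// => -[_]; apply => i; split; first exact: tK.
  by move=> Ci; apply: nC; exists i.
have mg : measurable_fun setT (fun t => (g t)%:E).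
  apply/measurable_EFinP; apply: measurable_sum => a.
  by apply: measurable_indic; exact: measurable_hit_event.
have Eg : (mu%:E <= \int[iid_law P n]_t (g t)%:E)%E.
  under eq_integral do rewrite -sumEFin.
  rewrite ge0_integral_sum//; last first.
    by move=> a; apply/measurable_EFinP; apply: measurable_indic; exact: measurable_hit_event.
  apply: (@le_trans _ _ (\sum_(a : I) (c / (1 + c))%:E)%E).
    by rewrite sumEFin sumr_const -mulr_natl.
  apply: lee_sum => a _; rewrite integral_indic//; last exact: measurable_hit_event.
  rewrite setIT; apply: le_trans (hit_event_probability n mK (mC a) PK p0 (pC a)).
  rewrite lee_fin ler_pdivrMr; last by lra.
  rewrite mulrAC ler_pdivlMr; last by lra.
  by move: (n%:R * p) cnp => z cz; nra.
have fin : (\int[iid_law P n]_t ((f t)%:R ^+ q.+1)%:E + (q%:R * mu ^+ q.+1)%:E >=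
    (q.+1%:R * mu ^+ q.+1)%:E)%E.
  apply: (@le_trans _ _ (\int[iid_law P n]_t ((q.+1%:R * mu ^+ q)%:E * (g t)%:E))%E).
    rewrite ge0_integralZl_EFin//; last 2 first.
    - by move=> t _; rewrite lee_fin.
    - by rewrite mulr_ge0 ?exprn_ge0.
    rewrite exprSr mulrA EFinM; apply: lee_wpmul2l => //.
    by rewrite lee_fin mulr_ge0 ?exprn_ge0.
  apply: (@le_trans _ _ (\int[iid_law P n]_t (((g t) ^+ q.+1)%:E + (q%:R * mu ^+ q.+1)%:E))%E).
    apply: ge0_le_integral_any => t.
      by rewrite -EFinM lee_fin mulr_ge0// mulr_ge0 ?exprn_ge0.
    by rewrite -EFinM -EFinD lee_fin tangent_pow.
  rewrite ge0_integralD//; last 3 first.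
  - by move=> t _; rewrite lee_fin exprn_ge0.
  - by apply/measurable_EFinP; apply: measurable_funX; exact/measurable_EFinP.
  - by move=> t _; rewrite lee_fin mulr_ge0 ?exprn_ge0.
  rewrite integral_cst// [X in (_ + _ * X)%E]probability_setT mule1 leeD2r//.
  apply: ge0_le_integral_any => t; first by rewrite lee_fin exprn_ge0.
  by rewrite lee_fin lerXn2r ?nnegrE.
move: fin; rewrite -leeBlDr// -EFinB; apply: le_trans.
by rewrite lee_fin -natr1 mulrDl mul1r addrAC subrr add0r.
Qed.

End hit_probability.

(** With [k ^ (d + 1) <= n] each cap contains at least [c] sample points in the
    mean. *)
Lemma vertices_lower (R : realType) e q (e0 : (0 < e)%N) : (0 < q)%N ->
  exists2 c : R, 0 < c & forall k n, (0 < k)%N -> (k ^ e.+2 <= n)%N ->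
    ((c * k%:R ^+ (q * e))%:E <=
     \int[iid_law (uniform_law (@paraboloid_body R e e0)) n]_t
       ((n_vertices t)%:R ^+ q : R)%:E)%E.
Proof.
move=> q0; have eR : 0 < e%:R :> R by rewrite ltr0n.
pose c : R := (4 * e%:R ^+ 2)^-1 ^+ e * (64 * e%:R ^+ 2)^-1 / 2 ^+ e.+1.
have c0 : 0 < c.
  by rewrite !mulr_gt0 ?invr_gt0 ?exprn_gt0 ?invr_gt0 ?mulr_gt0 ?exprn_gt0.
have c1 : 0 < c / (1 + c) by rewrite divr_gt0// addr_gt0.
exists ((c / (1 + c)) ^+ q) => [|k n k0 kn]; first exact: exprn_gt0.
have kR : 0 < k%:R ^+ e.+2 :> R by rewrite exprn_gt0// ltr0n.
set K := paraboloid_body R e0.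
have mK : measurable (body K) by exact: measurable_body.
have PK : uniform_law K (body K) = 1%E.
  transitivity (uniform_law K setT); last exact: probability_setT.
  by rewrite /uniform_law setIid setTI.
pose C (a : {ffun 'I_e -> 'I_k}) := [set v | cap_level R a < cap_fun a v].
have mC a : measurable (C a) by exact: measurable_cap.
have pC a : ((c / k%:R ^+ e.+2)%:E <= uniform_law K (C a))%E by exact: cap_probability.
have vC (t : n.-tuple 'rV[R]_e.+1) : (forall i, body K (tnth t i)) ->
    (#|[pred a | `[< exists i, C a (tnth t i) >]]| <= n_vertices t)%N.
  move=> tK; have := @n_vertices_disjoint R e.+1 n t _ (@cap_fun R e k) (@cap_level R e k)
    (body K) (@cap_fun_mix R e k) tK.
  move=> /(_ (fun a b v => @cap_disjoint R e e0 k k0 a b v)).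
  apply: leq_trans; apply: eq_leq; apply: eq_card => a; rewrite !inE.
  by apply/asboolP/existsP => -[i Ci]; exists i.
have := @hit_moment _ _ R (uniform_law K) n q _ (body K) C (c / k%:R ^+ e.+2) c _ q0 mK mC PK
  _ (ltW c0) _ pC vC.
rewrite card_ffun !card_ord natrX exprMn -exprM (mulnC e).
rewrite [(c / (1 + c)) ^+ q * _]mulrC; apply; first by rewrite divr_ge0 ?ltW.
rewrite mulrCA ler_peMr ?(ltW c0)// ler_pdivlMr// mul1r -natrX ler_nat//.
Qed.

(** * The order of the moments *)

(** Take the integer part of the root. *)
Lemma nat_root (D n : nat) : (0 < D)%N -> (0 < n)%N ->
  exists2 k, (0 < k)%N & (k ^ D <= n < (2 * k) ^ D)%N.
Proof.
move=> D0 n0; have ex : exists k, (k ^ D <= n)%N by exists 1; rewrite exp1n.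
have ub k : (k ^ D <= n)%N -> (k <= n)%N.
  by apply: leq_trans; case: k => // k; rewrite -[X in (X <= _)%N]expn1 leq_pexp2l.
case: (ex_maxnP ex ub) => k kn kmax.
have k0 : (0 < k)%N by apply: kmax; rewrite exp1n.
exists k => //; rewrite kn/= ltnNge; apply/negP => h; have := kmax _ h; lia.
Qed.

Lemma powR_rate (R : realType) (k e q : nat) :
  (k%:R ^+ e.+2 : R) `^ (q%:R * (e.+1%:R - 1) / (e.+1%:R + 1)) = k%:R ^+ (q * e).
Proof.
rewrite -powR_mulrn// -powRrM -[RHS]powR_mulrn//; congr (_ `^ _).
by rewrite natr1 -[e.+1%:R]natr1 addrK natrM mulrC divfK// pnatr_eq0.
Qed.

Lemma ler_powR_rate (R : realType) (x y : nat) e q : (x <= y)%N ->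
  (x%:R : R) `^ (q%:R * (e.+1%:R - 1) / (e.+1%:R + 1)) <=
  y%:R `^ (q%:R * (e.+1%:R - 1) / (e.+1%:R + 1)).
Proof.
move=> xy; apply: ge0_ler_powR; rewrite ?nnegrE ?ler_nat//.
Qed.

(** For [n = 1] the sample cannot be split, but there is at most one vertex. *)
Lemma vertices_upper_rate (R : realType) e q : (0 < e)%N -> (0 < q)%N ->
  exists2 B : R, 0 < B & forall (K : convex_body R e.+1) n, (0 < n)%N ->
    (\int[iid_law (uniform_law K) n]_t ((n_vertices t)%:R ^+ q : R)%:E <=
     (B * n%:R `^ (q%:R * (e.+1%:R - 1) / (e.+1%:R + 1)))%:E)%E.
Proof.
move=> e0 q0; have [B B0 BP] := @vertices_upper R e.+1 q e0 q0.
exists (B * (1 + 2 ^+ (q * e.+2)) + 1) => [|K n n0].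
  by rewrite addr_gt0// mulr_gt0// addr_gt0// exprn_gt0.
have [k k0 /andP[kn nk]] := @nat_root e.+2 n isT n0.
have kR : 1 <= k%:R :> R by rewrite ler1n.
set rate : R := n%:R `^ _.
have rate_ge : k%:R ^+ (q * e) <= rate.
  by rewrite -powR_rate -natrX; exact: ler_powR_rate.
have rate1 : 1 <= rate by apply: le_trans rate_ge; rewrite exprn_ege1.
have p20 : 0 <= 2 ^+ (q * e.+2) :> R by rewrite exprn_ge0.
have [n1|n1] := leqP n 1.
  apply: (@le_trans _ _ (\int[iid_law (uniform_law K) n]_t 1%:E)%E).
    apply: ge0_le_integral_any => t; first by rewrite lee_fin exprn_ge0.
    by rewrite lee_fin exprn_ile1// lern1 (leq_trans (n_vertices_le t)).
  rewrite integral_cst// [X in (_ * X)%E]probability_setT mule1 lee_fin.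
  have : 0 <= B * (1 + 2 ^+ (q * e.+2)) by rewrite mulr_ge0 ?(ltW B0)// addr_ge0.
  move: (_ * (1 + _)) => x x0; nra.
have nE : n = (n./2 + (n - n./2))%N by lia.
have km : (k ^ e.+2 <= 3 * n./2)%N by lia.
have km' : (k ^ e.+2 <= 3 * (n - n./2))%N by lia.
have := BP K k _ _ k0 km km'; rewrite -nE => /le_trans; apply.
rewrite lee_fin; apply: (@le_trans _ _ (B * (1 + 2 ^+ (q * e.+2)) * rate)); last first.
  by apply: ler_wpM2r; [exact: le_trans rate1|lra].
rewrite -mulrA; apply: ler_wpM2l; first exact: ltW.
have : n%:R ^+ q / k%:R ^+ (2 * q) <= 2 ^+ (q * e.+2) * k%:R ^+ (q * e) :> R.
  rewrite ler_pdivrMr; last by rewrite exprn_gt0// ltr0n.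
  apply: (@le_trans _ _ (((2 * k) ^ e.+2)%:R ^+ q)).
    by apply: lerXn2r; rewrite ?nnegrE// ler_nat ltnW.
  rewrite -!natrX -!natrM ler_nat -!expnM expnMn -mulnA -expnD.
  by rewrite (mulnC e.+2) [(2 * q)%N]mulnC -mulnDr addn2.
have := ler_wpM2l p20 rate_ge.
rewrite mulrDl mul1r => h1 h2; apply: lerD => //; exact: le_trans h2 h1.
Qed.

Theorem theorem5 (R : realType) (d : nat) (hd : (2 <= d)%N)
    (q : nat) (hq : (0 < q)%N) :
  exists b B : R, 0 < b /\ 0 < B /\
    forall n : nat, (0 < n)%N ->
      ((b * n%:R `^ (q%:R * (d%:R - 1) / (d%:R + 1)))%:E
       <= ereal_sup [set 'E_(iid_law (uniform_law K) n)
                           [fun x => ((n_vertices x)%:R ^+ q)%R]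
                    | K in [set: convex_body R d]]
       <= (B * n%:R `^ (q%:R * (d%:R - 1) / (d%:R + 1)))%:E)%E.
Proof.
case: d hd => // e e0.
have [c c0 cP] := @vertices_lower R e q e0 hq.
have [B B0 BP] := @vertices_upper_rate R e q e0 hq.
exists (c / 2 ^+ (q * e)), B; split; first by rewrite divr_gt0// exprn_gt0.
split => // n n0; apply/andP; split; last first.
  by apply: ge_ereal_sup => _ [K _ <-]; rewrite unlock; exact: BP.
have [k k0 /andP[kn nk]] := @nat_root e.+2 n isT n0.
apply: (@le_trans _ _ (c * k%:R ^+ (q * e))%:E).
  rewrite lee_fin -mulrA; apply: ler_wpM2l; first exact: ltW.
  rewrite [leLHS]mulrC ler_pdivrMr ?exprn_gt0//.
  rewrite [leRHS]mulrC -exprMn -natrM -powR_rate -natrX.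
  by apply: ler_powR_rate; exact: ltnW.
apply: (le_trans (cP k n k0 kn)); apply: ereal_sup_ubound.
by exists (paraboloid_body R e0) => //; rewrite unlock.
Qed.
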